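(* Consider the full dynamic model of a rigid body payload, $n$ links and $n$ quadrotors described in the context, with control inputs $\{f_i,M_i\}_{1\le i\le n}$, $f_i\in\mathbb{R}$, $M_i\in\mathbb{R}^3$, where the force of the $i$-th quadrotor is $u_i=-f_iR_ie_3$. For given tracking commands $x_{0_d}(t)\in\mathbb{R}^3$, $R_{0_d}(t)\in\mathsf{SO(3)}$ and the desired direction of the first body-fixed axis $b_{1_i}(t)\in\mathsf{S}^2$ of each quadrotor, let the control inputs for the quadrotors be designed as $$f_i=-u_i^*\cdot R_ie_3,$$ $$M_i=-\frac{k_R}{\epsilon^2}e_{R_i}-\frac{k_\Omega}{\epsilon}e_{\Omega_i}+\Omega_i\times J_i\Omega_i-J_i(\hat\Omega_iR_i^TR_{i_c}\Omega_{i_c}-R_i^TR_{i_c}\dot\Omega_{i_c}),$$ where $\epsilon,k_R,k_\Omega$ are positive constants and the ideal control force $u_i^*$, the attitude command $R_{i_c},\Omega_{i_c}$ and the errors $e_{R_i},e_{\Omega_i}$ are defined in the context. Then there exists $\epsilon^\star>0$ such that for all $\epsilon<\epsilon^\star$ the zero equilibrium of the tracking errors $(e_{x_0},\dot e_{x_0},e_{R_0},e_{\Omega_0},e_{q_i},e_{\omega_i},e_{R_i},e_{\Omega_i})$ is exponentially stable.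
   Context: **Notation.** $\mathsf{SO(3)}=\{R\in\mathbb{R}^{3\times3}: R^TR=I,\ \det R=1\}$, $\mathsf{S}^2=\{q\in\mathbb{R}^3:\|q\|=1\}$. The hat map $\hat{\cdot}$ (also written $(\cdot)^\wedge$) sends $x\in\mathbb{R}^3$ to the skew-symmetric matrix with $\hat xy=x\times y$ for all $y\in\mathbb{R}^3$; its inverse is the vee map $(\cdot)^\vee$. $e_3=[0,0,1]^T$ points downward along gravity, $g$ is the gravitational acceleration. The index $i$ ranges over $1,\dots,n$. **Physical data.** A rigid body payload (mass $m_0$, inertia matrix $J_0\in\mathbb{R}^{3\times3}$) is connected by $n$ massless rigid links of lengths $l_i$ to $n$ quadrotors of masses $m_i$ and inertia matrices $J_i\in\mathbb{R}^{3\times3}$. The $i$-th link joins the mass center of the $i$-th quadrotor to the point $\rho_i\in\mathbb{R}^3$ of the payload (expressed in the payload body frame). Let $$\mathcal P=\begin{bmatrix}I_{3\times3}&\cdots&I_{3\times3}\\ \hat\rho_1&\cdots&\hat\rho_n\end{bmatrix}\in\mathbb{R}^{6\times3n};$$ it is assumed that $\mathrm{rank}[\mathcal P]\ge6$. **State.** Payload position $x_0\in\mathbb{R}^3$ and velocity $\dot x_0$, payload attitude $R_0\in\mathsf{SO(3)}$ and body angular velocity $\Omega_0\in\mathbb{R}^3$, link directions $q_i\in\mathsf{S}^2$ (from quadrotor $i$ toward the payload) and link angular velocities $\omega_i\in\mathbb{R}^3$ with $q_i\cdot\omega_i=0$, quadrotor attitudes $R_i\in\mathsf{SO(3)}$ and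 body angular velocities $\Omega_i\in\mathbb{R}^3$. **Full dynamic model.** Kinematics: $\dot q_i=\omega_i\times q_i$, $\dot R_0=R_0\hat\Omega_0$, $\dot R_i=R_i\hat\Omega_i$. Put $u_i^\parallel=q_iq_i^Tu_i$, $u_i^\perp=(I-q_iq_i^T)u_i$ for the force $u_i=-f_iR_ie_3$. With $M_q=m_0I+\sum_{i=1}^nm_iq_iq_i^T$, $$M_q(\ddot x_0-ge_3)-\sum_{i=1}^nm_iq_iq_i^TR_0\hat\rho_i\dot\Omega_0=\sum_{i=1}^n\left(u_i^\parallel-m_il_i\|\omega_i\|^2q_i-m_iq_iq_i^TR_0\hat\Omega_0^2\rho_i\right),$$ $$\Big(J_0-\sum_{i=1}^nm_i\hat\rho_iR_0^Tq_iq_i^TR_0\hat\rho_i\Big)\dot\Omega_0+\sum_{i=1}^nm_i\hat\rho_iR_0^Tq_iq_i^T(\ddot x_0-ge_3)+\hat\Omega_0J_0\Omega_0=\sum_{i=1}^n\hat\rho_iR_0^T\left(u_i^\parallel-m_il_i\|\omega_i\|^2q_i-m_iq_iq_i^TR_0\hat\Omega_0^2\rho_i\right),$$ $$\dot\omega_i=\frac1{l_i}\hat q_i\left(\ddot x_0-ge_3-R_0\hat\rho_i\dot\Omega_0+R_0\hat\Omega_0^2\rho_i\right)-\frac1{m_il_i}\hat q_iu_i^\perp,$$ $$J_i\dot\Omega_i+\Omega_i\times J_i\Omega_i=M_i.$$ **Commands.** $x_{0_d}(t)$, $R_{0_d}(t)$ and $b_{1_i}(t)$ are smooth; $\Omega_{0_d}$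 is defined by $\dot R_{0_d}=R_{0_d}\hat\Omega_{0_d}$; the velocity and the acceleration of the desired trajectories $x_{0_d},R_{0_d}$ are assumed to be bounded by known constants. **Payload errors.** $e_{x_0}=x_0-x_{0_d}$, $e_{R_0}=\frac12(R_{0_d}^TR_0-R_0^TR_{0_d})^\vee$, $e_{\Omega_0}=\Omega_0-R_0^TR_{0_d}\Omega_{0_d}$. **Ideal control force $u_i^*$** (designed for the simplified model in which the quadrotor attitude dynamics are ignored and $u_i$ may be chosen arbitrarily). For positive constants $k_{x_0},k_{\dot x_0},k_{R_0},k_{\Omega_0},k_q,k_\omega$ let $$F_d=m_0(-k_{x_0}e_{x_0}-k_{\dot x_0}\dot e_{x_0}+\ddot x_{0_d}-ge_3),$$ $$M_d=-k_{R_0}e_{R_0}-k_{\Omega_0}e_{\Omega_0}+(R_0^TR_{0_d}\Omega_{0_d})^\wedge J_0R_0^TR_{0_d}\Omega_{0_d}+J_0R_0^TR_{0_d}\dot\Omega_{0_d},$$ $$\begin{bmatrix} \mu_{1_d} \\ \vdots \\ \mu_{n_d} \end{bmatrix}=\mathrm{diag}[R_0,\dots,R_0]\,\mathcal P^T(\mathcal P\mathcal P^T)^{-1}\begin{bmatrix} R_0^TF_d \\ M_d \end{bmatrix},\qquad \mu_i=q_iq_i^T\mu_{i_d},\qquad q_{i_d}=-\frac{\mu_{i_d}}{\|\mu_{i_d}\|}.$$ Let $a_i=\ddot x_0-ge_3+R_0\hat\Omega_0^2\rho_i-R_0\hat\rho_i\dot\Omega_0$ be the acceleration of the $i$-th attachment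 point relative to gravity; substituting the payload equations $m_0(\ddot x_0-ge_3)=\sum_j\mu_j$ and $J_0\dot\Omega_0+\hat\Omega_0J_0\Omega_0=\sum_j\hat\rho_jR_0^T\mu_j$ that result in the simplified model, it is expressed as $$a_i=\frac1{m_0}\sum_{j=1}^n\mu_j+R_0\hat\Omega_0^2\rho_i+R_0\hat\rho_iJ_0^{-1}\Big(\hat\Omega_0J_0\Omega_0-\sum_{j=1}^n\hat\rho_jR_0^T\mu_j\Big).$$ The link commands and errors are $$\omega_{i_d}=q_{i_d}\times\dot q_{i_d},\qquad e_{q_i}=q_{i_d}\times q_i,\qquad e_{\omega_i}=\omega_i+\hat q_i^2\omega_{i_d},$$ and the ideal control force is the sum of its components parallel and normal to $q_i$: $$u_i^*=\big[\mu_i+m_il_i\|\omega_i\|^2q_i+m_iq_iq_i^Ta_i\big]+\big[m_il_i\hat q_i\{-k_qe_{q_i}-k_\omega e_{\omega_i}-(q_i\cdot\omega_{i_d})\dot q_i-\hat q_i^2\dot\omega_{i_d}\}-m_i\hat q_i^2a_i\big].$$ **Quadrotor attitude command and errors.** With $b_{3_i}=-u_i^*/\|u_i^*\|$, $$R_{i_c}=\begin{bmatrix}-\dfrac{(\hat b_{3_i})^2b_{1_i}}{\|(\hat b_{3_i})^2b_{1_i}\|},&\dfrac{\hat b_{3_i}b_{1_i}}{\|\hat b_{3_i}b_{1_i}\|},&b_{3_i}\end{bmatrix}\in\mathsf{SO(3)},\qquad \Omega_{i_c}=(R_{i_c}^T\dot R_{i_c})^\vee,$$ $$e_{R_i}=\tfrac12(R_{i_c}^TR_i-R_i^TR_{i_c})^\vee,\qquad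 e_{\Omega_i}=\Omega_i-R_i^TR_{i_c}\Omega_{i_c}.$$
   Formalization: Added: along the desired motion ‖μ_id‖ is bounded below by a positive constant, and second and third derivatives of the velocity commands are bounded; dots inside u_i^* are taken along the simplified model; the bound is for trajectories on which the control law is defined. *)

(* Defs.v *)
From HB Require Import structures.
From mathcomp Require Import all_boot all_order all_algebra.
From mathcomp Require Import all_classical all_reals all_analysis.

Set Implicit Arguments.
Unset Strict Implicit.
Unset Printing Implicit Defensive.

Import Order.TTheory GRing.Theory Num.Theory.
Import numFieldNormedType.Exports.

Local Open Scope ring_scope.

(* MathComp world, with MathComp-Analysis. *)

Section Vectors.
Variable R : realType.
Implicit Types (x y : 'cV[R]_3) (A : 'M[R]_3).

Definition dot x y : R := (x^T *m y) 0 0.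

(* The library norm on matrices is the maximum norm. *)
Definition enorm x : R := Num.sqrt (dot x x).

Definition hat x : 'M[R]_3 :=
  \matrix_(i < 3, j < 3)
    nth 0 (nth [::] [:: [:: 0            ; - x 2%:R 0 ; x 1 0   ];
                        [:: x 2%:R 0     ; 0          ; - x 0 0 ];
                        [:: - x 1 0      ; x 0 0      ; 0       ]] i) j.

Definition cross x y : 'cV[R]_3 := hat x *m y.

(* Only meaningful on skew-symmetric matrices, where it inverts [hat]. *)
Definition vee A : 'cV[R]_3 :=
  \col_(i < 3) nth 0 [:: A 2%:R 1; A 0 2%:R; A 1 0] i.

Lemma crossE x y : cross x y =
  \col_(i < 3) nth 0 [:: x 1 0 * y 2%:R 0 - x 2%:R 0 * y 1 0;
                         x 2%:R 0 * y 0 0 - x 0 0 * y 2%:R 0;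
                         x 0 0 * y 1 0 - x 1 0 * y 0 0] i.
Proof.
apply/colP => i; rewrite !mxE !big_ord_recl big_ord0 !mxE /= addr0.
have -> : lift ord0 ord0 = 1 :> 'I_3 by exact: val_inj.
have -> : lift ord0 (lift ord0 ord0) = 2%:R :> 'I_3 by exact: val_inj.
case: i => -[|[|[|//]]] i3 /=.
- by rewrite mul0r add0r mulNr addrC.
- by rewrite mul0r add0r mulNr.
- by rewrite mul0r addr0 mulNr addrC.
Qed.

Lemma hatK x : vee (hat x) = x.
Proof.
apply/colP => i; rewrite !mxE.
by case: i => -[|[|[|//]]] i3 /=; congr (x _ _); exact: val_inj.
Qed.

Definition e3 : 'cV[R]_3 := delta_mx 2%:R 0.

Definition SO3 A : Prop := A^T *m A = 1%:M /\ \det A = 1.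

Definition S2 x : Prop := enorm x = 1.

Definition inertia A : Prop :=
  A^T = A /\ forall x, x != 0 -> 0 < dot x (A *m x).

Definition att_err (Rd A : 'M[R]_3) : 'cV[R]_3 :=
  2^-1 *: vee (Rd^T *m A - A^T *m Rd).

Definition vel_err (Rd A : 'M[R]_3) (Wd W : 'cV[R]_3) : 'cV[R]_3 :=
  W - A^T *m Rd *m Wd.

End Vectors.

Arguments e3 {R}.

Record plant (R : realType) (n : nat) := Plant {
  grav : R;
  m0 : R;
  J0 : 'M[R]_3;
  mass : 'I_n -> R;
  inert : 'I_n -> 'M[R]_3;
  len : 'I_n -> R;
  rho : 'I_n -> 'cV[R]_3 }.

Record gains (R : realType) := Gains {
  k_x0 : R; k_v0 : R; k_R0 : R; k_W0 : R; k_q : R; k_w : R; k_R : R; k_W : R }.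

Record commands (R : realType) (n : nat) := Commands {
  x0d : R -> 'cV[R]_3;
  R0d : R -> 'M[R]_3;
  b1 : 'I_n -> R -> 'cV[R]_3 }.

Record payload (R : realType) := Payload {
  px : 'cV[R]_3;
  pv : 'cV[R]_3;
  pR : 'M[R]_3;
  pW : 'cV[R]_3 }.

Record state (R : realType) (n : nat) := State {
  pl : payload R;
  lq : 'I_n -> 'cV[R]_3;
  lw : 'I_n -> 'cV[R]_3;
  qR : 'I_n -> 'M[R]_3;
  qW : 'I_n -> 'cV[R]_3 }.

Section Model.
Variables (R : realType) (n : nat).
Variables (P : plant R n) (K : gains R) (D : commands R n).

Definition Pmat : 'M[R]_(3 + 3, \sum_(j < n) 3) :=
  \mxrow_(j < n) col_mx (1%:M : 'M[R]_3) (hat (rho P j)).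

Definition plant_ok : Prop :=
  [/\ 0 < grav P, 0 < m0 P, inertia (J0 P),
      (forall i, [/\ 0 < mass P i, 0 < len P i & inertia (inert P i)])
    & (6 <= \rank Pmat)%N].

Definition gains_ok : Prop :=
  [/\ 0 < k_x0 K, 0 < k_v0 K, 0 < k_R0 K & 0 < k_W0 K] /\
  [/\ 0 < k_q K, 0 < k_w K, 0 < k_R K & 0 < k_W K].

Definition v0d : R -> 'cV[R]_3 := derive1 (x0d D).

Definition W0d (t : R) : 'cV[R]_3 := vee ((R0d D t)^T *m derive1 (R0d D) t).

(* The ideal control force as a feedback function of the time t, the payload
   state p, the link directions q and the link angular velocities w. *)
Section IdealForce.
Implicit Types (t s : R) (p : payload R) (q w : 'I_n -> 'cV[R]_3) (i : 'I_n).

Definition e_x0 t p : 'cV[R]_3 := px p - x0d D t.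
Definition e_v0 t p : 'cV[R]_3 := pv p - v0d t.
Definition e_R0 t p : 'cV[R]_3 := att_err (R0d D t) (pR p).
Definition e_W0 t p : 'cV[R]_3 := vel_err (R0d D t) (pR p) (W0d t) (pW p).

Definition Fd t p : 'cV[R]_3 :=
  m0 P *: (- (k_x0 K *: e_x0 t p) - k_v0 K *: e_v0 t p
           + derive1 v0d t - grav P *: e3).

Definition Md t p : 'cV[R]_3 :=
  let Q := (pR p)^T *m R0d D t in
  - (k_R0 K *: e_R0 t p) - k_W0 K *: e_W0 t p
  + hat (Q *m W0d t) *m J0 P *m Q *m W0d t + J0 P *m Q *m derive1 W0d t.

Definition mu_d t p i : 'cV[R]_3 :=
  submxcol (\mxdiag_(j < n) pR p *m Pmat^T *m invmx (Pmat *m Pmat^T)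
            *m col_mx ((pR p)^T *m Fd t p) (Md t p)) i.

Definition mu t p q i : 'cV[R]_3 := q i *m (q i)^T *m mu_d t p i.

Definition q_d t p i : 'cV[R]_3 := - ((enorm (mu_d t p i))^-1 *: mu_d t p i).

(* Payload accelerations of the simplified model, in which u_i may be chosen
   arbitrarily and u_i = u_i^* gives
   m0 (x0'' - g e3) = sum mu_j,  J0 W0' + W0 x J0 W0 = sum rho_j x R0^T mu_j. *)
Definition acc_s t p q : 'cV[R]_3 :=
  grav P *: e3 + (m0 P)^-1 *: \sum_j mu t p q j.

Definition dW0_s t p q : 'cV[R]_3 :=
  invmx (J0 P) *m (\sum_j hat (rho P j) *m (pR p)^T *m mu t p q j
                   - hat (pW p) *m J0 P *m pW p).

Definition acc_pt t p q i : 'cV[R]_3 :=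
  acc_s t p q - grav P *: e3 + pR p *m (hat (pW p) ^+ 2 *m rho P i)
  - pR p *m hat (rho P i) *m dW0_s t p q.

(* First-order motion, for a duration s, of the payload and of the links in the
   simplified model. Differentiating at s = 0 along it gives the total time
   derivative along that model of a function of (t, p, q); at a state with
   R0 in SO(3) the value does not depend on how such a motion leaves SO(3)
   and S^2 at second order. *)
Definition pmove t p q s : payload R :=
  Payload (px p + s *: pv p) (pv p + s *: acc_s t p q)
          (pR p + s *: (pR p *m hat (pW p))) (pW p + s *: dW0_s t p q).

Definition qmove q w s : 'I_n -> 'cV[R]_3 := fun j => q j + s *: cross (w j) (q j).

(* u_i^* is the feedback law designed on the simplified model, so the time
   derivatives of q_d and of w_d it contains are, like the acceleration a_i,
   the ones of that model. Along the full model they would involve x0'' and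
   W0', hence (once R_i differs from R_ic) u_i^* itself: u_i^* would then be
   constrained by an implicit differential equation instead of being given. *)
Definition dq_d t p q i : 'cV[R]_3 :=
  derive1 (fun s => q_d (t + s) (pmove t p q s) i) 0.

Definition w_d t p q i : 'cV[R]_3 := cross (q_d t p i) (dq_d t p q i).

Definition dw_d t p q w i : 'cV[R]_3 :=
  derive1 (fun s => w_d (t + s) (pmove t p q s) (qmove q w s) i) 0.

Definition e_q t p q i : 'cV[R]_3 := cross (q_d t p i) (q i).

Definition e_w t p q w i : 'cV[R]_3 := w i + hat (q i) ^+ 2 *m w_d t p q i.

Definition u_star t p q w i : 'cV[R]_3 :=
  (mu t p q i + (mass P i * len P i * enorm (w i) ^+ 2) *: q i
   + mass P i *: (q i *m (q i)^T *m acc_pt t p q i))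
  + ((mass P i * len P i) *:
       (hat (q i) *m (- (k_q K *: e_q t p q i) - k_w K *: e_w t p q w i
                      - dot (q i) (w_d t p q i) *: cross (w i) (q i)
                      - hat (q i) ^+ 2 *m dw_d t p q w i))
     - mass P i *: (hat (q i) ^+ 2 *m acc_pt t p q i)).

Definition b3 t p q w i : 'cV[R]_3 :=
  - ((enorm (u_star t p q w i))^-1 *: u_star t p q w i).

Definition R_cmd t p q w i : 'M[R]_3 :=
  let b := hat (b3 t p q w i) in
  let c1 := b ^+ 2 *m b1 D i t in
  let c2 := b *m b1 D i t in
  \matrix_(k < 3, j < 3)
    (nth 0 [:: - ((enorm c1)^-1 *: c1); (enorm c2)^-1 *: c2; b3 t p q w i] j) k 0.

End IdealForce.

Section Trajectory.
Variable S : R -> state R n.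

(* Short names for the components of the trajectory S. *)
Let x t := px (pl (S t)).
Let v t := pv (pl (S t)).
Let R0 t := pR (pl (S t)).
Let W0 t := pW (pl (S t)).
Let q i t := lq (S t) i.
Let w i t := lw (S t) i.
Let Rq i t := qR (S t) i.
Let Wq i t := qW (S t) i.

Definition on_manifold (t : R) : Prop :=
  SO3 (R0 t) /\
  forall i, [/\ S2 (q i t), dot (q i t) (w i t) = 0 & SO3 (Rq i t)].

Definition kinematics (t : R) : Prop :=
  [/\ is_derive t 1 x (v t), is_derive t 1 R0 (R0 t *m hat (W0 t))
    & forall i, is_derive t 1 (q i) (cross (w i t) (q i t)) /\
                is_derive t 1 (Rq i) (Rq i t *m hat (Wq i t))].

Definition velocities_derivable (t : R) : Prop :=
  [/\ derivable v t 1, derivable W0 t 1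
    & forall i, derivable (w i) t 1 /\ derivable (Wq i) t 1].

Section Dynamics.
(* Thrust magnitudes and control moments of the quadrotors. *)
Variables (f : 'I_n -> R -> R) (M : 'I_n -> R -> 'cV[R]_3).

Let qq i t : 'M[R]_3 := q i t *m (q i t)^T.

Definition thrust i (t : R) : 'cV[R]_3 := - (f i t *: (Rq i t *m e3)).
Definition u_par i (t : R) : 'cV[R]_3 := qq i t *m thrust i t.
Definition u_perp i (t : R) : 'cV[R]_3 := (1%:M - qq i t) *m thrust i t.

Definition link_force i (t : R) : 'cV[R]_3 :=
  u_par i t - (mass P i * len P i * enorm (w i t) ^+ 2) *: q i t
  - mass P i *: (qq i t *m R0 t *m (hat (W0 t) ^+ 2 *m rho P i)).

Definition payload_translation (t : R) : Prop :=
  ((m0 P)%:M + \sum_i mass P i *: qq i t) *m (derive1 v t - grav P *: e3)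
  - \sum_i mass P i *: (qq i t *m R0 t *m hat (rho P i) *m derive1 W0 t)
  = \sum_i link_force i t.

Definition payload_rotation (t : R) : Prop :=
  (J0 P - \sum_i mass P i *:
     (hat (rho P i) *m (R0 t)^T *m qq i t *m R0 t *m hat (rho P i))) *m derive1 W0 t
  + \sum_i mass P i *:
      (hat (rho P i) *m (R0 t)^T *m qq i t *m (derive1 v t - grav P *: e3))
  + hat (W0 t) *m J0 P *m W0 t
  = \sum_i hat (rho P i) *m (R0 t)^T *m link_force i t.

Definition link_dynamics (t : R) : Prop := forall i,
  derive1 (w i) t =
    (len P i)^-1 *: (hat (q i t) *m
      (derive1 v t - grav P *: e3 - R0 t *m hat (rho P i) *m derive1 W0 t
       + R0 t *m (hat (W0 t) ^+ 2 *m rho P i)))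
    - (mass P i * len P i)^-1 *: (hat (q i t) *m u_perp i t).

Definition quadrotor_dynamics (t : R) : Prop := forall i,
  inert P i *m derive1 (Wq i) t + cross (Wq i t) (inert P i *m Wq i t) = M i t.

Definition full_model (t : R) : Prop :=
  [/\ on_manifold t, kinematics t & velocities_derivable t] /\
  [/\ payload_translation t, payload_rotation t, link_dynamics t
    & quadrotor_dynamics t].

End Dynamics.

Definition us i (t : R) : 'cV[R]_3 := u_star t (pl (S t)) (lq (S t)) (lw (S t)) i.

Definition R_c i (t : R) : 'M[R]_3 := R_cmd t (pl (S t)) (lq (S t)) (lw (S t)) i.

Definition W_c i (t : R) : 'cV[R]_3 := vee ((R_c i t)^T *m derive1 (R_c i) t).

Definition e_R i (t : R) : 'cV[R]_3 := att_err (R_c i t) (Rq i t).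
Definition e_W i (t : R) : 'cV[R]_3 := vel_err (R_c i t) (Rq i t) (W_c i t) (Wq i t).

Definition f_law i (t : R) : R := - dot (us i t) (Rq i t *m e3).

Definition M_law (eps : R) i (t : R) : 'cV[R]_3 :=
  let Q := (Rq i t)^T *m R_c i t in
  - ((k_R K / eps ^+ 2) *: e_R i t) - (k_W K / eps) *: e_W i t
  + cross (Wq i t) (inert P i *m Wq i t)
  - inert P i *m (hat (Wq i t) *m Q *m W_c i t - Q *m derive1 (W_c i) t).

(* As x / 0 = 0 and derive1 is total, the control law is required to make
   sense along the trajectory: R_ic is in SO(3) exactly when u_i^* and
   b3_i x b1_i do not vanish. *)
Definition law_defined (t : R) : Prop := forall i,
  [/\ mu_d t (pl (S t)) i != 0, SO3 (R_c i t),
      derivable (R_c i) t 1 & derivable (W_c i) t 1].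

Definition closed_loop (eps a b : R) : Prop := forall t, a < t < b ->
  law_defined t /\ full_model f_law (M_law eps) t.

Definition err_norm (t : R) : R :=
  let p := pl (S t) in
  Num.sqrt (enorm (e_x0 t p) ^+ 2 + enorm (e_v0 t p) ^+ 2
            + enorm (e_R0 t p) ^+ 2 + enorm (e_W0 t p) ^+ 2
            + \sum_i (enorm (e_q t p (lq (S t)) i) ^+ 2
                      + enorm (e_w t p (lq (S t)) (lw (S t)) i) ^+ 2
                      + enorm (e_R i t) ^+ 2 + enorm (e_W i t) ^+ 2)).

(* e_R0, e_q and e_R also vanish at configurations other than the desired one
   (attitudes off by a half turn, q_i = - q_id), so a neighbourhood of the zero
   equilibrium has to be specified on the configurations too. *)
Definition near_equilibrium (delta t : R) : Prop :=
  [/\ err_norm t < delta, `|R0 t - R0d D t| < delta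
    & forall i, enorm (q i t - q_d t (pl (S t)) i) < delta /\
                `|Rq i t - R_c i t| < delta].

End Trajectory.

(* Exponential stability of a non-autonomous system, uniform in the initial
   time t0. Trajectories live on an open interval around t0, so that every
   derivative in the closed loop is two-sided; those defined on [t0, +oo[ are
   covered by letting b vary. *)
Definition exponentially_stable (eps : R) : Prop :=
  exists delta C lambda : R, [/\ 0 < delta, 0 < C, 0 < lambda &
    forall (a b t0 : R) (S : R -> state R n),
      0 <= t0 -> a < t0 < b -> closed_loop S eps a b ->
      near_equilibrium S delta t0 ->
      forall t, t0 <= t < b ->
        err_norm S t <= C * expR (- (lambda * (t - t0))) * err_norm S t0].

Definition payload_d (t : R) : payload R :=
  Payload (x0d D t) (v0d t) (R0d D t) (W0d t).

Definition smooth (V : normedModType R) (f : R -> V) : Prop :=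
  forall (k : nat) (t : R), derivable (derive1n k f) t 1.

Definition commands_smooth : Prop :=
  [/\ smooth (x0d D), smooth (R0d D) & forall i, smooth (b1 D i)] /\
  forall t, SO3 (R0d D t) /\ forall i, S2 (b1 D i t).

Definition commands_bounded : Prop :=
  exists B : R, forall t : R, 0 <= t ->
    [/\ enorm (v0d t) <= B, enorm (derive1 v0d t) <= B,
        enorm (W0d t) <= B & enorm (derive1 W0d t) <= B].

(* The design presupposes that, at zero error, the command q_id is well defined
   and the ideal control force bounded, uniformly in time; u_i^* involves the
   derivatives of the velocity commands up to order 3. *)
Definition desired_motion_regular : Prop :=
  (exists2 c : R, 0 < c &
     forall i (t : R), 0 <= t -> c <= enorm (mu_d t (payload_d t) i)) /\
  (exists B : R, forall (k : nat) (t : R), (2 <= k <= 3)%N -> 0 <= t ->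
     enorm (derive1n k v0d t) <= B /\ enorm (derive1n k W0d t) <= B).

End Model.

(* Main.v *)
Require Import Defs.
From mathcomp Require Import all_boot all_order all_algebra.
From mathcomp Require Import all_classical all_reals all_analysis.
From mathcomp Require Import ring lra.
Import Order.TTheory GRing.Theory Num.Theory.
Import numFieldNormedType.Exports.

(* The closed loop is a cascade, so that every epsilon works. The control
   moments make the attitude errors (e_R, e_W) of each quadrotor obey the
   autonomous system J e_W' = - kR/eps^2 e_R - kW/eps e_W, whatever the rest of
   the state does. The force error |u_i - u_i*| is at most |u_i*| times the
   distance of the thrust axes, hence linear in e_R where u_i* is bounded. It
   shifts the accelerations of the payload, away from those of the simplified
   model, by a linear amount, because the mass matrix is positive definite; so
   it perturbs the link errors (e_q, e_w) linearly. The payload errors are in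
   turn perturbed by mu_i - mu_id, of norm |mu_id| |e_q|, and by the force
   errors. A weighted sum of one Lyapunov function per stage,
   T + k U + c X with T a kinetic and U a potential energy and X a cross term,
   then decays exponentially, and one of its sublevel sets is an invariant
   region on which all the bounds used are uniform in time. *)

Set Implicit Arguments.
Unset Strict Implicit.
Unset Printing Implicit Defensive.
Local Open Scope ring_scope.

(** * Vectors and rotations *)

(** Two features of the control law shape the proof. [R_c] is differentiated along the actual
    trajectory, so the moments cancel its motion exactly, and the derivability granted by
    [law_defined] suffices. In contrast, [u_star] contains derivatives of [q_d] and [w_d] taken
    along the simplified model; their discrepancy with the actual derivatives is what perturbs the
    links. These nested derivatives have no usable closed form. What matters is that they are
    bounded uniformly in time and that the discrepancy is linear in the acceleration errors; [reg]
    and [tanform] record this structurally. The desired motion and its derivatives count as bounded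
    coordinates beside the state, so that time itself disappears from the estimates. Normalizing
    [mu_d] is legitimate near the desired motion: the lower bound assumed on that motion survives on
    a neighbourhood, by a Lipschitz estimate. The invariant region and the decay rate may depend on
    [eps]. *)

Section Space3.
Variable R : realType.
Implicit Types (x y z u v : 'cV[R]_3) (A B : 'M[R]_3).

Lemma sum3 (V : nmodType) (F : 'I_3 -> V) :
  \sum_i F i = F 0 + F 1 + F 2%:R.
Proof.
rewrite !big_ord_recl big_ord0 addr0 addrA.
by congr (F _ + F _ + F _); apply: val_inj.
Qed.

Lemma forall3 (Q : 'I_3 -> Prop) : Q 0 -> Q 1 -> Q 2%:R -> forall i, Q i.
Proof.
move=> Q0 Q1 Q2 [[|[|[|//]]] i3].
- by have -> : Ordinal i3 = 0 by apply: val_inj.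
- by have -> : Ordinal i3 = 1 by apply: val_inj.
- by have -> : Ordinal i3 = 2%:R by apply: val_inj.
Qed.

Lemma col3P x y :
  x 0 0 = y 0 0 -> x 1 0 = y 1 0 -> x 2%:R 0 = y 2%:R 0 -> x = y.
Proof. by move=> *; apply/colP; apply: forall3. Qed.

Lemma hat_entries x :
  ((hat x 0 0 = 0) * (hat x 0 1 = - x 2%:R 0) * (hat x 0 2%:R = x 1 0) *
   (hat x 1 0 = x 2%:R 0) * (hat x 1 1 = 0) * (hat x 1 2%:R = - x 0 0) *
   (hat x 2%:R 0 = - x 1 0) * (hat x 2%:R 1 = x 0 0) * (hat x 2%:R 2%:R = 0))%type.
Proof. by rewrite !mxE /=. Qed.

Lemma vee_entries A :
  ((vee A 0 0 = A 2%:R 1) * (vee A 1 0 = A 0 2%:R) * (vee A 2%:R 0 = A 1 0))%type.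
Proof. by rewrite !mxE /=. Qed.

Lemma mul3E (n p : nat) (A : 'M[R]_(n, 3)) (B : 'M[R]_(3, p)) i j :
  (A *m B) i j = A i 0 * B 0 j + A i 1 * B 1 j + A i 2%:R * B 2%:R j.
Proof. by rewrite mxE sum3. Qed.

Lemma cross_entries x y :
  ((cross x y 0 0 = x 1 0 * y 2%:R 0 - x 2%:R 0 * y 1 0) *
   (cross x y 1 0 = x 2%:R 0 * y 0 0 - x 0 0 * y 2%:R 0) *
   (cross x y 2%:R 0 = x 0 0 * y 1 0 - x 1 0 * y 0 0))%type.
Proof. by rewrite !crossE !mxE /=. Qed.

Lemma dotE x y : dot x y = x 0 0 * y 0 0 + x 1 0 * y 1 0 + x 2%:R 0 * y 2%:R 0.
Proof. by rewrite /dot mul3E !mxE. Qed.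

End Space3.

(** Identities of vector algebra are settled by passing to entries, where they are polynomial. *)
Ltac entries := rewrite ?(mul3E, dotE, cross_entries, hat_entries, vee_entries, mxE) /=.
Ltac vec3 := apply: col3P; entries; ring.
Ltac dot3 := entries; ring.

Section Space3Theory.
Variable R : realType.
Implicit Types (x y z u v : 'cV[R]_3) (A B : 'M[R]_3) (a b : R).

Lemma dotC x y : dot x y = dot y x. Proof. dot3. Qed.
Lemma dotDl x y z : dot (x + y) z = dot x z + dot y z. Proof. dot3. Qed.
Lemma dotDr x y z : dot x (y + z) = dot x y + dot x z. Proof. dot3. Qed.
Lemma dotNl x y : dot (- x) y = - dot x y. Proof. dot3. Qed.
Lemma dotNr x y : dot x (- y) = - dot x y. Proof. dot3. Qed.
Lemma dotBl x y z : dot (x - y) z = dot x z - dot y z. Proof. dot3. Qed.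
Lemma dotBr x y z : dot x (y - z) = dot x y - dot x z. Proof. dot3. Qed.
Lemma dotZl a x y : dot (a *: x) y = a * dot x y. Proof. dot3. Qed.
Lemma dotZr a x y : dot x (a *: y) = a * dot x y. Proof. dot3. Qed.
Lemma dot0l x : dot 0 x = 0. Proof. dot3. Qed.
Lemma dot0r x : dot x 0 = 0. Proof. dot3. Qed.

Lemma dot_sumr (I : finType) (F : I -> 'cV[R]_3) y :
  dot y (\sum_i F i) = \sum_i dot y (F i).
Proof.
by elim/big_rec2: _ => [|i a b _ <-]; rewrite ?dot0r ?dotDr.
Qed.

Lemma dot_mulmx A x y : dot x (A *m y) = dot (A^T *m x) y.
Proof. dot3. Qed.

Lemma dot_ge0 x : 0 <= dot x x.
Proof. by rewrite dotE !addr_ge0 // -expr2 sqr_ge0. Qed.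

Lemma dot_eq0 x : dot x x = 0 -> x = 0.
Proof.
rewrite dotE => /eqP; rewrite !paddr_eq0 ?addr_ge0 -?expr2 ?sqr_ge0 //.
by rewrite !sqrf_eq0 => /andP[/andP[/eqP a /eqP b] /eqP c]; apply: col3P; rewrite ?a ?b ?c mxE.
Qed.

Lemma enorm_ge0 x : 0 <= enorm x. Proof. exact: sqrtr_ge0. Qed.

Lemma enorm2 x : enorm x ^+ 2 = dot x x.
Proof. by rewrite sqr_sqrtr ?dot_ge0. Qed.

Lemma enorm_eq0 x : enorm x = 0 -> x = 0.
Proof. by move=> x0; apply: dot_eq0; rewrite -enorm2 x0 expr0n. Qed.

Lemma enorm0 : enorm (0 : 'cV[R]_3) = 0.
Proof. by rewrite /enorm dot0l sqrtr0. Qed.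

Lemma enorm_gt0 x : x != 0 -> 0 < enorm x.
Proof.
by move=> x0; rewrite lt0r enorm_ge0 andbT; apply: contraNneq x0 => /enorm_eq0 ->.
Qed.

Lemma enorm_leP x b : 0 <= b -> dot x x <= b ^+ 2 -> enorm x <= b.
Proof.
move=> b0 h; rewrite /enorm -(ger0_norm b0) -sqrtr_sqr.
by rewrite ler_wsqrtr.
Qed.

Lemma cross_dot_sqr x y :
  dot (cross x y) (cross x y) + dot x y ^+ 2 = dot x x * dot y y.
Proof. dot3. Qed.

Lemma dot_le x y : `|dot x y| <= enorm x * enorm y.
Proof.
rewrite -(ler_pXn2r (n := 2)) ?nnegrE ?mulr_ge0 ?enorm_ge0 //.
rewrite exprMn !enorm2 real_normK ?num_real // -cross_dot_sqr lerDr.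
exact: dot_ge0.
Qed.

Lemma dot_le_norms x y : dot x y <= enorm x * enorm y.
Proof. exact: le_trans (ler_norm _) (dot_le x y). Qed.

Lemma enorm_cross x y : enorm (cross x y) <= enorm x * enorm y.
Proof.
apply: enorm_leP; first by rewrite mulr_ge0 ?enorm_ge0.
by rewrite exprMn !enorm2 -cross_dot_sqr lerDl sqr_ge0.
Qed.

Lemma enormD x y : enorm (x + y) <= enorm x + enorm y.
Proof.
apply: enorm_leP; first by rewrite addr_ge0 ?enorm_ge0.
rewrite dotDl !dotDr sqrrD !enorm2 (dotC y x).
have := dot_le_norms x y; rewrite mulr2n; lra.
Qed.

Lemma enormN x : enorm (- x) = enorm x.
Proof. by rewrite /enorm dotNl dotNr opprK. Qed.

Lemma enormB x y : enorm (x - y) <= enorm x + enorm y.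
Proof. by rewrite -(enormN y) enormD. Qed.

Lemma enormZ a x : enorm (a *: x) = `|a| * enorm x.
Proof.
by rewrite /enorm dotZl dotZr mulrA -expr2 sqrtrM ?sqr_ge0 // sqrtr_sqr.
Qed.

Lemma enorm_sum (I : finType) (F : I -> 'cV[R]_3) :
  enorm (\sum_i F i) <= \sum_i enorm (F i).
Proof.
elim/big_rec2: _ => [|i y x _ h]; first by rewrite enorm0.
by rewrite (le_trans (enormD _ _)) // lerD2l.
Qed.

Lemma entry_le_enorm x i : `|x i 0| <= enorm x.
Proof.
rewrite -(ler_pXn2r (n := 2)) ?nnegrE ?enorm_ge0 // enorm2 real_normK ?num_real //.
rewrite dotE -!expr2.
have [[h0 h1] h2] := (sqr_ge0 (x 0 0), sqr_ge0 (x 1 0), sqr_ge0 (x 2%:R 0)).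
by elim/forall3: i; lra.
Qed.

Lemma enorm_le_entries x b : (forall i, `|x i 0| <= b) -> enorm x <= 3 * b.
Proof.
move=> h; have b0 : 0 <= b by apply: le_trans (h 0).
apply: enorm_leP; first by rewrite mulr_ge0.
have sq i : x i 0 * x i 0 <= b * b.
  rewrite -!expr2 -(real_normK (num_real (x i 0))).
  by rewrite ler_pXn2r ?nnegrE.
rewrite dotE; have [[h0 h1] h2] := (sq 0, sq 1, sq 2%:R).
have : 0 <= b * b by rewrite mulr_ge0.
rewrite exprMn !expr2; lra.
Qed.

Lemma cross_cross x y z : cross x (cross y z) = dot x z *: y - dot x y *: z.
Proof. by vec3. Qed.

Lemma crossDr x y z : cross x (y + z) = cross x y + cross x z.
Proof. exact: mulmxDr. Qed.

Lemma hat_tr x : (hat x)^T = - hat x.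
Proof.
by apply/matrixP; do 2 elim/forall3; rewrite !mxE /= ?oppr0 ?opprK.
Qed.

Lemma hatB x y : hat (x - y) = hat x - hat y.
Proof.
by apply/matrixP; do 2 elim/forall3; rewrite !mxE /= ?subrr ?opprB ?opprK //; ring.
Qed.

Lemma mulmx_bound A : exists2 c, 0 < c & forall x, enorm (A *m x) <= c * enorm x.
Proof.
have [m hm] : exists m, forall i j, `|A i j| <= m.
  exists (\sum_i \sum_j `|A i j|) => i j.
  rewrite (bigD1 i) //= (bigD1 j) //= -addrA lerDl addr_ge0 ?sumr_ge0 // => k _.
  by rewrite sumr_ge0.
have m0 : 0 <= m := le_trans (normr_ge0 _) (hm 0 0).
(* Three entries per row, and the factor 3 of [enorm_le_entries]; the [+ 1] keeps the constant
   positive for the zero matrix. *)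
exists (9 * m + 1); first by rewrite ltr_wpDl ?mulr_ge0.
move=> x; apply: (@le_trans _ _ (3 * (3 * m * enorm x))); last first.
  by have := enorm_ge0 x; rewrite -subr_ge0 => ?; nra.
apply: enorm_le_entries => i; rewrite mul3E.
apply: le_trans (ler_normD _ _) _.
apply: le_trans (lerD (ler_normD _ _) (lexx _)) _.
have e j : `|A i j * x j 0| <= m * enorm x.
  by rewrite normrM ler_pM // entry_le_enorm.
have := e 0; have := e 1; have := e 2%:R; lra.
Qed.

Lemma orthogonal_dot A x y : A^T *m A = 1%:M -> dot (A *m x) (A *m y) = dot x y.
Proof. by move=> h; rewrite dot_mulmx mulmxA h mul1mx. Qed.

Lemma orthogonal_enorm A x : A^T *m A = 1%:M -> enorm (A *m x) = enorm x.
Proof. by move=> h; rewrite /enorm orthogonal_dot. Qed.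

Lemma SO3_tr A : SO3 A -> A *m A^T = 1%:M.
Proof. by case=> /mulmx1C. Qed.

Lemma SO3_trmx A : SO3 A -> SO3 A^T.
Proof. by move=> hA; split; rewrite ?trmxK ?det_tr ?(SO3_tr hA) //; case: hA. Qed.

Lemma SO3_mul A B : SO3 A -> SO3 B -> SO3 (A *m B).
Proof.
move=> [a a'] [b b']; split; last by rewrite det_mulmx a' b' mulr1.
by rewrite trmx_mul mulmxA -(mulmxA B^T) a mulmx1.
Qed.

End Space3Theory.

(** * Rotations, the error function [Psi] and the attitude error vector *)

Section Rotations.
Variable R : realType.
Implicit Types (x y z u v : 'cV[R]_3) (A B Q : 'M[R]_3) (a b : R).

Lemma det3E A : \det A =
  A 0 0 * (A 1 1 * A 2%:R 2%:R - A 1 2%:R * A 2%:R 1)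
  - A 0 1 * (A 1 0 * A 2%:R 2%:R - A 1 2%:R * A 2%:R 0)
  + A 0 2%:R * (A 1 0 * A 2%:R 1 - A 1 1 * A 2%:R 0).
Proof.
(* With entries indexed by natural numbers, the lifted indices produced by the cofactor expansions
   reduce by computation. *)
pose f i j := A (inord i) (inord j).
have -> : A = \matrix_(i, j) f i j by apply/matrixP => i j; rewrite mxE /f !inord_val.
rewrite (expand_det_row _ ord0) !big_ord_recl big_ord0 /cofactor.
rewrite !(expand_det_row _ (ord0 : 'I_2)) !big_ord_recl !big_ord0 /cofactor !det_mx11.
by rewrite !mxE /= /bump /=; ring.
Qed.

(** The cofactor identity: polynomial in the entries, hence valid for every matrix. On rotations it
    yields the equivariance of the cross product. *)
Lemma cross_det A x y : A^T *m cross (A *m x) (A *m y) = \det A *: cross x y.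
Proof. by apply: col3P; rewrite det3E; entries; ring. Qed.

Lemma SO3_cross A x y : SO3 A -> cross (A *m x) (A *m y) = A *m cross x y.
Proof.
move=> hA; have := cross_det A x y.
case: (hA) => _ ->; rewrite scale1r => <-.
by rewrite mulmxA (SO3_tr hA) mul1mx.
Qed.

Lemma SO3_hat A x : SO3 A -> A *m hat (A^T *m x) = hat x *m A.
Proof.
move=> hA; apply/matrixP => i j.
have h : A *m hat (A^T *m x) *m delta_mx j 0 = hat x *m A *m delta_mx j (0 : 'I_1).
  have := SO3_cross (A^T *m x) (delta_mx j 0) hA.
  by rewrite mulmxA (SO3_tr hA) mul1mx /cross !mulmxA => <-.
by rewrite -!colE in h; move/colP: h => /(_ i); rewrite !mxE.
Qed.

(** The usual error function on rotations: [1 - cos theta] for a rotation by the angle [theta].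
    Correspondingly [rot_err] is [sin theta] times the axis. *)
Definition Psi Q : R := 2^-1 * (3 - \tr Q).

Definition rot_err Q : 'cV[R]_3 := 2^-1 *: vee (Q - Q^T).

Lemma att_errE A B : att_err A B = rot_err (A^T *m B).
Proof. by rewrite /att_err /rot_err trmx_mul trmxK. Qed.

Lemma vel_errE A B x y : vel_err A B x y = y - (A^T *m B)^T *m x.
Proof. by rewrite /vel_err trmx_mul trmxK. Qed.

Lemma tr3E A : \tr A = A 0 0 + A 1 1 + A 2%:R 2%:R.
Proof. by rewrite /mxtrace sum3. Qed.

(** The image of a cross product of two basis vectors is the cross product of two columns; one entry
    of each such identity is kept. *)
Lemma SO3_cofactors Q : SO3 Q ->
  [/\ Q 0 0 = Q 1 1 * Q 2%:R 2%:R - Q 1 2%:R * Q 2%:R 1,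
      Q 1 1 = Q 0 0 * Q 2%:R 2%:R - Q 0 2%:R * Q 2%:R 0 &
      Q 2%:R 2%:R = Q 0 0 * Q 1 1 - Q 0 1 * Q 1 0].
Proof.
move=> hQ.
have h i j := SO3_cross (delta_mx i 0) (delta_mx j 0) hQ.
split.
- by have /colP/(_ 0) := h 1 2%:R; entries; lra.
- by have /colP/(_ 1) := h 2%:R 0; entries; lra.
- by have /colP/(_ 2%:R) := h 0 1; entries; lra.
Qed.

Lemma orthogonal_sum_sqr Q : Q^T *m Q = 1%:M ->
  Q 0 0 ^+ 2 + Q 0 1 ^+ 2 + Q 0 2%:R ^+ 2 +
  (Q 1 0 ^+ 2 + Q 1 1 ^+ 2 + Q 1 2%:R ^+ 2) +
  (Q 2%:R 0 ^+ 2 + Q 2%:R 1 ^+ 2 + Q 2%:R 2%:R ^+ 2) = 3.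
Proof.
move=> /matrixP h; have := h 0 0; have := h 1 1; have := h 2%:R 2%:R.
rewrite !mul3E !mxE /=; rewrite !expr2; lra.
Qed.

(** This is [sin^2 = (1 - cos) (1 + cos)], obtained without angles: [SO3_cofactors] eliminates the
    products of off-diagonal entries, and orthogonality eliminates their squares. *)
Lemma rot_err_sqr Q : SO3 Q -> dot (rot_err Q) (rot_err Q) = Psi Q * (2 - Psi Q).
Proof.
move=> hQ; have [h0 h1 h2] := SO3_cofactors hQ.
have hs := orthogonal_sum_sqr hQ.1.
have q0 : Q 1 2%:R * Q 2%:R 1 = Q 1 1 * Q 2%:R 2%:R - Q 0 0 by lra.
have q1 : Q 0 2%:R * Q 2%:R 0 = Q 0 0 * Q 2%:R 2%:R - Q 1 1 by lra.
have q2 : Q 0 1 * Q 1 0 = Q 0 0 * Q 1 1 - Q 2%:R 2%:R by lra.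
rewrite /rot_err /Psi dotZl dotZr tr3E; entries.
move: (Q 0 0) (Q 0 1) (Q 0 2%:R) (Q 1 0) (Q 1 1) (Q 1 2%:R) (Q 2%:R 0) (Q 2%:R 1)
  (Q 2%:R 2%:R) hs q0 q1 q2 => a b c d e f g h i hs q0 q1 q2.
transitivity (4^-1 * ((a ^+ 2 + b ^+ 2 + c ^+ 2 + (d ^+ 2 + e ^+ 2 + f ^+ 2) + (g ^+ 2 + h ^+ 2 + i ^+ 2))
  - a ^+ 2 - e ^+ 2 - i ^+ 2 - 2 * (f * h) - 2 * (c * g) - 2 * (b * d))).
  by field.
by rewrite hs q0 q1 q2; field.
Qed.

(* [4 Psi] is the squared Frobenius distance between the two rotations. *)
Lemma Psi_dist A B : SO3 A -> SO3 B ->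
  \sum_i \sum_j (A i j - B i j) ^+ 2 = 4 * Psi (A^T *m B).
Proof.
move=> [hA _] [hB _].
have sA := orthogonal_sum_sqr hA; have sB := orthogonal_sum_sqr hB.
rewrite !sum3 /Psi tr3E !mul3E !mxE.
transitivity (3 + 3 - 2 * (A 0 0 * B 0 0 + A 0 1 * B 0 1 + A 0 2%:R * B 0 2%:R +
 (A 1 0 * B 1 0 + A 1 1 * B 1 1 + A 1 2%:R * B 1 2%:R) +
 (A 2%:R 0 * B 2%:R 0 + A 2%:R 1 * B 2%:R 1 + A 2%:R 2%:R * B 2%:R 2%:R))); last by field.
by rewrite -{1}sA -sB; ring.
Qed.

Lemma Psi_ge0 Q : SO3 Q -> 0 <= Psi Q.
Proof.
move=> hQ; have h1 : SO3 (1%:M : 'M[R]_3) by split; rewrite ?det1 ?trmx1 ?mul1mx.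
have := Psi_dist h1 hQ; rewrite trmx1 mul1mx => h.
have : 0 <= 4 * Psi Q by rewrite -h; do 2!apply: sumr_ge0 => ? _; rewrite sqr_ge0.
lra.
Qed.

Lemma rot_err_le Q : SO3 Q -> enorm (rot_err Q) ^+ 2 <= 2 * Psi Q.
Proof. by move=> hQ; rewrite enorm2 rot_err_sqr //; have := Psi_ge0 hQ; nra. Qed.

(** The restriction [Psi Q <= 1] keeps away from half turns, where [rot_err] vanishes although [Psi]
    is 2. *)
Lemma Psi_le Q : SO3 Q -> Psi Q <= 1 -> Psi Q <= enorm (rot_err Q) ^+ 2.
Proof. by move=> hQ h; rewrite enorm2 rot_err_sqr //; have := Psi_ge0 hQ; nra. Qed.

Lemma Psi_entry A B i j : SO3 A -> SO3 B ->
  (A i j - B i j) ^+ 2 <= 4 * Psi (A^T *m B).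
Proof.
move=> hA hB; rewrite -Psi_dist // (bigD1 i) //= (bigD1 j) //= -addrA lerDl.
by rewrite addr_ge0 ?sumr_ge0 // => k _; rewrite ?sumr_ge0 // => *; rewrite sqr_ge0.
Qed.

Lemma Psi_small A B e : SO3 A -> SO3 B -> (forall i j, `|A i j - B i j| <= e) ->
  Psi (A^T *m B) <= 3 * e ^+ 2.
Proof.
move=> hA hB h.
have : \sum_i \sum_j (A i j - B i j) ^+ 2 <= \sum_(i < 3) \sum_(j < 3) e ^+ 2.
  apply: ler_sum => i _; apply: ler_sum => j _.
  rewrite -(real_normK (num_real (A i j - B i j))).
  by rewrite ler_pXn2r ?nnegrE ?(le_trans _ (h i j)).
rewrite Psi_dist // !sum3 => h'.
have : 0 <= e ^+ 2 by apply: sqr_ge0.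
lra.
Qed.

Lemma SO3_entry A i j : SO3 A -> `|A i j| <= 1.
Proof.
move=> [hA _]; rewrite -(ler_pXn2r (n := 2)) ?nnegrE // expr1n real_normK ?num_real //.
have /matrixP/(_ j j) := hA; rewrite mul3E !mxE eqxx /= -!expr2.
have := (sqr_ge0 (A 0 j), sqr_ge0 (A 1 j), sqr_ge0 (A 2%:R j)) => -[[s0 s1] s2] h.
by elim/forall3: i; lra.
Qed.

(** The left-hand side is the derivative of [rot_err] when [Q] moves with velocity [Q *m hat e]. *)
Lemma rot_err_hat Q e :
  2^-1 *: vee (Q *m hat e - (Q *m hat e)^T) = 2^-1 *: ((\tr Q) *: e - Q^T *m e).
Proof. by rewrite tr3E; vec3. Qed.

(** The trace is at most 3 in absolute value and [Q^T] is an isometry, whence [2 = (3 + 1) / 2]. *)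
Lemma rot_err_hat_le Q e : SO3 Q ->
  enorm (2^-1 *: ((\tr Q) *: e - Q^T *m e)) <= 2 * enorm e.
Proof.
move=> hQ; rewrite enormZ gtr0_norm ?invr_gt0 //.
have h1 : `|\tr Q| <= 3.
  have [q0 [q1 q2]] := (SO3_entry 0 0 hQ, (SO3_entry 1 1 hQ, SO3_entry 2%:R 2%:R hQ)).
  rewrite tr3E; apply: le_trans (ler_normD _ _) _.
  by apply: le_trans (lerD (ler_normD _ _) (lexx _)) _; lra.
have h2 := enormB (\tr Q *: e) (Q^T *m e).
rewrite enormZ (orthogonal_enorm (A := Q^T)) ?trmxK ?(SO3_tr hQ) // in h2.
have := enorm_ge0 e; nra.
Qed.

Lemma trace_mul_hat Q e : \tr (Q *m hat e) = - 2 * dot (rot_err Q) e.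
Proof. by rewrite /rot_err dotZl tr3E; entries; field. Qed.

End Rotations.

(** * Differentiation of vectors and matrices *)

Section Derivatives.
Variable R : realType.
Implicit Types t : R.

Lemma is_derive_mxP m n (F : R -> 'M[R]_(m, n)) t dF :
  is_derive t 1 F dF <-> forall i j, is_derive t 1 (fun s => F s i j) (dF i j).
Proof.
split=> [[dv <-] i j|h].
  by apply: DeriveDef; [exact: (derivable_mxP F t 1).1|rewrite derive_mx // mxE].
have dv : derivable F t 1 by apply/derivable_mxP => i j; case: (h i j).
apply: DeriveDef => //; rewrite derive_mx //; apply/matrixP => i j.
by rewrite mxE; case: (h i j).
Qed.

Lemma is_derive_mulmx m n p (F : R -> 'M[R]_(m, n)) (G : R -> 'M[R]_(n, p)) t dF dG :
  is_derive t 1 F dF -> is_derive t 1 G dG ->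
  is_derive t 1 (fun s => F s *m G s) (dF *m G t + F t *m dG).
Proof.
move=> /is_derive_mxP hF /is_derive_mxP hG; apply/is_derive_mxP => i j.
have -> : (fun s => (F s *m G s) i j) = \sum_(k < n) (fun s => F s i k * G s k j).
  by apply/funext => s; rewrite mxE fct_sumE.
apply: is_derive_eq (is_derive_sum (fun k => is_deriveM (hF i k) (hG k j))) _.
rewrite !mxE -big_split /=; apply: eq_bigr => k _.
by rewrite addrC /GRing.scale /= (mulrC (G t k j)).
Qed.

Lemma is_derive_trmx m n (F : R -> 'M[R]_(m, n)) t dF :
  is_derive t 1 F dF -> is_derive t 1 (fun s => (F s)^T) dF^T.
Proof.
move=> /is_derive_mxP hF; apply/is_derive_mxP => i j; rewrite mxE.
by apply: is_derive_eq; rewrite //; under eq_fun do rewrite mxE.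
Qed.

Lemma is_derive_add (V : normedModType R) (f g : R -> V) t df dg :
  is_derive t 1 f df -> is_derive t 1 g dg -> is_derive t 1 (fun s => f s + g s) (df + dg).
Proof. by move=> *; apply: is_deriveD. Qed.

Lemma is_derive_sub (V : normedModType R) (f g : R -> V) t df dg :
  is_derive t 1 f df -> is_derive t 1 g dg -> is_derive t 1 (fun s => f s - g s) (df - dg).
Proof. by move=> *; apply: is_deriveB. Qed.

Lemma is_derive_opp (V : normedModType R) (f : R -> V) t df :
  is_derive t 1 f df -> is_derive t 1 (fun s => - f s) (- df).
Proof. by move=> *; apply: is_deriveN. Qed.

Lemma is_derive_scale (V : normedModType R) c (f : R -> V) t df :
  is_derive t 1 f df -> is_derive t 1 (fun s => c *: f s) (c *: df).
Proof. by move=> *; apply: is_deriveZ. Qed.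

Lemma is_derive_mul (f g : R -> R) t df dg :
  is_derive t 1 f df -> is_derive t 1 g dg ->
  is_derive t 1 (fun s => f s * g s) (df * g t + f t * dg).
Proof.
move=> hf hg; apply: is_derive_eq (is_deriveM hf hg) _.
by rewrite addrC /GRing.scale /= (mulrC (g t)).
Qed.

Lemma is_derive_bigsum (V : normedModType R) n (f : 'I_n -> R -> V) t df :
  (forall i, is_derive t 1 (f i) (df i)) ->
  is_derive t 1 (fun s => \sum_i f i s) (\sum_i df i).
Proof.
move=> h; rewrite (_ : (fun s => _) = \sum_i f i); first exact: is_derive_sum.
by apply/funext => s; rewrite fct_sumE.
Qed.

Lemma is_derive_dot (f g : R -> 'cV[R]_3) t df dg :
  is_derive t 1 f df -> is_derive t 1 g dg ->
  is_derive t 1 (fun s => dot (f s) (g s)) (dot df (g t) + dot (f t) dg).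
Proof.
move=> hf hg; have := is_derive_mulmx (is_derive_trmx hf) hg.
by move=> /is_derive_mxP/(_ 0 0); rewrite mxE.
Qed.

Lemma is_derive_hat (f : R -> 'cV[R]_3) t df :
  is_derive t 1 f df -> is_derive t 1 (fun s => hat (f s)) (hat df).
Proof.
move=> /is_derive_mxP h; apply/is_derive_mxP.
have e0 : is_derive t 1 (fun _ : R => 0 : R) 0 by exact: is_derive_cst.
have hN k : is_derive t 1 (fun s => - f s k 0) (- df k 0) by exact: is_derive_opp.
elim/forall3; elim/forall3; rewrite ?hat_entries;
  under eq_fun do rewrite hat_entries; by [].
Qed.

Lemma is_derive_cross (f g : R -> 'cV[R]_3) t df dg :
  is_derive t 1 f df -> is_derive t 1 g dg ->
  is_derive t 1 (fun s => cross (f s) (g s)) (cross df (g t) + cross (f t) dg).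
Proof. by move=> hf hg; apply: is_derive_mulmx => //; apply: is_derive_hat. Qed.

Lemma is_derive_vee (f : R -> 'M[R]_3) t df :
  is_derive t 1 f df -> is_derive t 1 (fun s => vee (f s)) (vee df).
Proof.
move=> /is_derive_mxP h; apply/is_derive_mxP => i j; rewrite (ord1 j).
by elim/forall3: i; rewrite ?vee_entries; under eq_fun do rewrite vee_entries.
Qed.

Lemma is_derive_trace (f : R -> 'M[R]_3) t df :
  is_derive t 1 f df -> is_derive t 1 (fun s => \tr (f s)) (\tr df).
Proof. by move=> /is_derive_mxP h; apply: is_derive_bigsum => i; exact: h. Qed.

Lemma is_derive_unique (V : normedModType R) (f : R -> V) t d1 d2 :
  is_derive t 1 f d1 -> is_derive t 1 f d2 -> d1 = d2.
Proof. by move=> [_ <-] [_ <-]. Qed.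

Lemma derivable_is_derive1 (V : normedModType R) (f : R -> V) t :
  derivable f t 1 -> is_derive t 1 f (derive1 f t).
Proof. by move=> df; apply: DeriveDef => //; rewrite derive1E. Qed.

Lemma is_derive_derive1 (V : normedModType R) (f : R -> V) t d :
  is_derive t 1 f d -> derive1 f t = d.
Proof. by move=> [_ <-]; rewrite derive1E. Qed.

Lemma near_itv (a b t : R) : a < t < b -> \forall s \near t, a < s < b.
Proof. by move=> h; have /near_in_itvoo : t \in `]a, b[ by rewrite in_itv.
   Qed.

(** Differentiating [F^T F = 1] makes [F^T F'] skew-symmetric, and [hat] inverts [vee] on
    skew-symmetric matrices. *)
Lemma orthogonal_derive (F : R -> 'M[R]_3) a b t dF :
  (forall s, a < s < b -> (F s)^T *m F s = 1%:M) -> a < t < b ->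
  is_derive t 1 F dF -> dF = F t *m hat (vee ((F t)^T *m dF)).
Proof.
move=> hF tab hd.
have h1 : is_derive t 1 (fun s => (F s)^T *m F s) 0.
  apply: near_eq_is_derive (is_derive_cst (1%:M : 'M[R]_3) t 1).
  near=> s; rewrite /cst hF //; near: s; exact: near_itv.
have /esym h2 := is_derive_unique h1 (is_derive_mulmx (is_derive_trmx hd) hd).
have FF := mulmx1C (hF t tab).
have skew : ((F t)^T *m dF)^T = - ((F t)^T *m dF).
  by rewrite trmx_mul trmxK; apply/eqP; rewrite -addr_eq0 h2.
rewrite (_ : hat _ = (F t)^T *m dF) ?mulmxA ?FF ?mul1mx //.
move: ((F t)^T *m dF) skew => S /matrixP skew.
apply/matrixP; do 2 elim/forall3; rewrite ?hat_entries ?vee_entries //.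
- by have := skew 0 0; rewrite !mxE; lra.
- by have := skew 0 1; rewrite !mxE; lra.
- by have := skew 1 1; rewrite !mxE; lra.
- by have := skew 1 2%:R; rewrite !mxE; lra.
- by have := skew 0 2%:R; rewrite !mxE; lra.
- by have := skew 2%:R 2%:R; rewrite !mxE; lra.
Unshelve. all: by end_near. Qed.

End Derivatives.

(** * Regular functions *)

Section Regular.
Variables (R : realType) (I : Type).
Notation config := (I -> R).
Implicit Types (S : I -> Prop) (Dom : config -> Prop) (f g : config -> R) (B M L h : R).

(* Stands in for smoothness and compactness: regular functions are bounded and
   Lipschitz on bounded sets, and so are their derivatives along a vector field
   with regular components. *)
Inductive reg S Dom : (config -> R) -> Prop :=
| reg_coord j : S j -> reg S Dom (fun z => z j)
| reg_cst c : reg S Dom (fun=> c)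
| reg_add f g : reg S Dom f -> reg S Dom g -> reg S Dom (fun z => f z + g z)
| reg_mul f g : reg S Dom f -> reg S Dom g -> reg S Dom (fun z => f z * g z)
| reg_rsqrt f k : reg S Dom f -> 0 < k -> (forall z, Dom z -> k <= f z) ->
    reg S Dom (fun z => (Num.sqrt (f z))^-1).

(* Differentials of regular functions: linear in the second argument, with
   regular coefficients. *)
Inductive tanform S Dom : (config -> config -> R) -> Prop :=
| tanform0 : tanform S Dom (fun _ _ => 0)
| tanform_coord j : S j -> tanform S Dom (fun _ y => y j)
| tanform_add d e : tanform S Dom d -> tanform S Dom e ->
    tanform S Dom (fun z y => d z y + e z y)
| tanform_scale f d : reg S Dom f -> tanform S Dom d ->
    tanform S Dom (fun z y => f z * d z y).

Lemma reg_mono S S' Dom Dom' f :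
  (forall j, S j -> S' j) -> (forall z, Dom' z -> Dom z) ->
  reg S Dom f -> reg S' Dom' f.
Proof.
move=> hS hD; elim=> {f} [j|c|f g _ hf _ hg|f g _ hf _ hg|f k _ hf k0 hk].
- by move=> /hS; exact: reg_coord.
- exact: reg_cst.
- exact: reg_add.
- exact: reg_mul.
- by apply: reg_rsqrt hf k0 _ => z /hD; exact: hk.
Qed.

(** Chain rule, by induction on the construction of [f]. Only the point [c t] has to lie in [Dom]:
    positivity there is enough to differentiate the square root. *)
Lemma reg_tanform S Dom f : reg S Dom f ->
  exists2 d, tanform S Dom d &
    forall (c : R -> config) t y, Dom (c t) ->
      (forall j, S j -> is_derive t 1 (fun s => c s j) (y j)) ->
      is_derive t 1 (fun s => f (c s)) (d (c t) y).
Proof.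
elim=> {f} [j Sj|a|f g _ [d hd df] _ [e he dg]|f g rf [d hd df] rg [e he dg]|
            f k rf [d hd df] k0 hk].
- exists (fun _ y => y j); first exact: tanform_coord.
  by move=> c t y _; apply.
- exists (fun _ _ => 0); first exact: tanform0.
  by move=> *; exact: is_derive_cst.
- exists (fun z y => d z y + e z y); first exact: tanform_add.
  by move=> c t y D h; apply: is_derive_add; [exact: df|exact: dg].
- exists (fun z y => g z * d z y + f z * e z y).
    by apply: tanform_add; exact: tanform_scale.
  move=> c t y D h; apply: is_derive_eq.
    by apply: is_derive_mul; [exact: df|exact: dg].
  by rewrite mulrC.
- pose r z := (Num.sqrt (f z))^-1.
  have rr : reg S Dom r by apply: reg_rsqrt rf k0 hk.
  exists (fun z y => (- 2^-1 * (r z * (r z * r z))) * d z y).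
    apply: tanform_scale => //; apply: reg_mul; first exact: reg_cst.
    by do 2 apply: reg_mul => //.
  move=> c t y D h.
  have f0 : 0 < f (c t) by apply: lt_le_trans k0 (hk _ D).
  have ds := is_derive1_comp (is_derive1_sqrt f0) (df c t y D h).
  have s0 : Num.sqrt (f (c t)) != 0 by rewrite gt_eqF // sqrtr_gt0.
  apply: is_derive_eq (is_deriveV _ ds) _; first exact: s0.
  by rewrite /r /GRing.scale /=; field.
Qed.

(** Closes the class under differentiation along a regular vector field. The field may involve more
    coordinates than [d], whence the larger set [S']. *)
Lemma tanform_field S S' Dom d (F : config -> config) :
  tanform S Dom d -> (forall j, S j -> S' j) ->
  (forall j, S j -> reg S' Dom (fun z => F z j)) ->
  reg S' Dom (fun z => d z (F z)).
Proof.
move=> hd hS hF; elim: hd => {d} [|j|d e _ hd _ he|f d hf _ hd].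
- exact: reg_cst.
- exact: hF.
- exact: reg_add.
- by apply: reg_mul => //; apply: reg_mono hf.
Qed.

(** Splits the derivative along a perturbed motion into that of the model and the effect of the
    perturbation. *)
Lemma tanformD S Dom d z y y' : tanform S Dom d ->
  d z (fun j => y j + y' j) = d z y + d z y'.
Proof.
elim=> {d} [|j|d e _ hd _ he|f d hf _ hd] //; first by rewrite addr0.
- by rewrite hd he; ring.
- by rewrite hd; ring.
Qed.

Definition bounded_on S B (z : config) := forall j, S j -> `|z j| <= B.

Lemma reg_bounded S Dom f B : reg S Dom f ->
  exists2 M : R, 0 <= M & forall z, Dom z -> bounded_on S B z -> `|f z| <= M.
Proof.
elim=> {f} [j Sj|a|f g _ [M M0 hf] _ [N N0 hg]|f g rf [M M0 hf] rg [N N0 hg]|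
            f k rf [M M0 hf] k0 hk].
- by exists `|B| => // z _ /(_ _ Sj) h; apply: le_trans h (ler_norm _).
- by exists `|a|.
- exists (M + N); first exact: addr_ge0.
  move=> z D b; apply: le_trans (ler_normD _ _) _.
  by rewrite lerD ?hf ?hg.
- exists (M * N); first exact: mulr_ge0.
  by move=> z D b; rewrite normrM ler_pM ?hf ?hg.
- exists (Num.sqrt k)^-1; first by rewrite invr_ge0 sqrtr_ge0.
  move=> z D b; have fz := hk _ D.
  rewrite ger0_norm ?invr_ge0 ?sqrtr_ge0 // lef_pV2 ?posrE ?sqrtr_gt0 //.
  - by rewrite ler_wsqrtr.
  - exact: lt_le_trans fz.
Qed.

Lemma tanform_bounded S Dom d B : tanform S Dom d ->
  exists2 M : R, 0 <= M & forall z y (h : R), Dom z -> bounded_on S B z -> 0 <= h ->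
    bounded_on S h y -> `|d z y| <= M * h.
Proof.
elim=> {d} [|j Sj|d e _ [M M0 hd] _ [N N0 he]|f d rf _ [M M0 hd]].
- by exists 0 => // z y h *; rewrite normr0 mul0r.
- by exists 1 => // z y h _ _ _ /(_ _ Sj); rewrite mul1r.
- exists (M + N); first exact: addr_ge0.
  move=> z y h D b h0 by_; apply: le_trans (ler_normD _ _) _.
  by rewrite mulrDl lerD ?hd ?he.
- have [N N0 hf] := reg_bounded B rf.
  exists (N * M); first exact: mulr_ge0.
  by move=> z y h D b h0 by_; rewrite normrM -mulrA ler_pM ?hf ?hd.
Qed.

(** Differences are estimated directly along the construction of [f]; a mean value argument would
    ask for a convex [Dom]. *)
Lemma reg_lipschitz S Dom f B : reg S Dom f ->
  exists2 L : R, 0 <= L & forall z z' (h : R), Dom z -> Dom z' ->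
    bounded_on S B z -> bounded_on S B z' -> 0 <= h ->
    bounded_on S h (fun j => z j - z' j) -> `|f z - f z'| <= L * h.
Proof.
elim=> {f} [j Sj|a|f g _ [M M0 hf] _ [N N0 hg]|f g rf [M M0 hf] rg [N N0 hg]|
            f k rf [M M0 hf] k0 hk].
- by exists 1 => // z z' h _ _ _ _ _ /(_ _ Sj); rewrite mul1r.
- by exists 0 => // z z' h *; rewrite subrr normr0 mul0r.
- exists (M + N); first exact: addr_ge0.
  move=> z z' h D D' b b' h0 zz /=.
  rewrite (_ : _ - _ = f z - f z' + (g z - g z')); last by ring.
  apply: le_trans (ler_normD _ _) _.
  by rewrite mulrDl lerD ?hf ?hg.
- have [F F0 bf] := reg_bounded B rf.
  have [G G0 bg] := reg_bounded B rg.
  exists (M * G + F * N); first by rewrite addr_ge0 ?mulr_ge0.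
  move=> z z' h D D' b b' h0 zz /=.
  rewrite (_ : _ - _ = (f z - f z') * g z + f z' * (g z - g z')); last by ring.
  apply: le_trans (ler_normD _ _) _.
  rewrite [leRHS]mulrDl !normrM lerD //.
  + by rewrite mulrAC ler_pM ?hf ?bg.
  + by rewrite -mulrA ler_pM ?bf ?hg.
- pose r := Num.sqrt k; have r0 : 0 < r by rewrite sqrtr_gt0.
  (* With [x] and [y] the two square roots, [1/x - 1/y] is [(y^2 - x^2) / (x y (x + y))], and both
     roots are at least [r]. *)
  exists (M / (2 * r ^+ 3)); first by rewrite divr_ge0 // mulr_ge0 // exprn_ge0 // ltW.
  move=> z z' h D D' b b' h0 zz /=.
  have rz u : Dom u -> r <= Num.sqrt (f u) by move=> /hk ?; rewrite ler_wsqrtr.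
  have fE u : Dom u -> f u = Num.sqrt (f u) ^+ 2.
    by move=> /hk ku; rewrite sqr_sqrtr // (le_trans (ltW k0)).
  have := hf z z' h D D' b b' h0 zz; rewrite [f z in X in X -> _]fE // [f z' in X in X -> _]fE //.
  have := rz _ D; have := rz _ D'.
  move: (Num.sqrt (f z)) (Num.sqrt (f z')) => x y ry rx le.
  have x0 : 0 < x by apply: lt_le_trans rx.
  have y0 : 0 < y by apply: lt_le_trans ry.
  have -> : x^-1 - y^-1 = (y ^+ 2 - x ^+ 2) * (x * y * (x + y))^-1.
    by field; rewrite !gt_eqF //= addr_gt0.
  rewrite normrM distrC [leRHS]mulrAC ler_pM //.
  rewrite gtr0_norm ?invr_gt0 ?mulr_gt0 ?addr_gt0 //.
  rewrite lef_pV2 ?posrE ?mulr_gt0 ?addr_gt0 ?exprn_gt0 //.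
  rewrite (_ : 2 * r ^+ 3 = r * r * (r + r)); last by ring.
  by rewrite ler_pM ?ler_pM ?lerD ?mulr_ge0 ?addr_ge0 // ltW.
Qed.

Section Matrices.
Variables (S : I -> Prop) (Dom : config -> Prop).
Local Notation reg := (reg S Dom).

Definition regm m n (F : config -> 'M[R]_(m, n)) := forall i j, reg (fun z => F z i j).

Lemma reg_sum (J : finType) (f : J -> config -> R) :
  (forall i, reg (f i)) -> reg (fun z => \sum_i f i z).
Proof.
move=> h; rewrite (_ : (fun _ => _) = \sum_i f i).
  by elim/big_ind: _ => // [|f1 f2 h1 h2]; [exact: reg_cst|exact: reg_add].
by apply/funext => z; rewrite fct_sumE.
Qed.

Lemma reg_opp f : reg f -> reg (fun z => - f z).
Proof.
by move=> h; under eq_fun do rewrite -mulN1r; apply: reg_mul => //; exact: reg_cst.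
Qed.

Lemma regm_cst m n (A : 'M[R]_(m, n)) : regm (fun=> A).
Proof. by move=> i j; exact: reg_cst. Qed.

Lemma regm_add m n (F G : config -> 'M[R]_(m, n)) :
  regm F -> regm G -> regm (fun z => F z + G z).
Proof. by move=> hF hG i j; under eq_fun do rewrite mxE; exact: reg_add. Qed.

Lemma regm_opp m n (F : config -> 'M[R]_(m, n)) : regm F -> regm (fun z => - F z).
Proof. by move=> hF i j; under eq_fun do rewrite mxE; exact: reg_opp. Qed.

Lemma regm_sub m n (F G : config -> 'M[R]_(m, n)) :
  regm F -> regm G -> regm (fun z => F z - G z).
Proof. by move=> hF hG; apply: regm_add => //; exact: regm_opp. Qed.

Lemma regm_scale m n f (F : config -> 'M[R]_(m, n)) :
  reg f -> regm F -> regm (fun z => f z *: F z).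
Proof. by move=> hf hF i j; under eq_fun do rewrite mxE; exact: reg_mul. Qed.

Lemma regm_mul m n p (F : config -> 'M[R]_(m, n)) (G : config -> 'M[R]_(n, p)) :
  regm F -> regm G -> regm (fun z => F z *m G z).
Proof.
move=> hF hG i j; under eq_fun do rewrite mxE.
by apply: reg_sum => k; exact: reg_mul.
Qed.

Lemma regm_tr m n (F : config -> 'M[R]_(m, n)) : regm F -> regm (fun z => (F z)^T).
Proof. by move=> hF i j; under eq_fun do rewrite mxE; exact: hF. Qed.

Lemma regm_sum (J : finType) m n (F : J -> config -> 'M[R]_(m, n)) :
  (forall i, regm (F i)) -> regm (fun z => \sum_i F i z).
Proof. by move=> hF i j; under eq_fun do rewrite summxE; apply: reg_sum => k; exact: hF. Qed.

Lemma regm_col m1 m2 n (F : config -> 'M[R]_(m1, n)) (G : config -> 'M[R]_(m2, n)) :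
  regm F -> regm G -> regm (fun z => col_mx (F z) (G z)).
Proof.
move=> hF hG i j; case: (split_ordP i) => k ->.
- by under eq_fun do rewrite col_mxEu; exact: hF.
- by under eq_fun do rewrite col_mxEd; exact: hG.
Qed.

Lemma regm_hat (F : config -> 'cV[R]_3) : regm F -> regm (fun z => hat (F z)).
Proof.
move=> hF; elim/forall3; elim/forall3; under eq_fun do rewrite hat_entries;
  by [exact: reg_cst | apply: hF | apply: reg_opp; apply: hF].
Qed.

Lemma regm_vee (F : config -> 'M[R]_3) : regm F -> regm (fun z => vee (F z)).
Proof.
move=> hF i j; rewrite (ord1 j).
by elim/forall3: i; under eq_fun do rewrite vee_entries; exact: hF.
Qed.

Lemma regm_cross (F G : config -> 'cV[R]_3) :
  regm F -> regm G -> regm (fun z => cross (F z) (G z)).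
Proof. by move=> hF hG; apply: regm_mul => //; exact: regm_hat. Qed.

Lemma reg_dot (F G : config -> 'cV[R]_3) :
  regm F -> regm G -> reg (fun z => dot (F z) (G z)).
Proof.
move=> hF hG; have h : regm (fun z => (F z)^T *m G z).
  by apply: regm_mul => //; exact: regm_tr.
exact: h.
Qed.

Lemma regm_tanform m n (F : config -> 'M[R]_(m, n)) : regm F ->
  exists2 d : config -> config -> 'M[R]_(m, n),
    (forall i j, tanform S Dom (fun z y => d z y i j)) &
    forall (c : R -> config) t y, Dom (c t) ->
      (forall j, S j -> is_derive t 1 (fun s => c s j) (y j)) ->
      is_derive t 1 (fun s => F (c s)) (d (c t) y).
Proof.
move=> hF.
pose T (ij : 'I_m * 'I_n) d := tanform S Dom d /\
  forall (c : R -> config) t y, Dom (c t) ->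
    (forall j, S j -> is_derive t 1 (fun s => c s j) (y j)) ->
    is_derive t 1 (fun s => F (c s) ij.1 ij.2) (d (c t) y).
have /choice[d hd] : forall ij, exists d, T ij d.
  by move=> ij; have [d d1 d2] := reg_tanform (hF ij.1 ij.2); exists d.
exists (fun z y => \matrix_(i, j) d (i, j) z y).
  move=> i j; have [h _] := hd (i, j).
  rewrite (_ : (fun _ _ => _) = d (i, j)) //.
  by apply/funext => z; apply/funext => y; rewrite mxE.
move=> c t y D h; apply/is_derive_mxP => i j; rewrite mxE.
exact: (hd (i, j)).2.
Qed.

End Matrices.

Lemma regm_mono S S' Dom Dom' m n (F : config -> 'M[R]_(m, n)) :
  (forall j, S j -> S' j) -> (forall z, Dom' z -> Dom z) ->
  regm S Dom F -> regm S' Dom' F.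
Proof. by move=> hS hD hF i j; apply: reg_mono (hF i j). Qed.

(** The sum of the individual bounds serves for all indices at once. *)
Lemma bound_uniform (J : finType) (Q : J -> R -> Prop) :
  (forall i M N, M <= N -> Q i M -> Q i N) ->
  (forall i, exists2 M : R, 0 <= M & Q i M) -> exists2 M, 0 <= M & forall i, Q i M.
Proof.
move=> mono h; have /choice[m hm] : forall i, exists m, 0 <= m /\ Q i m.
  by move=> i; have [M M0 QM] := h i; exists M.
exists (\sum_i m i) => [|i]; first by apply: sumr_ge0 => i _; case: (hm i).
apply: mono (hm i).2; rewrite (bigD1 i) //= lerDl sumr_ge0 // => k _.
by case: (hm k).
Qed.

Lemma regm_bounded S Dom B (F : config -> 'cV[R]_3) : regm S Dom F ->
  exists2 M : R, 0 <= M & forall z, Dom z -> bounded_on S B z -> enorm (F z) <= M.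
Proof.
move=> hF; have [M M0 hM] : exists2 M : R, 0 <= M & forall i : 'I_3,
    forall z, Dom z -> bounded_on S B z -> `|F z i 0| <= M.
  apply: bound_uniform => [i M N MN h z D b|i]; first exact: le_trans (h z D b) MN.
  exact: reg_bounded (hF i 0).
exists (3 * M); first by rewrite mulr_ge0.
by move=> z D b; apply: enorm_le_entries => i; exact: hM.
Qed.

Lemma tanformm_bounded S Dom B (d : config -> config -> 'cV[R]_3) :
  (forall i j, tanform S Dom (fun z y => d z y i j)) ->
  exists2 M : R, 0 <= M & forall z y (h : R), Dom z -> bounded_on S B z -> 0 <= h ->
    bounded_on S h y -> enorm (d z y) <= M * h.
Proof.
move=> hF; have [M M0 hM] : exists2 M : R, 0 <= M & forall i : 'I_3,
    forall z y (h : R), Dom z -> bounded_on S B z -> 0 <= h ->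
    bounded_on S h y -> `|d z y i 0| <= M * h.
  apply: bound_uniform => [i M N MN h z y a D b a0 hy|i].
    by apply: le_trans (h z y a D b a0 hy) _; rewrite ler_wpM2r.
  exact: tanform_bounded (hF i 0).
exists (3 * M); first by rewrite mulr_ge0.
move=> z y h D b h0 hy; rewrite -mulrA; apply: enorm_le_entries => i; exact: hM.
Qed.

Lemma regm_lipschitz S Dom B (F : config -> 'cV[R]_3) : regm S Dom F ->
  exists2 L : R, 0 <= L & forall z z' (h : R), Dom z -> Dom z' ->
    bounded_on S B z -> bounded_on S B z' -> 0 <= h ->
    bounded_on S h (fun j => z j - z' j) -> enorm (F z - F z') <= L * h.
Proof.
move=> hF; have [M M0 hM] : exists2 M : R, 0 <= M & forall i : 'I_3,
    forall z z' (h : R), Dom z -> Dom z' ->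
    bounded_on S B z -> bounded_on S B z' -> 0 <= h ->
    bounded_on S h (fun j => z j - z' j) -> `|F z i 0 - F z' i 0| <= M * h.
  apply: bound_uniform => [i M N MN h z z' a D D' b b' a0 hy|i].
    by apply: le_trans (h z z' a D D' b b' a0 hy) _; rewrite ler_wpM2r.
  exact: reg_lipschitz (hF i 0).
exists (3 * M); first by rewrite mulr_ge0.
move=> z z' h D D' b b' h0 hy; rewrite -mulrA; apply: enorm_le_entries => i.
by rewrite !mxE; exact: hM.
Qed.

End Regular.

#[local] Hint Resolve reg_cst reg_add reg_mul reg_opp reg_dot regm_cst regm_add
  regm_opp regm_sub regm_scale regm_mul regm_tr regm_sum regm_col regm_hat
  regm_vee regm_cross : reg.

(** * The ideal control force as a regular function *)

Section SmoothFunctions.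
Variable R : realType.

(** Counterpart of [smooth] that peels off the first derivative instead of the last one, so that the
    product rule fits an induction on [k]. *)
Fixpoint diffn (V : normedModType R) (k : nat) (f : R -> V) : Prop :=
  if k is k'.+1 then (forall t, derivable f t 1) /\ diffn k' (derive1 f) else True.

Lemma smooth_diffn (V : normedModType R) (f : R -> V) :
  smooth f <-> forall k, diffn k f.
Proof.
split=> [h k|h k t].
  elim: k f h => //= k IH f h; split; first exact: h 0%N.
  by apply: IH => l t; rewrite -derive1Sn; exact: h.
have {h} := h k.+1; elim: k f => [|k IH] f [h1 h2].
  exact: h1.
by rewrite derive1Sn; exact: IH.
Qed.

Lemma smooth_is_derive (V : normedModType R) (f : R -> V) (k : nat) (t : R) :
  smooth f -> is_derive t 1 (derive1n k f) (derive1n k.+1 f t).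
Proof. by move=> h; rewrite derive1nS; apply: derivable_is_derive1; exact: h. Qed.

Lemma derive1_ext (V : normedModType R) (f g : R -> V) :
  (forall t : R, is_derive t 1 f (g t)) -> derive1 f = g.
Proof. by move=> h; apply/funext => t; exact: is_derive_derive1. Qed.

Lemma diffn_le (V : normedModType R) (f : R -> V) k : diffn k.+1 f -> diffn k f.
Proof. by elim: k f => //= k IH f [h1 h2]; split=> //; exact: IH. Qed.

Lemma diffn_add (V : normedModType R) k (f g : R -> V) :
  diffn k f -> diffn k g -> diffn k (fun t => f t + g t).
Proof.
elim: k f g => //= k IH f g [f1 f2] [g1 g2]; split.
  by move=> t; apply: derivableD.
rewrite (_ : derive1 _ = fun t => derive1 f t + derive1 g t); first exact: IH.
by apply: derive1_ext => t; apply: is_derive_add; exact: derivable_is_derive1.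
Qed.

Lemma diffn_mulmx m n p k (F : R -> 'M[R]_(m, n)) (G : R -> 'M[R]_(n, p)) :
  diffn k F -> diffn k G -> diffn k (fun t => F t *m G t).
Proof.
elim: k F G => //= k IH F G F1 G1.
have [f1 f2] := F1; have [g1 g2] := G1.
have h (t : R) : is_derive t 1 (fun t => F t *m G t) (derive1 F t *m G t + F t *m derive1 G t).
  by apply: is_derive_mulmx; exact: derivable_is_derive1.
split; first by move=> t; case: (h t).
rewrite (derive1_ext h).
by apply: diffn_add; apply: IH => //; exact: diffn_le.
Qed.

Lemma diffn_tr m n k (F : R -> 'M[R]_(m, n)) : diffn k F -> diffn k (fun t => (F t)^T).
Proof.
elim: k F => //= k IH F [f1 f2].
have h (t : R) : is_derive t 1 (fun t => (F t)^T) (derive1 F t)^T.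
  by apply: is_derive_trmx; exact: derivable_is_derive1.
split; first by move=> t; case: (h t).
by rewrite (derive1_ext h); exact: IH.
Qed.

Lemma diffn_vee k (F : R -> 'M[R]_3) : diffn k F -> diffn k (fun t => vee (F t)).
Proof.
elim: k F => //= k IH F [f1 f2].
have h (t : R) : is_derive t 1 (fun t => vee (F t)) (vee (derive1 F t)).
  by apply: is_derive_vee; exact: derivable_is_derive1.
split; first by move=> t; case: (h t).
by rewrite (derive1_ext h); exact: IH.
Qed.

End SmoothFunctions.

(** * Coordinates: the state together with the desired motion and its derivatives *)

Section Coordinates.
Variables (R : realType) (n : nat) (D : commands R n).

(** Position and velocity appear only through their errors, since the desired position need not be
    bounded; attitudes appear as matrices, whose entries are bounded. Derivatives of the commands
    are coordinates in their own right, so a bound in terms of coordinates is uniform in time. *)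
Inductive var := Vex of 'I_3 | Vev of 'I_3 | Va of nat & 'I_3
  | VR of 'I_3 & 'I_3 | VRd of 'I_3 & 'I_3 | VW of 'I_3 | VWd of nat & 'I_3
  | Vq of 'I_n & 'I_3 | Vw of 'I_n & 'I_3.

Notation config := (var -> R).
Implicit Types (z : config) (t s : R) (p : payload R) (q w : 'I_n -> 'cV[R]_3).

(** The order of the derivative is shifted for [Va]: [Va 0] is the desired acceleration, whereas
    [VWd 0] is the desired angular velocity itself. *)
Definition cfg t p q w : config := fun v => match v with
  | Vex k => e_x0 D t p k 0
  | Vev k => e_v0 D t p k 0
  | Va l k => derive1n l.+1 (v0d D) t k 0
  | VR k l => pR p k l
  | VRd k l => R0d D t k l
  | VW k => pW p k 0
  | VWd l k => derive1n l (W0d D) t k 0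
  | Vq j k => q j k 0
  | Vw j k => w j k 0
  end.

(* Level 0 carries mu_d and q_d; each time derivative along the model raises
   the level by one. *)
Definition level (m : nat) (v : var) : Prop := match v with
  | Va l _ => (l <= m)%N
  | VWd l _ => (l <= m.+1)%N
  | Vq _ _ => (1 <= m)%N
  | Vw _ _ => (2 <= m)%N
  | _ => True
  end.

Definition zex z : 'cV[R]_3 := \col_k z (Vex k).
Definition zev z : 'cV[R]_3 := \col_k z (Vev k).
Definition za l z : 'cV[R]_3 := \col_k z (Va l k).
Definition zR z : 'M[R]_3 := \matrix_(k, l) z (VR k l).
Definition zRd z : 'M[R]_3 := \matrix_(k, l) z (VRd k l).
Definition zW z : 'cV[R]_3 := \col_k z (VW k).
Definition zWd l z : 'cV[R]_3 := \col_k z (VWd l k).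
Definition zq j z : 'cV[R]_3 := \col_k z (Vq j k).
Definition zw j z : 'cV[R]_3 := \col_k z (Vw j k).

Section Levels.
Variables (m : nat) (Dom : config -> Prop).
Local Notation regm F := (regm (level m) Dom F).

Lemma regm_zex : regm zex.
Proof. by move=> i j; under eq_fun do rewrite mxE; apply: reg_coord. Qed.
Lemma regm_zev : regm zev.
Proof. by move=> i j; under eq_fun do rewrite mxE; apply: reg_coord. Qed.
Lemma regm_za l : (l <= m)%N -> regm (za l).
Proof. by move=> h i j; under eq_fun do rewrite mxE; apply: reg_coord. Qed.
Lemma regm_zR : regm zR.
Proof. by move=> i j; under eq_fun do rewrite mxE; apply: reg_coord. Qed.
Lemma regm_zRd : regm zRd.
Proof. by move=> i j; under eq_fun do rewrite mxE; apply: reg_coord. Qed.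
Lemma regm_zW : regm zW.
Proof. by move=> i j; under eq_fun do rewrite mxE; apply: reg_coord. Qed.
Lemma regm_zWd l : (l <= m.+1)%N -> regm (zWd l).
Proof. by move=> h i j; under eq_fun do rewrite mxE; apply: reg_coord. Qed.
Lemma regm_zq k : (1 <= m)%N -> regm (zq k).
Proof. by move=> h i j; under eq_fun do rewrite mxE; apply: reg_coord. Qed.
Lemma regm_zw k : (2 <= m)%N -> regm (zw k).
Proof. by move=> h i j; under eq_fun do rewrite mxE; apply: reg_coord. Qed.

End Levels.

Lemma zexE t p q w : zex (cfg t p q w) = e_x0 D t p.
Proof. by apply/matrixP => i j; rewrite (ord1 j) [LHS]mxE. Qed.
Lemma zevE t p q w : zev (cfg t p q w) = e_v0 D t p.
Proof. by apply/matrixP => i j; rewrite (ord1 j) [LHS]mxE. Qed.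
Lemma zaE l t p q w : za l (cfg t p q w) = derive1n l.+1 (v0d D) t.
Proof. by apply/matrixP => i j; rewrite (ord1 j) [LHS]mxE. Qed.
Lemma zRE t p q w : zR (cfg t p q w) = pR p.
Proof. by apply/matrixP => i j; rewrite [LHS]mxE. Qed.
Lemma zRdE t p q w : zRd (cfg t p q w) = R0d D t.
Proof. by apply/matrixP => i j; rewrite [LHS]mxE. Qed.
Lemma zWE t p q w : zW (cfg t p q w) = pW p.
Proof. by apply/matrixP => i j; rewrite (ord1 j) [LHS]mxE. Qed.
Lemma zWdE l t p q w : zWd l (cfg t p q w) = derive1n l (W0d D) t.
Proof. by apply/matrixP => i j; rewrite (ord1 j) [LHS]mxE. Qed.
Lemma zqE j t p q w : zq j (cfg t p q w) = q j.
Proof. by apply/matrixP => i k; rewrite (ord1 k) [LHS]mxE. Qed.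
Lemma zwE j t p q w : zw j (cfg t p q w) = w j.
Proof. by apply/matrixP => i k; rewrite (ord1 k) [LHS]mxE. Qed.
Definition zE := (zexE, zevE, zaE, zRE, zRdE, zWE, zWdE, zqE, zwE).

End Coordinates.

Arguments Vex {n}.
Arguments Vev {n}.
Arguments Va {n}.
Arguments VR {n}.
Arguments VRd {n}.
Arguments VW {n}.
Arguments VWd {n}.

#[local] Hint Resolve regm_zex regm_zev regm_za regm_zR regm_zRd regm_zW regm_zWd
  regm_zq regm_zw : reg.

Section Feedback.
Variables (R : realType) (n : nat) (P : plant R n) (K : gains R) (D : commands R n).
Notation config := (var n -> R).
Notation cfg := (cfg D).
Notation level := (@level n).
Implicit Types (z : config) (t s : R) (p : payload R) (q w : 'I_n -> 'cV[R]_3).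

Definition att_err_z z := att_err (zRd z) (zR z).
Definition vel_err_z z := vel_err (zRd z) (zR z) (zWd 0 z) (zW z).

Definition Fd_z z : 'cV[R]_3 :=
  m0 P *: (- (k_x0 K *: zex z) - k_v0 K *: zev z + za 0 z - grav P *: e3).

Definition Md_z z : 'cV[R]_3 :=
  let Q := (zR z)^T *m zRd z in
  - (k_R0 K *: att_err_z z) - k_W0 K *: vel_err_z z
  + hat (Q *m zWd 0 z) *m J0 P *m Q *m zWd 0 z + J0 P *m Q *m zWd 1 z.

(* The rows of P^T (P P^T)^-1 that belong to the i-th link. *)
Definition alloc i : 'M[R]_(3, 3 + 3) :=
  submxcol ((Pmat P)^T *m invmx (Pmat P *m (Pmat P)^T)) i.

Definition mu_d_z i z : 'cV[R]_3 :=
  zR z *m (alloc i *m col_mx ((zR z)^T *m Fd_z z) (Md_z z)).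

Definition mu_z j z : 'cV[R]_3 := zq j z *m (zq j z)^T *m mu_d_z j z.

Definition acc_z z : 'cV[R]_3 := grav P *: e3 + (m0 P)^-1 *: \sum_j mu_z j z.

Definition dW0_z z : 'cV[R]_3 :=
  invmx (J0 P) *m (\sum_j hat (rho P j) *m (zR z)^T *m mu_z j z
                   - hat (zW z) *m J0 P *m zW z).

Definition acc_pt_z i z : 'cV[R]_3 :=
  acc_z z - grav P *: e3 + zR z *m (hat (zW z) *m hat (zW z) *m rho P i)
  - zR z *m hat (rho P i) *m dW0_z z.

Definition q_d_z i z : 'cV[R]_3 :=
  - ((Num.sqrt (dot (mu_d_z i z) (mu_d_z i z)))^-1 *: mu_d_z i z).

(* The closed-loop vector field of the simplified model; [w] is frozen, as it is
   in [qmove]. *)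
Definition field z : config := fun v => match v with
  | Vex k => zev z k 0
  | Vev k => (acc_z z - za 0 z) k 0
  | Va l k => z (Va l.+1 k)
  | VR k l => (zR z *m hat (zW z)) k l
  | VRd k l => (zRd z *m hat (zWd 0 z)) k l
  | VW k => dW0_z z k 0
  | VWd l k => z (VWd l.+1 k)
  | Vq j k => cross (zw j z) (zq j z) k 0
  | Vw j k => 0
  end.

(** The tangent vector by which an actual motion departs from [field] at levels 0 and 1: only the
    payload accelerations differ between the two models. *)
Definition kick (d1 d2 : 'cV[R]_3) : config := fun v => match v with
  | Vev k => d1 k 0
  | VW k => d2 k 0
  | _ => 0
  end.

Lemma mu_dE t p q w i : mu_d P K D t p i = mu_d_z i (cfg t p q w).
Proof.
(* The block-diagonal factor rotates each block of three rows separately, so the i-th block can be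
   extracted before the rotation. *)
rewrite /mu_d -!mulmxA [X in _ *m X]mulmxA -[(Pmat P)^T *m _]submxcolK.
rewrite mulmxA mul_mxdiag_mxcol -submxcol_mul mxcolK -mulmxA.
by rewrite /mu_d_z /Fd_z /Md_z /att_err_z /vel_err_z !zE derive1n0 !derive1n1.
Qed.

Lemma mu_E t p q w i : mu P K D t p q i = mu_z i (cfg t p q w).
Proof. by rewrite /mu /mu_z (mu_dE _ _ q w) !zE. Qed.

Lemma acc_sE t p q w : acc_s P K D t p q = acc_z (cfg t p q w).
Proof. by rewrite /acc_s /acc_z; under eq_bigr do rewrite (mu_E _ _ _ w). Qed.

Lemma dW0_sE t p q w : dW0_s P K D t p q = dW0_z (cfg t p q w).
Proof. by rewrite /dW0_s /dW0_z; under eq_bigr do rewrite (mu_E _ _ _ w); rewrite !zE. Qed.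

Lemma acc_ptE t p q w i : acc_pt P K D t p q i = acc_pt_z i (cfg t p q w).
Proof. by rewrite /acc_pt /acc_pt_z (acc_sE _ _ _ w) (dW0_sE _ _ _ w) !zE expr2. Qed.

Lemma q_dE t p q w i : q_d P K D t p i = q_d_z i (cfg t p q w).
Proof. by rewrite /q_d /q_d_z -(mu_dE t p q w i). Qed.

Lemma regm_mu_d m Dom i : regm (level m) Dom (mu_d_z i).
Proof.
rewrite /mu_d_z /Fd_z /Md_z /att_err_z /vel_err_z /att_err /vel_err.
apply: regm_mul; first by auto with reg.
apply: regm_mul; first by auto with reg.
apply: regm_col; first by auto 20 with reg.
auto 30 with reg.
Qed.

End Feedback.

#[local] Hint Resolve regm_mu_d : reg.

Section TangentField.
Variables (R : realType) (n : nat) (P : plant R n) (K : gains R) (D : commands R n).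
Notation config := (var n -> R).
Implicit Types (z : config) (t s : R) (p : payload R) (q w : 'I_n -> 'cV[R]_3).
Notation cfg := (cfg D).
Notation mu_d_z := (mu_d_z P K).
Notation mu_z := (mu_z P K).
Notation acc_z := (acc_z P K).
Notation dW0_z := (dW0_z P K).
Notation acc_pt_z := (acc_pt_z P K).
Notation q_d_z := (q_d_z P K).
Notation field := (field P K).
Notation kick := (@kick R n).
Notation level := (@level n).

Section Levels.
Variables (m : nat) (Dom : config -> Prop).
Local Notation regm F := (regm (level m) Dom F).

Lemma regm_mu j : (1 <= m)%N -> regm (mu_z j).
Proof. by move=> ?; rewrite /mu_z; auto 10 with reg. Qed.

Lemma regm_acc : (1 <= m)%N -> regm acc_z.
Proof.
move=> ?; rewrite /acc_z; apply: regm_add; first exact: regm_cst.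
by apply: regm_scale; [exact: reg_cst|apply: regm_sum => j; exact: regm_mu].
Qed.

Lemma regm_dW0 : (1 <= m)%N -> regm dW0_z.
Proof.
move=> ?; rewrite /dW0_z; apply: regm_mul; first exact: regm_cst.
apply: regm_sub; last by auto 10 with reg.
apply: regm_sum => j; apply: regm_mul; last exact: regm_mu.
by auto 10 with reg.
Qed.

Lemma regm_acc_pt i : (1 <= m)%N -> regm (acc_pt_z i).
Proof.
move=> h; have := regm_acc h; have := regm_dW0 h => hd ha.
by rewrite /acc_pt_z; auto 20 with reg.
Qed.

End Levels.
(** One differentiation raises the level by one. [m <= 1] excludes the coordinates [Vw], where
    [field] holds only a placeholder. *)
Lemma reg_field m Dom v : (m <= 1)%N -> level m v ->
  reg (level m.+1) Dom (fun z => field z v).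
Proof.
move=> m1; case: v => [k|k|l k|k l|k l|k|l k|j k|j k] /= h.
- by apply: regm_zev.
- by apply: regm_sub; [apply: regm_acc|apply: regm_za].
- by apply: reg_coord.
- by apply: regm_mul; auto with reg.
- by apply: regm_mul; auto with reg.
- by apply: regm_dW0.
- by apply: reg_coord.
- by apply: regm_cross; auto with reg.
- by case: m h m1 => [|[|]].
Qed.

(* Motions along the simplified model, up to errors [d1] and [d2] on the
   accelerations of the payload. *)
Definition moves (t : R) (T : R -> R) (p : R -> payload R)
    (q w : R -> 'I_n -> 'cV[R]_3) (d1 d2 : 'cV[R]_3) : Prop :=
  [/\ is_derive t 1 T 1,
      is_derive t 1 (fun s => px (p s)) (pv (p t)),
      is_derive t 1 (fun s => pv (p s)) (acc_s P K D (T t) (p t) (q t) + d1),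
      is_derive t 1 (fun s => pR (p s)) (pR (p t) *m hat (pW (p t))) &
      is_derive t 1 (fun s => pW (p s)) (dW0_s P K D (T t) (p t) (q t) + d2)] /\
  forall j, is_derive t 1 (fun s => q s j) (cross (w t j) (q t j)).

Hypothesis hD : commands_smooth D.

Lemma W0d_smooth : smooth (W0d D).
Proof.
case: hD => -[_ /smooth_diffn hR _] _.
apply/smooth_diffn => k; apply: diffn_vee; apply: diffn_mulmx.
  by apply: diffn_tr; exact: hR.
by have [] := hR k.+1.
Qed.

Lemma is_derive_v0d l t : is_derive t 1 (derive1n l (v0d D)) (derive1n l.+1 (v0d D) t).
Proof.
apply: smooth_is_derive => k s.
by case: hD => -[hx _ _] _; have := hx k.+1 s; rewrite derive1Sn.
Qed.

Lemma is_derive_x0d t : is_derive t 1 (x0d D) (v0d D t).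
Proof. by case: hD => -[hx _ _] _; exact: (smooth_is_derive 0 t hx). Qed.

Lemma is_derive_W0d l t : is_derive t 1 (derive1n l (W0d D)) (derive1n l.+1 (W0d D) t).
Proof. by apply: smooth_is_derive W0d_smooth. Qed.

Lemma is_derive_R0d t : is_derive t 1 (R0d D) (R0d D t *m hat (W0d D t)).
Proof.
case: hD => -[_ hR _] hS.
have h : is_derive t 1 (R0d D) (derive1 (R0d D) t) := smooth_is_derive 0 t hR.
apply: (is_derive_eq h); apply: (@orthogonal_derive _ (R0d D) (t - 1) (t + 1) _ _ _ _ h).
- by move=> s _; case: (hS s) => -[].
- by rewrite ltrBlDr ltrDl ltr01.
Qed.

(** Serves both for the actual time and for the shifted time [t + s] of [pmove]. *)
Lemma is_derive_time (V : normedModType R) (f : R -> V) (T : R -> R) t df :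
  is_derive t 1 T 1 -> is_derive (T t) 1 f df -> is_derive t 1 (fun s => f (T s)) df.
Proof.
move=> [hT hT1] [hf hf1].
have dT : differentiable T t by apply/derivable1_diffP.
have df' : differentiable f (T t) by apply/derivable1_diffP.
have dc : differentiable (f \o T) t by apply: differentiable_comp.
apply: DeriveDef; first exact/derivable1_diffP.
have T1 : 'd T t 1 = 1 by rewrite -deriveE.
by rewrite deriveE // diff_comp //= T1 -deriveE.
Qed.

Lemma is_derive_cfg m t T (p : R -> payload R) (q w : R -> 'I_n -> 'cV[R]_3) d1 d2 : (m <= 1)%N -> moves t T p q w d1 d2 ->
  forall v, level m v -> is_derive t 1 (fun s => cfg (T s) (p s) (q s) (w s) v)
    (field (cfg (T t) (p t) (q t) (w t)) v + kick d1 d2 v).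
Proof.
move=> m1 [[hT hx hv hR hW] hq].
have entry m1' m2' (F : R -> 'M[R]_(m1', m2')) dF dF' i j :
    is_derive t 1 F dF -> dF i j = dF' -> is_derive t 1 (fun s => F s i j) dF'.
  by move=> /is_derive_mxP h <-.
case=> [k|k|l k|k l|k l|k|l k|j k|j k] /= h.
- apply: entry; first exact: is_derive_sub hx (is_derive_time hT (is_derive_x0d _)).
  by rewrite !zE addr0.
- apply: entry; first exact: is_derive_sub hv (is_derive_time hT (is_derive_v0d 0 _)).
  by rewrite (acc_sE _ _ _ _ _ _ (w t)) zaE addrAC [LHS]mxE.
- apply: entry; first exact: is_derive_time hT (is_derive_v0d l.+1 _).
  by rewrite addr0.
- by apply: (entry _ _ _ _ _ k l hR); rewrite !zE addr0.
- apply: entry; first exact: is_derive_time hT (is_derive_R0d _).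
  by rewrite !zE derive1n0 addr0.
- apply: (entry _ _ _ _ _ k 0 hW).
  by rewrite (dW0_sE _ _ _ _ _ _ (w t)) [LHS]mxE.
- apply: entry; first exact: is_derive_time hT (is_derive_W0d l _).
  by rewrite addr0.
- by apply: (entry _ _ _ _ _ k 0 (hq j)); rewrite !zE addr0.
- by case: m m1 h => [|[|]].
Qed.

Lemma pmove0 t p q : pmove P K D t p q 0 = p.
Proof. by rewrite /pmove !scale0r !addr0; case: (p). Qed.

Lemma qmove0 q w : qmove q w 0 = q.
Proof. by apply/funext => j; rewrite /qmove scale0r addr0. Qed.

Lemma moves_pmove t p q w :
  moves 0 (fun s => t + s) (pmove P K D t p q) (qmove q w) (fun=> w) 0 0.
Proof.
have line a b (x y : 'M[R]_(a, b)) : is_derive (0 : R) 1 (fun s => x + s *: y) y.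
  apply/is_derive_mxP => i j; under eq_fun do rewrite !mxE.
  have h := is_derive_mul (is_derive_id (0 : R) 1) (is_derive_cst (y i j) (0 : R) 1).
  apply: (is_derive_eq (is_derive_add (is_derive_cst (x i j) (0 : R) 1) h)).
  by rewrite /cst mul1r mulr0 addr0 add0r.
split; last by move=> j; rewrite qmove0; exact: line.
rewrite pmove0 qmove0 addr0 !addr0; split; try exact: line.
have h := is_derive_add (is_derive_cst t (0 : R) 1) (is_derive_id (0 : R) 1).
by apply: (is_derive_eq h); rewrite add0r.
Qed.

End TangentField.

#[local] Hint Resolve regm_mu regm_acc regm_dW0 regm_acc_pt : reg.

Section FeedbackDerivatives.
Variables (R : realType) (n : nat) (P : plant R n) (K : gains R) (D : commands R n).
Notation config := (var n -> R).
Implicit Types (z : config) (t s : R) (p : payload R) (q w : 'I_n -> 'cV[R]_3).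
Notation cfg := (cfg D).
Notation mu_d_z := (mu_d_z P K).
Notation mu_z := (mu_z P K).
Notation acc_z := (acc_z P K).
Notation dW0_z := (dW0_z P K).
Notation acc_pt_z := (acc_pt_z P K).
Notation q_d_z := (q_d_z P K).
Notation field := (field P K).
Notation kick := (@kick R n).
Notation level := (@level n).
Hypothesis hD : commands_smooth D.

(** The inequality is strict so that a motion starting in the domain stays in it for nearby times;
    identities valid on the domain can then be differentiated. *)
Definition dom (k : R) i z := k < dot (mu_d_z i z) (mu_d_z i z).

Lemma regm_q_d m k i : 0 < k -> regm (level m) (dom k i) (q_d_z i).
Proof.
move=> k0; apply: regm_opp; apply: regm_scale; last exact: regm_mu_d.
apply: (reg_rsqrt _ k0); last by move=> z; exact: ltW.
by apply: reg_dot; exact: regm_mu_d.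
Qed.

Lemma level_mono m m' (v : var n) : (m <= m')%N -> level m v -> level m' v.
Proof. by case: v => //= [l _|l _|_ _|_ _] mm h; apply: leq_trans h _. Qed.

Lemma moves_dom k i t T (p : R -> payload R) (q w : R -> 'I_n -> 'cV[R]_3) d1 d2 : moves P K D t T p q w d1 d2 ->
  dom k i (cfg (T t) (p t) (q t) (w t)) ->
  \forall s \near t, dom k i (cfg (T s) (p s) (q s) (w s)).
Proof.
move=> hm hd.
have hr : reg (level 0) setT (fun z => dot (mu_d_z i z) (mu_d_z i z)).
  by apply: reg_dot; exact: regm_mu_d.
have [d _ dd] := reg_tanform hr.
have := dd _ _ _ I (is_derive_cfg hD (leq0n 1) hm).
move=> [/derivable1_diffP/differentiable_continuous hc _].
exact: (@cvgr_gt _ _ _ _ _ _ hc _ hd).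
Qed.

(** [q_d] is regular at level 0; one derivative along [field] gives [w_d] at level 1, and a second
    one gives [u_star] at level 2. The differentials [DQ] and [DW] are linear, so a motion with
    perturbed accelerations adds exactly their value on the [kick]. Formulas are hidden behind
    existentials, as only regularity is used later. *)
Lemma feedback i (k : R) : 0 < k ->
  exists (wd us : config -> 'cV[R]_3) (DQ DW : config -> config -> 'cV[R]_3),
    [/\ forall a b, tanform (level 0) (dom k i) (fun z y => DQ z y a b),
        forall a b, tanform (level 1) (dom k i) (fun z y => DW z y a b),
        regm (level 1) (dom k i) wd & regm (level 2) (dom k i) us] /\
    [/\ forall t p q w, dom k i (cfg t p q w) ->
          w_d P K D t p q i = wd (cfg t p q w),
        forall t p q w, dom k i (cfg t p q w) ->
          u_star P K D t p q w i = us (cfg t p q w) &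
        forall t T (p : R -> payload R) (q w : R -> 'I_n -> 'cV[R]_3) d1 d2, moves P K D t T p q w d1 d2 ->
          dom k i (cfg (T t) (p t) (q t) (w t)) ->
          is_derive t 1 (fun s => q_d P K D (T s) (p s) i)
            (dq_d P K D (T t) (p t) (q t) i
             + DQ (cfg (T t) (p t) (q t) (w t)) (kick d1 d2)) /\
          is_derive t 1 (fun s => w_d P K D (T s) (p s) (q s) i)
            (dw_d P K D (T t) (p t) (q t) (w t) i
             + DW (cfg (T t) (p t) (q t) (w t)) (kick d1 d2))].
Proof.
move=> k0.
have [DQ tQ dQ] := regm_tanform (regm_q_d 0 i k0).
pose dq z := DQ z (field z).
have rdq : regm (level 1) (dom k i) dq.
  by move=> a b; apply: (tanform_field (tQ a b)) => [j|j]; [exact: level_mono|exact: reg_field].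
pose wd z := cross (q_d_z i z) (dq z).
have rwd : regm (level 1) (dom k i) wd by apply: regm_cross => //; exact: regm_q_d.
have [DW tW dW] := regm_tanform rwd.
pose dw z := DW z (field z).
have rdw : regm (level 2) (dom k i) dw.
  by move=> a b; apply: (tanform_field (tW a b)) => [j|j]; [exact: level_mono|exact: reg_field].
(* [dq_d] and [dw_d] are derivatives along [pmove], a motion with zero [kick]. *)
have DQ0 z y y' : (forall j, y' j = 0) -> DQ z (fun j => y j + y' j) = DQ z y.
  move=> h; congr (DQ z _); apply/funext => j; by rewrite h addr0.
have DW0 z y y' : (forall j, y' j = 0) -> DW z (fun j => y j + y' j) = DW z y.
  move=> h; congr (DW z _); apply/funext => j; by rewrite h addr0.
have kick0 v : kick 0 0 v = 0 by case: v => * /=; rewrite ?mxE.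
have dqE t p q w : dom k i (cfg t p q w) -> dq_d P K D t p q i = dq (cfg t p q w).
  move=> h; rewrite /dq_d /dq -(DQ0 _ (field _) _ kick0).
  set f := (fun s => q_d _ _ _ _ _ _).
  suff hf : is_derive (0 : R) 1 f (DQ (cfg t p q w) (fun j => field (cfg t p q w) j + kick 0 0 j)).
    exact: (is_derive_derive1 hf).
  rewrite /f (_ : (fun s => _) = fun s => q_d_z i (cfg (t + s) (pmove P K D t p q s) (qmove q w s) w)); last first.
    by apply/funext => s; exact: q_dE.
  have hm := moves_pmove P K D t p q w.
  have c0 : cfg (t + 0) (pmove P K D t p q 0) (qmove q w 0) w = cfg t p q w.
    by rewrite addr0 pmove0 qmove0.
  have := is_derive_cfg hD (leq0n 1) hm; rewrite c0 => hc.
  have := dQ (fun s => cfg (t + s) (pmove P K D t p q s) (qmove q w s) w) 0.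
  by rewrite c0; apply.
have wdE t p q w : dom k i (cfg t p q w) -> w_d P K D t p q i = wd (cfg t p q w).
  by move=> h; rewrite /w_d (q_dE _ _ _ _ _ q w) (dqE _ _ _ w).
have dwE t p q w : dom k i (cfg t p q w) -> dw_d P K D t p q w i = dw (cfg t p q w).
  move=> h; rewrite /dw_d /dw -(DW0 _ (field _) _ kick0).
  set f := (fun s => w_d _ _ _ _ _ _ _).
  suff hf : is_derive (0 : R) 1 f (DW (cfg t p q w) (fun j => field (cfg t p q w) j + kick 0 0 j)).
    exact: (is_derive_derive1 hf).
  have hm := moves_pmove P K D t p q w.
  have c0 : cfg (t + 0) (pmove P K D t p q 0) (qmove q w 0) w = cfg t p q w.
    by rewrite addr0 pmove0 qmove0.
  have hn := moves_dom hm; rewrite c0 in hn.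
  (* [w_d] agrees with the regular function [wd] on the domain only, hence near [s = 0] along the
     motion, which is enough for the derivative. *)
  apply: (near_eq_is_derive (f := fun s => wd (cfg (t + s) (pmove P K D t p q s) (qmove q w s) w))).
    by near=> s; apply/esym/wdE; near: s; exact: hn.
  have := is_derive_cfg hD (leqnn 1) hm; rewrite c0 => hc.
  have := dW (fun s => cfg (t + s) (pmove P K D t p q s) (qmove q w s) w) 0.
  by rewrite c0; apply.
pose us z := (mu_z i z + (mass P i * len P i * dot (zw i z) (zw i z)) *: zq i z
   + mass P i *: (zq i z *m (zq i z)^T *m acc_pt_z i z))
  + ((mass P i * len P i) *:
       (hat (zq i z) *m (- (k_q K *: cross (q_d_z i z) (zq i z))
                      - k_w K *: (zw i z + hat (zq i z) *m hat (zq i z) *m wd z)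
                      - dot (zq i z) (wd z) *: cross (zw i z) (zq i z)
                      - hat (zq i z) *m hat (zq i z) *m dw z))
     - mass P i *: (hat (zq i z) *m hat (zq i z) *m acc_pt_z i z)).
exists wd, us, DQ, DW; split; [split; [exact: tQ|exact: tW|exact: rwd|]|split; [exact: wdE| |]].
- have rq := regm_q_d 2 i k0.
  have rwd2 : regm (level 2) (dom k i) wd.
    by apply: regm_mono rwd => // j; exact: level_mono.
  have ra : regm (level 2) (dom k i) (acc_pt_z i) by exact: regm_acc_pt.
  have rm : regm (level 2) (dom k i) (mu_z i) by exact: regm_mu.
  have rzq : regm (level 2) (dom k i) (zq i) by exact: regm_zq.
  have rzw : regm (level 2) (dom k i) (zw i) by exact: regm_zw.
  have rqq : regm (level 2) (dom k i) (fun z => hat (zq i z) *m hat (zq i z)).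
    by apply: regm_mul; exact: regm_hat.
  rewrite /us; apply: regm_add.
    apply: regm_add; first apply: regm_add => //.
      apply: regm_scale => //; apply: reg_mul; first exact: reg_cst.
      exact: reg_dot.
    apply: regm_scale; first exact: reg_cst.
    by auto 10 with reg.
  apply: regm_sub; last first.
    by apply: regm_scale; [exact: reg_cst|exact: regm_mul].
  apply: regm_scale; first exact: reg_cst.
  apply: regm_mul; first exact: regm_hat.
  apply: regm_sub; last exact: regm_mul.
  apply: regm_sub; last first.
    by apply: regm_scale; [exact: reg_dot|exact: regm_cross].
  apply: regm_sub.
    apply: regm_opp; apply: regm_scale; first exact: reg_cst.
    exact: regm_cross.
  apply: regm_scale; first exact: reg_cst.
  by apply: regm_add => //; exact: regm_mul.
- move=> t p q w h.
  rewrite /u_star /us /e_w /e_q (wdE _ _ _ w h) (dwE _ _ _ _ h).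
  by rewrite (mu_E _ _ _ _ _ _ w) (acc_ptE _ _ _ _ _ _ w) (q_dE _ _ _ _ _ q w) !zE enorm2 !expr2.
move=> t T p q w d1 d2 hm h; split.
- rewrite (_ : (fun s => _) = fun s => q_d_z i (cfg (T s) (p s) (q s) (w s))); last first.
    by apply/funext => s; exact: q_dE.
  have := dQ _ _ _ h (is_derive_cfg hD (leq0n 1) hm).
  rewrite (dqE _ _ _ _ h) => /is_derive_eq; apply.
  by apply/matrixP => a b; rewrite (tanformD _ _ _ (tQ a b)) [RHS]mxE.
- have hn := moves_dom hm h.
  apply: (near_eq_is_derive (f := fun s => wd (cfg (T s) (p s) (q s) (w s)))).
    by near=> s; apply/esym/wdE; near: s; exact: hn.
  have := dW _ _ _ h (is_derive_cfg hD (leqnn 1) hm).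
  rewrite (dwE _ _ _ _ h) => /is_derive_eq; apply.
  by apply/matrixP => a b; rewrite (tanformD _ _ _ (tW a b)) [RHS]mxE.
Unshelve. all: by end_near. Qed.

End FeedbackDerivatives.

(** * Accelerations of the payload *)

Section Inertia.
Variable R : realType.
Implicit Types (x y : 'cV[R]_3) (J : 'M[R]_3).

Lemma inertia_unit J : inertia J -> J \in unitmx.
Proof.
move=> [Jt Jp]; rewrite -row_free_unit -kermx_eq0; apply/negPn/negP => h.
have /rowV0Pn[v vk v0] := h.
have vJ : v *m J = 0 by apply: sub_kermxP.
have := Jp v^T; rewrite -trmx0 (inj_eq trmx_inj) => /(_ v0).
rewrite -{1}Jt -trmx_mul vJ trmx0.
by rewrite dot0r ltxx.
Qed.

(* Cauchy-Schwarz for the form J: [|x|^4 <= (x . J x) (x . J^-1 x)]. *)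
Lemma inertia_lower J : inertia J ->
  exists2 c, 0 < c & forall x, c * enorm x ^+ 2 <= dot x (J *m x).
Proof.
move=> hJ; have uJ := inertia_unit hJ; case: (hJ) => Jt Jp.
have [c c0 hc] := mulmx_bound (invmx J).
exists c^-1 => [|x]; first by rewrite invr_gt0.
rewrite ler_pdivrMl //.
pose y := invmx J *m x; have Jy : J *m y = x by rewrite mulmxA mulmxV // mul1mx.
have Jsym u v : dot u (J *m v) = dot v (J *m u) by rewrite dot_mulmx Jt dotC.
have Jnn u : 0 <= dot u (J *m u).
  have [->|u0] := eqVneq u 0; first by rewrite dot0l.
  exact/ltW/Jp.
have xx : dot y (J *m x) = enorm x ^+ 2 by rewrite Jsym Jy enorm2.
have yy : dot y (J *m y) <= c * enorm x ^+ 2.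
  rewrite Jy dotC; apply: le_trans (dot_le_norms _ _) _.
  by have := hc x; have := enorm_ge0 x; rewrite expr2 => ? ?; nra.
(* Expanding, the two cross terms give [- 2 c |x|^2] and the last term is at most [c |x|^2];
   dividing by [c] leaves the claim. *)
have := Jnn (c *: x - y).
rewrite mulmxBr -scalemxAr dotBl !dotBr !dotZl !dotZr xx (Jsym x y) xx => h.
have c0' := c0.
have : 0 <= c * (c * dot x (J *m x)) - c * enorm x ^+ 2 by nra.
by rewrite -mulrBr pmulr_rge0 // subr_ge0.
Qed.

End Inertia.

Lemma row_gram_eq0 (R : realType) m (u : 'rV[R]_m) : u *m u^T = 0 -> u = 0.
Proof.
move=> /matrixP/(_ 0 0); rewrite !mxE => /psumr_eq0P hs.
apply/rowP => j; rewrite [RHS]mxE; apply/eqP; rewrite -sqrf_eq0 expr2.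
have := hs _ j isT; rewrite mxE => -> // k _.
by rewrite mxE -expr2 sqr_ge0.
Qed.

(** * Allocation of the desired force and moment to the links *)

Section ControlAllocation.
Variables (R : realType) (n : nat) (P : plant R n) (K : gains R) (D : commands R n).
Hypothesis hP : plant_ok P.

(** If [v] kills the Gram matrix, then [(v P) (v P)^T = 0], so [v P = 0], and full row rank gives
    [v = 0]. *)
Lemma Pmat_gram_unit : Pmat P *m (Pmat P)^T \in unitmx.
Proof.
case: hP => _ _ _ _ rk.
have fr : row_free (Pmat P) by rewrite /row_free eqn_leq rk rank_leq_row.
rewrite -row_free_unit -kermx_eq0; apply/negPn/negP => h.
have /rowV0Pn[v vk v0] := h.
have vJ : v *m (Pmat P *m (Pmat P)^T) = 0 by apply: sub_kermxP.
have vP : v *m Pmat P = 0.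
  by apply: row_gram_eq0; rewrite trmx_mul mulmxA -(mulmxA v) vJ mul0mx.
have v00 : v = 0 by apply: (row_free_inj fr); rewrite vP mul0mx.
by rewrite v00 eqxx in v0.
Qed.

Lemma alloc_sum (c : 'cV[R]_(3 + 3)) :
  \sum_j alloc P j *m c = usubmx c /\
  \sum_j hat (rho P j) *m (alloc P j *m c) = dsubmx c.
Proof.
have h : Pmat P *m ((Pmat P)^T *m invmx (Pmat P *m (Pmat P)^T)) *m c = c.
  by rewrite mulmxA mulmxV ?Pmat_gram_unit // mul1mx.
have e : \sum_j col_mx (1%:M : 'M[R]_3) (hat (rho P j)) *m (alloc P j *m c) = c.
  rewrite -[RHS]h -[X in _ *m X *m _]submxcolK mul_mxrow_mxcol mulmx_suml.
  by apply: eq_bigr => j _; rewrite mulmxA.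
split; rewrite -[in RHS]e.
- rewrite -[RHS]/(usubmx _) raddf_sum; apply: eq_bigr => j _.
  by rewrite /= mul_col_mx col_mxKu mul1mx.
- rewrite raddf_sum; apply: eq_bigr => j _.
  by rewrite /= mul_col_mx col_mxKd.
Qed.

(** The pseudo-inverse is a right inverse of [Pmat]: the forces [mu_d] would realize [Fd] and [Md]
    exactly, so the payload sees only the differences [mu - mu_d]. *)
Lemma mu_d_force t (p : payload R) : SO3 (pR p) ->
  \sum_j mu_d P K D t p j = Fd P K D t p /\
  \sum_j hat (rho P j) *m ((pR p)^T *m mu_d P K D t p j) = Md P K D t p.
Proof.
move=> hR.
have e j : mu_d P K D t p j =
    pR p *m (alloc P j *m col_mx ((pR p)^T *m Fd P K D t p) (Md P K D t p)).
  rewrite /mu_d -!mulmxA [X in _ *m X]mulmxA -[(Pmat P)^T *m _]submxcolK.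
  by rewrite mulmxA mul_mxdiag_mxcol -submxcol_mul mxcolK -mulmxA.
have [s1 s2] := alloc_sum (col_mx ((pR p)^T *m Fd P K D t p) (Md P K D t p)).
split.
- under eq_bigr do rewrite e.
  by rewrite -mulmx_sumr s1 col_mxKu mulmxA (SO3_tr hR) mul1mx.
- rewrite -[RHS](col_mxKd ((pR p)^T *m Fd P K D t p)) -s2.
  by apply: eq_bigr => j _; rewrite e [X in _ *m X]mulmxA; case: hR => -> _; rewrite mul1mx.
Qed.

End ControlAllocation.

Section UnitVectors.
Variable R : realType.
Implicit Types (q x y : 'cV[R]_3).

Lemma dyadE q x : q *m q^T *m x = dot q x *: q.
Proof. by rewrite -mulmxA (mx11_scalar (q^T *m x)) mul_mx_scalar. Qed.

Lemma hat_sqr q x : hat q *m (hat q *m x) = dot q x *: q - dot q q *: x.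
Proof. by vec3. Qed.

Lemma hat_sqrE q x : hat q ^+ 2 *m x = dot q x *: q - dot q q *: x.
Proof. by rewrite expr2 -mulmxE -mulmxA hat_sqr. Qed.

Lemma cross_self q : cross q q = 0. Proof. by vec3. Qed.

Lemma dot_cross q x : dot q (cross q x) = 0. Proof. by dot3. Qed.

Lemma dot_crossr q x : dot q (cross x q) = 0. Proof. by dot3. Qed.

Lemma S2_dot q : S2 q -> dot q q = 1.
Proof. by move=> h; rewrite -enorm2 h expr1n. Qed.

End UnitVectors.

Section ForceDecomposition.
Variable R : realType.
Implicit Types (q x y A X : 'cV[R]_3) (c m l : R).

(** [u] has the shape of [u_star], with [A] the acceleration of the attachment point and [X] the
    feedback on the link. Its second bracket is normal to [q]. *)
Lemma force_parallel q x A X c m l : dot q q = 1 ->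
  let u := (q *m q^T *m x + c *: q + m *: (q *m q^T *m A))
           + (l *: (hat q *m X) - m *: (hat q ^+ 2 *m A)) in
  q *m q^T *m u = q *m q^T *m x + c *: q + m *: (q *m q^T *m A).
Proof.
move=> q1 u; rewrite /u hat_sqrE q1 scale1r !dyadE.
rewrite -[hat q *m X]/(cross q X) !(dotDr, dotBr, dotZr, dotNr) dot_cross q1.
by apply: col3P; rewrite !mxE; ring.
Qed.

Lemma force_normal q x A X c m l : dot q q = 1 ->
  let u := (q *m q^T *m x + c *: q + m *: (q *m q^T *m A))
           + (l *: (hat q *m X) - m *: (hat q ^+ 2 *m A)) in
  hat q *m u = - (l *: (X - dot q X *: q)) + m *: (hat q *m A).
Proof.
move=> q1 u; rewrite /u hat_sqrE q1 scale1r !dyadE.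
have qq : hat q *m q = 0 by exact: cross_self.
rewrite !(mulmxDr, mulmxBr) -!scalemxAr !mulmxN -?scalemxAr !mulmxBr -?scalemxAr qq hat_sqr q1.
rewrite !scaler0 !add0r scale1r.
by apply: col3P; rewrite !mxE; ring.
Qed.

End ForceDecomposition.

(** * Deviation of the payload accelerations from the simplified model *)

Section Acceleration.
Variables (R : realType) (n : nat) (P : plant R n) (K : gains R) (D : commands R n).
Hypothesis hP : plant_ok P.
Variables (S : R -> state R n) (t : R).

Let p := pl (S t).
Let q := lq (S t).
Let w := lw (S t).

Definition force_err i : 'cV[R]_3 := thrust S (f_law P K D S) i t - us P K D S i t.

Definition acc_err : 'cV[R]_3 :=
  derive1 (fun s => pv (pl (S s))) t - acc_s P K D t p q.

Definition ang_err : 'cV[R]_3 :=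
  derive1 (fun s => pW (pl (S s))) t - dW0_s P K D t p q.

Definition pt_err i : 'cV[R]_3 := acc_err - pR p *m hat (rho P i) *m ang_err.

Hypothesis hM : on_manifold S t.

Let q1 i : dot (q i) (q i) = 1.
Proof. by apply: S2_dot; case: hM => _ /(_ i)[]. Qed.

Lemma pt_accE i :
  derive1 (fun s => pv (pl (S s))) t - grav P *: e3
  - pR p *m hat (rho P i) *m derive1 (fun s => pW (pl (S s))) t
  + pR p *m (hat (pW p) ^+ 2 *m rho P i) = acc_pt P K D t p q i + pt_err i.
Proof.
rewrite /acc_pt /pt_err /acc_err /ang_err.
rewrite mulmxBr; move: (_ *m dW0_s P K D t p q) => x.
move: (pR p *m _ *m _) (acc_s _ _ _ _ _ _) (derive1 _ _) => y z u.
by move: (grav P *: e3) (pR p *m _) => v v'; apply: col3P; rewrite !mxE; ring.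
Qed.

(** What the i-th link transmits to the payload beyond [mu]: the thrust error along the link, less
    the inertial force due to the error on the attachment acceleration. *)
Definition residual i : 'cV[R]_3 :=
  dot (q i) (force_err i) *: q i - (mass P i * dot (q i) (pt_err i)) *: q i.

Lemma link_forceE i :
  link_force P S (f_law P K D S) i t
  - mass P i *: (q i *m (q i)^T *m (derive1 (fun s => pv (pl (S s))) t - grav P *: e3
      - pR p *m hat (rho P i) *m derive1 (fun s => pW (pl (S s))) t))
  = mu P K D t p q i + residual i.
Proof.
rewrite /link_force /u_par -/p -/q -/w.
have -> : thrust S (f_law P K D S) i t = us P K D S i t + force_err i.
  by rewrite /force_err addrC subrK.
rewrite [in LHS]mulmxDr [X in X + _ - _ - _ - _](force_parallel _ _ _ _ _ _ (q1 i)).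
have := pt_accE i; set A := derive1 _ _ - _ - _ => hA.
have -> : A = acc_pt P K D t p q i + pt_err i - pR p *m (hat (pW p) ^+ 2 *m rho P i).
  by rewrite -hA addrK.
rewrite -/p -/q -/w -[_ *m pR p *m _]mulmxA.
move: (pR p *m (hat (pW p) ^+ 2 *m rho P i)) => y.
rewrite /mu /residual !dyadE -/p -/q -/w.
move: (acc_pt _ _ _ _ _ _ _) (mu_d _ _ _ _ _ _) (pt_err i) (force_err i) => A' x x' u.
rewrite !dotBr !dotDr.
by apply: col3P; rewrite !mxE; ring.
Qed.

(** Moving the quadrotor masses from the mass matrix to the right-hand side turns the equation into
    the simplified one, with forces [mu + residual]; the simplified equation is then subtracted. *)
Lemma acc_err_balance : payload_translation P S (f_law P K D S) t ->
  m0 P *: acc_err = \sum_i residual i.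
Proof.
rewrite /payload_translation -/p -/q -/w.
set a := derive1 _ t - _; set b := derive1 _ t => h.
have m0P : m0 P != 0 by case: hP => _ /lt0r_neq0 ? _ _ _.
have e : m0 P *: a = \sum_i (mu P K D t p q i + residual i).
  under eq_bigr do rewrite -link_forceE -/a -/b.
  rewrite sumrB -h mulmxDl mul_scalar_mx mulmx_suml -!addrA -[LHS]addr0; congr (_ + _).
  apply/esym/eqP; rewrite addrA subr_eq0 -sumrB; apply/eqP; apply: eq_bigr => i _.
  rewrite -scalemxAl [in RHS]mulmxBr scalerBr; congr (_ - _ *: _).
  by rewrite !mulmxA.
rewrite /acc_err /acc_s opprD addrA -/a.
by rewrite scalerBr e scalerA mulfV // scale1r big_split /= addrAC subrr add0r.
Qed.

Lemma ang_err_balance : payload_rotation P S (f_law P K D S) t ->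
  J0 P *m ang_err = \sum_i hat (rho P i) *m (pR p)^T *m residual i.
Proof.
rewrite /payload_rotation -/p -/q -/w.
set a := derive1 _ t - _; set b := derive1 _ t => h.
have uJ : J0 P \in unitmx by apply: inertia_unit; case: hP.
have e : J0 P *m b + hat (pW p) *m J0 P *m pW p =
    \sum_i hat (rho P i) *m (pR p)^T *m (mu P K D t p q i + residual i).
  under eq_bigr do rewrite -link_forceE -/a -/b mulmxBr.
  rewrite sumrB -h mulmxBl mulmx_suml.
  set X := hat (pW p) *m _ *m _; rewrite -!addrA [X + _]addrC !addrA; congr (_ + _).
  rewrite -!addrA -[LHS]addr0; congr (_ + _).
  rewrite -sumrN -sumrN -!big_split /=; apply/esym; apply: big1 => i _.
  rewrite -scalemxAr -scalemxAl; set H := hat _ *m _.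
  have -> : H *m (q i *m (q i)^T *m (a - pR p *m hat (rho P i) *m b)) =
      H *m (q i *m (q i)^T) *m a - H *m (q i *m (q i)^T) *m pR p *m hat (rho P i) *m b.
    by rewrite mulmxA [LHS]mulmxBr !mulmxA.
  by rewrite scalerBr subKr addNr.
rewrite /ang_err mulmxBr -/b /dW0_s mulKVmx //.
move/esym/eqP: e; rewrite -subr_eq => /eqP <-.
rewrite opprB addrA subrK; under eq_bigr do rewrite mulmxDr.
by rewrite big_split /= addrAC subrr add0r.
Qed.

End Acceleration.

Section AccelerationBound.
Variables (R : realType) (n : nat) (P : plant R n) (K : gains R) (D : commands R n).
Hypothesis hP : plant_ok P.

Lemma hat_rho_bound : exists2 c : R, 0 <= c &
  forall i x, enorm (hat (rho P i) *m x) <= c * enorm x.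
Proof.
apply: bound_uniform => [i M N MN h x|i].
  by apply: le_trans (h x) _; rewrite ler_wpM2r ?enorm_ge0.
by have [c c0 hc] := mulmx_bound (hat (rho P i)); exists c; rewrite // ltW.
Qed.

Lemma dot_torque (x y r : 'cV[R]_3) (A : 'M[R]_3) :
  dot x (hat y *m A^T *m r) = - dot (A *m hat y *m x) r.
Proof. by dot3. Qed.

(** An energy argument avoids inverting the coupled mass matrix. Pairing the two balances with
    [acc_err] and [ang_err] gives the sum of [pt_err . residual], in which the quadrotor masses
    contribute [- m (q . pt_err)^2 <= 0]; only force errors remain. *)
Lemma acc_err_bound : exists2 C : R, 0 <= C & forall (S : R -> state R n) t,
  on_manifold S t -> payload_translation P S (f_law P K D S) t ->
  payload_rotation P S (f_law P K D S) t ->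
  let X := \sum_i enorm (force_err P K D S t i) in
  [/\ enorm (acc_err P K D S t) <= C * X, enorm (ang_err P K D S t) <= C * X &
      forall i, enorm (pt_err P K D S t i) <= C * X].
Proof.
have [c c0 hc] := hat_rho_bound.
have [m0P hJ hm] : [/\ 0 < m0 P, inertia (J0 P) & forall i, 0 < mass P i].
  by case: hP => _ ? ? h _; split=> // i; case: (h i).
have [l l0 hl] := inertia_lower hJ.
pose g := Num.min (m0 P) l.
have g0 : 0 < g by rewrite lt_min m0P l0.
have gm : g <= m0 P by rewrite ge_min lexx.
have gl : g <= l by rewrite ge_min lexx orbT.
(* With [a], [b] the norms of the two errors, [g (a^2 + b^2) <= (a + c b) X], and
   [(a + b)^2 <= 2 (a^2 + b^2)]; one factor [a + b] then cancels. *)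
pose C0 := 2 * (1 + c) / g.
have C00 : 0 <= C0 by rewrite divr_ge0 ?ltW // mulr_gt0 // ltr_wpDr.
exists ((1 + c) * C0) => [|S t hM hT hR X]; first by rewrite mulr_ge0 // addr_ge0.
set d1 := acc_err _ _ _ _ _; set d2 := ang_err _ _ _ _ _.
have X0 : 0 <= X by apply: sumr_ge0 => i _; exact: enorm_ge0.
have ptle i : enorm (pt_err P K D S t i) <= enorm d1 + c * enorm d2.
  rewrite /pt_err; apply: le_trans (enormB _ _) _; rewrite lerD2l -mulmxA.
  by rewrite orthogonal_enorm //; case: hM => -[].
have energy : m0 P * dot d1 d1 + dot d2 (J0 P *m d2) =
    \sum_i dot (pt_err P K D S t i) (residual P K D S t i).
  rewrite -dotZr (acc_err_balance hP hM hT) (ang_err_balance hP hM hR).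
  rewrite !dot_sumr -big_split /=; apply: eq_bigr => i _.
  by rewrite dot_torque -/d1 -/d2 -dotBl.
have upper : m0 P * dot d1 d1 + dot d2 (J0 P *m d2) <=
    (enorm d1 + c * enorm d2) * X.
  rewrite energy mulr_sumr; apply: ler_sum => i _.
  have q1 : dot (lq (S t) i) (lq (S t) i) = 1 by apply: S2_dot; case: hM => _ /(_ i)[].
  have qn : enorm (lq (S t) i) = 1 by rewrite /enorm q1 sqrtr1.
  rewrite /residual dotBr !dotZr (dotC (lq (S t) i) (pt_err _ _ _ _ _ _)).
  have h1 := dot_le (lq (S t) i) (force_err P K D S t i).
  have h2 := dot_le (pt_err P K D S t i) (lq (S t) i).
  rewrite qn ?mul1r ?mulr1 in h1 h2.
  have h3 : 0 <= mass P i * dot (pt_err P K D S t i) (lq (S t) i) * dot (pt_err P K D S t i) (lq (S t) i).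
    by rewrite -mulrA mulr_ge0 ?(ltW (hm i)) // -expr2 sqr_ge0.
  have h4 : dot (lq (S t) i) (force_err P K D S t i) * dot (pt_err P K D S t i) (lq (S t) i)
      <= enorm (force_err P K D S t i) * enorm (pt_err P K D S t i).
    by apply: le_trans (ler_norm _) _; rewrite normrM ler_pM.
  have h5 : enorm (force_err P K D S t i) * enorm (pt_err P K D S t i) <=
      (enorm d1 + c * enorm d2) * enorm (force_err P K D S t i).
    by rewrite mulrC ler_wpM2r ?enorm_ge0.
  by apply: le_trans h5; apply: le_trans h4; rewrite lerBlDr lerDl.
have key : enorm d1 + enorm d2 <= C0 * X.
  have := hl d2; rewrite -enorm2 in upper => low.
  have [a0 b0] := (enorm_ge0 d1, enorm_ge0 d2).
  move: (enorm d1) (enorm d2) a0 b0 (dot _ (J0 P *m _)) upper low => a b a0 b0 e up low.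
  rewrite /C0 mulrAC ler_pdivlMr //.
  have h1 : g * (a ^+ 2 + b ^+ 2) <= (a + c * b) * X.
    apply: le_trans up; rewrite mulrDr lerD ?ler_wpM2r ?sqr_ge0 //.
    by apply: le_trans low; rewrite ler_wpM2r ?sqr_ge0.
  have h2 : (a + b) * ((a + b) * g) <= (a + b) * (2 * (1 + c) * X).
    have : (a + c * b) * X <= (1 + c) * (a + b) * X by rewrite ler_wpM2r //; nra.
    have : 0 <= g * (a - b) ^+ 2 by rewrite mulr_ge0 ?sqr_ge0 // ltW.
    nra.
  have [ab|ab] := ltP 0 (a + b); first by rewrite -(ler_pM2l ab).
  have -> : a + b = 0 by apply/eqP; rewrite eq_le ab addr_ge0.
  by rewrite mul0r !mulr_ge0 // addr_ge0.
have [a0 b0] := (enorm_ge0 d1, enorm_ge0 d2).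
have CX : C0 * X <= (1 + c) * C0 * X.
  have CX0 : 0 <= C0 * X by exact: mulr_ge0.
  by rewrite -mulrA ler_peMl // lerDl.
split.
- by apply: le_trans CX; apply: le_trans key; rewrite lerDl.
- by apply: le_trans CX; apply: le_trans key; rewrite lerDr.
- move=> i; apply: le_trans (ptle i) _; rewrite -mulrA.
  apply: (@le_trans _ _ ((1 + c) * (enorm d1 + enorm d2))); first by nra.
  by rewrite ler_wpM2l ?addr_ge0.
Qed.

End AccelerationBound.

Lemma unit_derive_orth (R : realType) (f : R -> 'cV[R]_3) t df :
  (\forall s \near t, dot (f s) (f s) = 1) -> is_derive t 1 f df -> dot (f t) df = 0.
Proof.
move=> h hf.
have h0 : is_derive t 1 (fun s => dot (f s) (f s)) 0.
  apply: near_eq_is_derive (is_derive_cst (1 : R) t 1).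
  by near=> s; rewrite /cst; apply/esym; near: s.
have := is_derive_unique h0 (is_derive_dot hf hf).
rewrite (dotC df) -mulr2n => /esym/eqP; rewrite mulrn_eq0 /= => /eqP //.
Unshelve. all: by end_near. Qed.

(** * Error dynamics *)

Section LinkErrors.
Variables (R : realType) (n : nat) (P : plant R n) (K : gains R) (D : commands R n).
Hypothesis (hP : plant_ok P) (hK : gains_ok K).
Variables (S : R -> state R n) (t : R) (i : 'I_n).

Let p := pl (S t).
Let q := lq (S t) i.
Let w := lw (S t) i.
Let qd := q_d P K D t p i.
Let wd := w_d P K D t p (lq (S t)) i.
Let dqd := dq_d P K D t p (lq (S t)) i.
Let dwd := dw_d P K D t p (lq (S t)) (lw (S t)) i.
Let eq := e_q P K D t p (lq (S t)) i.
Let ew := e_w P K D t p (lq (S t)) (lw (S t)) i.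

Hypothesis hM : on_manifold S t.
Hypothesis hk : kinematics S t.
Hypothesis hv : velocities_derivable S t.
Hypothesis hl : link_dynamics P S (f_law P K D S) t.
Hypothesis hqd1 : dot qd qd = 1.
Hypothesis hdqd : dot qd dqd = 0.

Let q1 : dot q q = 1.
Proof. by apply: S2_dot; case: hM => _ /(_ i)[]. Qed.
Let qw : dot q w = 0.
Proof. by case: hM => _ /(_ i)[]. Qed.

Lemma dqdE : cross wd qd = dqd.
Proof.
have -> : cross wd qd = dot qd qd *: dqd - dot qd dqd *: qd.
  by rewrite /wd /w_d -/qd -/dqd; clearbody qd dqd; vec3.
by rewrite hqd1 hdqd scale1r scale0r subr0.
Qed.

(** [w] is compared with the component of [w_d] normal to [q], so [e_w] stays normal to [q] too. *)
Lemma e_wE : ew = w + dot q wd *: q - wd.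
Proof. by rewrite /ew /e_w hat_sqrE -/q q1 scale1r addrA. Qed.

Lemma dot_q_eq : dot q eq = 0. Proof. exact: dot_crossr. Qed.

Lemma dot_q_ew : dot q ew = 0.
Proof. by rewrite e_wE dotBr dotDr dotZr q1 qw mulr1 add0r subrr. Qed.

(** Effects on [e_w] of the attachment acceleration error, of the thrust error, and of the deviation
    [zeta] of the derivative of [w_d] from [dw_d]; the last bracket is [hat q ^+ 2 *m zeta]. *)
Definition link_pert zeta : 'cV[R]_3 :=
  (len P i)^-1 *: cross q (pt_err P K D S t i)
  - (mass P i * len P i)^-1 *: cross q (force_err P K D S t i)
  + (dot q zeta *: q - zeta).

(** The normal part of [u_star] cancels the attachment acceleration [acc_pt], leaving the designed
    feedback and the two errors. *)
Lemma link_velocity : is_derive t 1 (fun s => lw (S s) i)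
  (- (k_q K *: eq) - k_w K *: ew - dot q wd *: cross w q - (dot q dwd *: q - dwd)
   + ((len P i)^-1 *: cross q (pt_err P K D S t i)
      - (mass P i * len P i)^-1 *: cross q (force_err P K D S t i))).
Proof.
have [m0 l0] : mass P i != 0 /\ len P i != 0.
  by case: hP => _ _ _ /(_ i)[/lt0r_neq0 ? /lt0r_neq0].
have [_ _ /(_ i)[hw _]] := hv.
apply: is_derive_eq (derivable_is_derive1 hw) _.
rewrite hl -/q -/p.
have -> : derive1 (fun s => pv (pl (S s))) t - grav P *: e3 -
    pR p *m hat (rho P i) *m derive1 (fun s => pW (pl (S s))) t +
    pR p *m (hat (pW p) ^+ 2 *m rho P i) = acc_pt P K D t p (lq (S t)) i + pt_err P K D S t i.
  exact: pt_accE.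
have -> : hat q *m u_perp S (f_law P K D S) i t =
    hat q *m us P K D S i t + cross q (force_err P K D S t i).
  rewrite /u_perp mulmxBl mul1mx mulmxBr -/q -!mulmxA (mulmxA (hat q)).
  rewrite [hat q *m q]cross_self mul0mx subr0 /force_err /cross.
  by rewrite mulmxBr addrC subrK.
rewrite /us /u_star -/p -/q -/w -/eq -/ew -/wd -/dwd (force_normal _ _ _ _ _ _ q1).
rewrite hat_sqrE q1 scale1r.
set X := - _ - _ - _ - _.
(* The feedback is already normal to [q], so the projection in [force_normal] leaves it
   unchanged. *)
have qX : dot q X = 0.
  rewrite /X !dotBr dotNr !dotZr dot_q_eq dot_q_ew dot_crossr q1; ring.
rewrite qX scale0r subr0 mulmxDr -![hat q *m _]/(cross q _).
clearbody X.
move: (cross q _) (cross q _) (cross q _) => x y z.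
by apply: col3P; rewrite !mxE; field; rewrite m0 l0.
Qed.

Variables eta zeta : 'cV[R]_3.
Hypothesis hqd : is_derive t 1 (fun s => q_d P K D s (pl (S s)) i) (dqd + eta).
Hypothesis hwd : is_derive t 1 (fun s => w_d P K D s (pl (S s)) (lq (S s)) i) (dwd + zeta).
Hypothesis heta : dot qd eta = 0.

Let hq : is_derive t 1 (fun s => lq (S s) i) (cross w q).
Proof. by case: hk => _ _ /(_ i)[]. Qed.

(** [eta] and [zeta] are the deviations of the derivatives of [q_d] and [w_d] from the model values.
    The extra term along [q] disappears from the estimates, since [e_q] and [e_w] are both normal to
    [q]. *)
Lemma e_w_derive : is_derive t 1
  (fun s => e_w P K D s (pl (S s)) (lq (S s)) (lw (S s)) i)
  (- (k_q K *: eq) - k_w K *: ew + dot (cross w q) wd *: q + link_pert zeta).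
Proof.
have -> : (fun s => e_w P K D s (pl (S s)) (lq (S s)) (lw (S s)) i) =
    fun s => lw (S s) i + cross (lq (S s) i) (cross (lq (S s) i)
      (w_d P K D s (pl (S s)) (lq (S s)) i)).
  by apply/funext => s; rewrite /e_w /cross expr2 -mulmxE mulmxA.
have h := is_derive_add link_velocity
  (is_derive_cross hq (is_derive_cross hq hwd)).
apply: (is_derive_eq h); rewrite -/q -/p -/wd /link_pert.
rewrite crossDr !cross_cross q1 (dotC (cross w q) q) dot_crossr dotDr.
move: (cross q (pt_err _ _ _ _ _ _)) (cross q (force_err _ _ _ _ _ _)) (cross w q) => x y z.
clearbody eq ew wd dwd q.
by apply: col3P; rewrite !mxE; ring.
Qed.

Lemma e_q_derive : is_derive t 1 (fun s => e_q P K D s (pl (S s)) (lq (S s)) i)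
  (cross wd eq + cross qd (cross ew q) + cross eta q).
Proof.
apply: (is_derive_eq (is_derive_cross hqd hq)).
rewrite -/qd -/q -dqdE e_wE /eq /e_q -/p -/q -/qd.
clearbody qd q wd.
by vec3.
Qed.

Lemma psi_derive : is_derive t 1
  (fun s => 1 - dot (lq (S s) i) (q_d P K D s (pl (S s)) i))
  (dot eq ew - dot (cross qd eta) eq).
Proof.
have h := is_derive_sub (is_derive_cst (1 : R) t 1) (is_derive_dot hq hqd).
apply: (is_derive_eq h); rewrite -/qd -/q -/p -dqdE e_wE /eq /e_q -/p -/q -/qd.
(* As [eta] is normal to [q_d], its contribution carries a factor [e_q]; a bare [q . eta] would not
   be small with the errors. *)
have e1 : dot (cross qd eta) (cross qd q) = dot q eta.
  have -> : dot (cross qd eta) (cross qd q) = dot qd qd * dot q eta - dot qd q * dot qd eta by dot3.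
  by rewrite hqd1 heta mulr0 subr0 mul1r.
rewrite e1; clearbody qd q wd; dot3.
Qed.

(** The energy, with derivative [D1], dissipates [e_w] only; the cross term, with derivative [D2],
    supplies the missing [- k_q |e_q|^2]. Both bounds have the form expected by
    [lyapunov_weights]. *)
Lemma link_estimate h Bw : enorm eta <= h -> enorm (link_pert zeta) <= h ->
  enorm wd <= Bw ->
  exists D1 D2 : R,
  [/\ is_derive t 1 (fun s =>
        2^-1 * dot (e_w P K D s (pl (S s)) (lq (S s)) (lw (S s)) i)
                   (e_w P K D s (pl (S s)) (lq (S s)) (lw (S s)) i)
        + k_q K * (1 - dot (lq (S s) i) (q_d P K D s (pl (S s)) i))) D1,
      is_derive t 1 (fun s => dot (e_q P K D s (pl (S s)) (lq (S s)) i)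
                   (e_w P K D s (pl (S s)) (lq (S s)) (lw (S s)) i)) D2,
      D1 <= - k_w K * enorm ew ^+ 2 + (1 + k_q K) * h * (enorm eq + enorm ew) &
      D2 <= - k_q K * enorm eq ^+ 2 + (Bw + k_w K) * (enorm eq * enorm ew)
            + enorm ew ^+ 2 + h * (enorm eq + enorm ew)].
Proof.
move=> h1 h2 h3.
have hew := e_w_derive; have heq := e_q_derive.
exists (2^-1 * (dot (- (k_q K *: eq) - k_w K *: ew + dot (cross w q) wd *: q + link_pert zeta) ew
  + dot ew (- (k_q K *: eq) - k_w K *: ew + dot (cross w q) wd *: q + link_pert zeta))
  + k_q K * (dot eq ew - dot (cross qd eta) eq)).
exists (dot (cross wd eq + cross qd (cross ew q) + cross eta q) ew
  + dot eq (- (k_q K *: eq) - k_w K *: ew + dot (cross w q) wd *: q + link_pert zeta)).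
have [kq kw] : 0 < k_q K /\ 0 < k_w K by case: hK => _ [].
have qn : enorm q = 1 by rewrite /enorm q1 sqrtr1.
have qdn : enorm qd = 1 by rewrite /enorm hqd1 sqrtr1.
have [a0 b0] := (enorm_ge0 eq, enorm_ge0 ew).
have h0 : 0 <= h by apply: le_trans h1; exact: enorm_ge0.
have i1 : dot ew (link_pert zeta) <= enorm ew * h.
  by apply: le_trans (dot_le_norms _ _) _; rewrite ler_wpM2l.
have i2 : dot eq (link_pert zeta) <= enorm eq * h.
  by apply: le_trans (dot_le_norms _ _) _; rewrite ler_wpM2l.
have i3 : - dot (cross qd eta) eq <= h * enorm eq.
  rewrite -dotNl; apply: le_trans (dot_le_norms _ _) _; rewrite enormN ler_wpM2r //.
  by apply: le_trans (enorm_cross _ _) _; rewrite qdn mul1r.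
have i4 : - dot eq ew <= enorm eq * enorm ew.
  by rewrite -dotNl; apply: le_trans (dot_le_norms _ _) _; rewrite enormN.
have i5 : dot (cross wd eq) ew <= Bw * (enorm eq * enorm ew).
  apply: le_trans (dot_le_norms _ _) _; rewrite mulrA ler_wpM2r //.
  by apply: le_trans (enorm_cross _ _) _; rewrite ler_wpM2r.
have i6 : dot (cross qd (cross ew q)) ew <= enorm ew * enorm ew.
  apply: le_trans (dot_le_norms _ _) _; rewrite ler_wpM2r //.
  apply: le_trans (enorm_cross _ _) _; rewrite qdn mul1r.
  by apply: le_trans (enorm_cross _ _) _; rewrite qn mulr1.
have i7 : dot (cross eta q) ew <= h * enorm ew.
  apply: le_trans (dot_le_norms _ _) _; rewrite ler_wpM2r //.
  by apply: le_trans (enorm_cross _ _) _; rewrite qn mulr1.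
split.
- apply: is_derive_add; apply: is_derive_scale; last exact: psi_derive.
  exact: is_derive_dot.
- exact: is_derive_dot.
- have z := dot_q_ew; move: (link_pert zeta) z i1 i3 => u.
  clearbody eq ew wd qd q; move=> z i1 i3.
  rewrite (dotC _ ew) !(dotDr, dotBr, dotNr, dotZr) (dotC ew q) z (dotC ew eq) enorm2.
  have i8 : k_q K * - dot (cross qd eta) eq <= k_q K * (h * enorm eq) by rewrite ler_wpM2l // ltW.
  have i9 : 0 <= k_q K * (h * enorm ew) by rewrite !mulr_ge0 // ltW.
  have i10 : 0 <= h * enorm eq by rewrite mulr_ge0.
  lra.
- have z := dot_q_eq; move: (link_pert zeta) z i2 i4 i5 i6 i7 => u.
  clearbody eq ew wd qd q; move=> z i2 i4 i5 i6 i7.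
  rewrite !(dotDr, dotBr, dotNr, dotZr) !dotDl (dotC eq q) z (enorm2 eq) expr2.
  have i8 : k_w K * - dot eq ew <= k_w K * (enorm eq * enorm ew) by rewrite ler_wpM2l // ltW.
  have i9 : enorm ew ^+ 2 = enorm ew * enorm ew by rewrite expr2.
  lra.
Qed.

End LinkErrors.

(** * Attitude errors, for the payload and the quadrotors alike *)

Section AttitudeErrors.
Variable R : realType.
Variables (Rd A : R -> 'M[R]_3) (Wd W : R -> 'cV[R]_3) (t : R).
Hypotheses (sRd : SO3 (Rd t)) (sA : SO3 (A t)).
Hypothesis hRd : is_derive t 1 Rd (Rd t *m hat (Wd t)).
Hypothesis hA : is_derive t 1 A (A t *m hat (W t)).

Let Q := (Rd t)^T *m A t.
Let eW := vel_err (Rd t) (A t) (Wd t) (W t).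

Let sQ : SO3 Q.
Proof. by apply: SO3_mul => //; exact: SO3_trmx. Qed.

Lemma rel_attitude_derive :
  is_derive t 1 (fun s => (Rd s)^T *m A s) (Q *m hat eW).
Proof.
apply: (is_derive_eq (is_derive_mulmx (is_derive_trmx hRd) hA)).
rewrite /eW vel_errE hatB mulmxBr -/Q (SO3_hat _ sQ).
by rewrite trmx_mul hat_tr mulNmx mulNmx addrC -!mulmxA.
Qed.

Lemma Psi_derive : is_derive t 1 (fun s => Psi ((Rd s)^T *m A s))
  (dot (att_err (Rd t) (A t)) eW).
Proof.
have h := is_derive_trace rel_attitude_derive.
have := is_derive_mul (is_derive_cst (2^-1 : R) t 1)
  (is_derive_sub (is_derive_cst (3 : R) t 1) h).
move=> /is_derive_eq; apply.
by rewrite att_errE /cst trace_mul_hat; field.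
Qed.

Lemma att_err_derive : exists2 v, enorm v <= 2 * enorm eW &
  is_derive t 1 (fun s => att_err (Rd s) (A s)) v.
Proof.
exists (2^-1 *: ((\tr Q) *: eW - Q^T *m eW)); first exact: rot_err_hat_le.
rewrite -rot_err_hat.
under eq_fun do rewrite att_errE.
apply: is_derive_scale; apply: is_derive_vee.
by apply: is_derive_sub; [|apply: is_derive_trmx]; exact: rel_attitude_derive.
Qed.

Lemma vel_err_derive (dWd dW : 'cV[R]_3) :
  is_derive t 1 Wd dWd -> is_derive t 1 W dW ->
  is_derive t 1 (fun s => vel_err (Rd s) (A s) (Wd s) (W s))
    (dW + (hat (W t) *m (A t)^T *m Rd t *m Wd t - (A t)^T *m Rd t *m dWd)).
Proof.
move=> hWd hW.
have h := is_derive_sub hW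
  (is_derive_mulmx (is_derive_mulmx (is_derive_trmx hA) hRd) hWd).
apply: (is_derive_eq h).
rewrite mulmxDl trmx_mul hat_tr !mulNmx.
rewrite -!mulmxA [hat (Wd t) *m Wd t]cross_self !mulmx0 addr0.
by rewrite opprD opprK.
Qed.

Variables (J : 'M[R]_3) (hJ : inertia J) (k1 k2 h Bg c : R) (G u : 'cV[R]_3).
Variables (dWd dW : 'cV[R]_3).
Hypothesis k20 : 0 < k2.
Hypotheses (hWd : is_derive t 1 Wd dWd) (hW : is_derive t 1 W dW).
Hypothesis dyn : J *m (dW + (hat (W t) *m (A t)^T *m Rd t *m Wd t - (A t)^T *m Rd t *m dWd))
  = - (k1 *: att_err (Rd t) (A t)) - k2 *: eW + G + u.
Hypotheses (GW : dot eW G = 0) (Gle : enorm G <= Bg * enorm eW) (ule : enorm u <= h).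
Hypothesis cJ : forall x : 'cV[R]_3, enorm (J *m x) <= c * enorm x.

(** [G] stands for gyroscopic terms: they do no work on [eW], so they leave the energy alone and
    enter the cross term through their size. [u] is a perturbation of size [h]. *)
Lemma attitude_estimate : exists D1 D2 : R,
  [/\ is_derive t 1 (fun s =>
        2^-1 * dot (vel_err (Rd s) (A s) (Wd s) (W s))
                   (J *m vel_err (Rd s) (A s) (Wd s) (W s))
        + k1 * Psi ((Rd s)^T *m A s)) D1,
      is_derive t 1 (fun s => dot (att_err (Rd s) (A s))
        (J *m vel_err (Rd s) (A s) (Wd s) (W s))) D2,
      D1 <= - k2 * enorm eW ^+ 2 + h * (enorm (att_err (Rd t) (A t)) + enorm eW) &
      D2 <= - k1 * enorm (att_err (Rd t) (A t)) ^+ 2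
            + (Bg + k2) * (enorm (att_err (Rd t) (A t)) * enorm eW)
            + 2 * c * enorm eW ^+ 2 + h * (enorm (att_err (Rd t) (A t)) + enorm eW)].
Proof.
have [v v2 hv] := att_err_derive.
have he := vel_err_derive hWd hW; have dynE := dyn.
set de := _ + _ in he dynE.
have hJe : is_derive t 1 (fun s => J *m vel_err (Rd s) (A s) (Wd s) (W s)) (J *m de).
  apply: (is_derive_eq (is_derive_mulmx (is_derive_cst J t 1) he)).
  by rewrite mul0mx add0r.
set eR := att_err (Rd t) (A t) in dynE *.
exists (2^-1 * (dot de (J *m eW) + dot eW (J *m de)) + k1 * dot eR eW).
exists (dot v (J *m eW) + dot eR (J *m de)).
have Jsym : dot de (J *m eW) = dot eW (J *m de).
  by rewrite dot_mulmx; case: hJ => -> _; rewrite dotC.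
have [a0 b0] := (enorm_ge0 eR, enorm_ge0 eW).
have i1 : dot eW u <= enorm eW * h.
  by apply: le_trans (dot_le_norms _ _) _; rewrite ler_wpM2l.
have i2 : dot eR u <= enorm eR * h.
  by apply: le_trans (dot_le_norms _ _) _; rewrite ler_wpM2l.
have h0 : 0 <= h by apply: le_trans ule; exact: enorm_ge0.
have i3 : - dot eR eW <= enorm eR * enorm eW.
  by rewrite -dotNl; apply: le_trans (dot_le_norms _ _) _; rewrite enormN.
have i4 : dot eR G <= enorm eR * (Bg * enorm eW).
  by apply: le_trans (dot_le_norms _ _) _; rewrite ler_wpM2l.
have i5 : dot v (J *m eW) <= 2 * enorm eW * (c * enorm eW).
  by apply: le_trans (dot_le_norms _ _) _; rewrite ler_pM ?enorm_ge0.
split.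
- apply: is_derive_add; apply: is_derive_scale; last exact: Psi_derive.
  exact: is_derive_dot.
- exact: is_derive_dot.
- move: dynE Jsym; clearbody eR eW de => dynE Jsym.
  rewrite Jsym dynE !(dotDr, dotBr, dotNr, dotZr) GW (dotC eW eR) enorm2.
  have i6 : 0 <= h * enorm eR by rewrite mulr_ge0.
  lra.
- move: dynE; clearbody eR eW de => dynE; rewrite dynE !(dotDr, dotBr, dotNr, dotZr) (enorm2 eR) expr2.
  have i8 : k2 * - dot eR eW <= k2 * (enorm eR * enorm eW) by rewrite ler_wpM2l // ltW.
  have i9 : 0 <= h * enorm eW by rewrite mulr_ge0.
  lra.
Qed.

End AttitudeErrors.

Section QuadrotorErrors.
Variables (R : realType) (n : nat) (P : plant R n) (K : gains R) (D : commands R n).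
Variables (S : R -> state R n) (eps a b t : R) (i : 'I_n).
Hypothesis hP : plant_ok P.
Hypothesis hK : gains_ok K.
Hypothesis e0 : 0 < eps.
Hypothesis tab : a < t < b.
Hypothesis hcl : closed_loop P K D S eps a b.

Lemma R_c_derive : is_derive t 1 (R_c P K D S i) (R_c P K D S i t *m hat (W_c P K D S i t)).
Proof.
have [hl _] := hcl tab; have [_ _ dR _] := hl i.
have h := derivable_is_derive1 dR.
apply: (is_derive_eq h); apply: (orthogonal_derive _ tab h) => s sab.
by have [hls _] := hcl sab; case: (hls i) => _ [].
Qed.

Lemma fast_estimate c : (forall x : 'cV[R]_3, enorm (inert P i *m x) <= c * enorm x) ->
  let eR s := e_R P K D S i s in let eW s := e_W P K D S i s in
  exists D1 D2 : R,
  [/\ is_derive t 1 (fun s => 2^-1 * dot (eW s) (inert P i *m eW s)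
        + k_R K / eps ^+ 2 * Psi ((R_c P K D S i s)^T *m qR (S s) i)) D1,
      is_derive t 1 (fun s => dot (eR s) (inert P i *m eW s)) D2,
      D1 <= - (k_W K / eps) * enorm (eW t) ^+ 2 &
      D2 <= - (k_R K / eps ^+ 2) * enorm (eR t) ^+ 2
            + k_W K / eps * (enorm (eR t) * enorm (eW t)) + 2 * c * enorm (eW t) ^+ 2].
Proof.
move=> hc eR eW.
have [hlaw [[hM hk hv] [_ _ _ hq]]] := hcl tab.
have [_ sRc _ dWc] := hlaw i.
have hJ : inertia (inert P i) by case: hP => _ _ _ /(_ i)[].
have [_ [_ _ kR kW]] := hK.
have sA : SO3 (qR (S t) i) by case: hM => _ /(_ i)[].
have hA : is_derive t 1 (fun s => qR (S s) i) (qR (S t) i *m hat (qW (S t) i)).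
  by case: hk => _ _ /(_ i)[].
have hWq : derivable (fun s => qW (S s) i) t 1 by case: hv => _ _ /(_ i)[].
(* Neither gyroscopic term nor perturbation is left: [M_law] compensates both the one of the
   quadrotor and the motion of [R_c]. *)
have := attitude_estimate sRc sA R_c_derive hA hJ (k1 := k_R K / eps ^+ 2)
  (k2 := k_W K / eps) (h := 0) (Bg := 0) (c := c) (G := 0) (u := 0)
  (Wd := W_c P K D S i) (W := fun s => qW (S s) i) _
  (derivable_is_derive1 dWc) (derivable_is_derive1 hWq).
case.
- by rewrite divr_gt0.
- rewrite !addr0 mulmxDr; have := hq i; rewrite /M_law => hd.
  rewrite (_ : inert P i *m derive1 _ t = - ((k_R K / eps ^+ 2) *: e_R P K D S i t)
    - (k_W K / eps) *: e_W P K D S i t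
    - inert P i *m (hat (qW (S t) i) *m ((qR (S t) i)^T *m R_c P K D S i t) *m W_c P K D S i t
       - ((qR (S t) i)^T *m R_c P K D S i t) *m derive1 (W_c P K D S i) t)).
    by rewrite !mulmxA subrK.
  move: hd; set x := cross _ _ => hd.
  by apply: (addIr x); rewrite hd addrAC.
- by rewrite dot0r.
- by rewrite enorm0 mul0r.
- by rewrite enorm0.
- exact: hc.
move=> D1 [D2 [d1 d2 l1 l2]]; exists D1, D2; split=> //.
- by move: l1; rewrite mul0r addr0.
- by move: l2; rewrite mul0r addr0 add0r.
Qed.

End QuadrotorErrors.

(** * Position and attitude errors of the payload *)

Section PayloadErrors.
Variables (R : realType) (n : nat) (P : plant R n) (K : gains R) (D : commands R n).
Hypotheses (hP : plant_ok P) (hK : gains_ok K) (hD : commands_smooth D).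
Variables (S : R -> state R n) (t : R).

Let p := pl (S t).
Let q := lq (S t).

Definition gap j : 'cV[R]_3 := mu P K D t p q j - mu_d P K D t p j.

Hypothesis hM : on_manifold S t.
Hypothesis hk : kinematics S t.
Hypothesis hv : velocities_derivable S t.

(** Projecting [mu_d] along the unit vector [q] loses [- q x (q x mu_d)], and
    [q x mu_d = |mu_d| e_q] because [q_d] is opposite to [mu_d]. *)
Lemma gap_le j : mu_d P K D t p j != 0 ->
  enorm (gap j) <= enorm (mu_d P K D t p j) * enorm (e_q P K D t p q j).
Proof.
move=> m0; have q1 : dot (q j) (q j) = 1 by apply: S2_dot; case: hM => _ /(_ j)[].
have -> : gap j = cross (q j) (cross (q j) (mu_d P K D t p j)).
  rewrite /gap /mu dyadE cross_cross q1 scale1r //.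
have -> : cross (q j) (mu_d P K D t p j) =
    enorm (mu_d P K D t p j) *: e_q P K D t p q j.
  rewrite /e_q /q_d; move/enorm_gt0/lt0r_neq0: m0.
  move: (mu_d _ _ _ _ _ _) => x x0.
  by apply: col3P; entries; field.
apply: le_trans (enorm_cross _ _) _.
by rewrite enormZ ger0_norm ?enorm_ge0 // {1}/enorm q1 sqrtr1 mul1r.
Qed.

(** If the forces were [mu_d] and the accelerations those of the simplified model, [Fd] would leave
    the linear equation [ev' = - k_x0 ex - k_v0 ev]; [h] bounds the two departures from it. *)
Lemma translation_estimate h :
  (m0 P)^-1 * \sum_j enorm (gap j) + enorm (acc_err P K D S t) <= h ->
  let ex s := e_x0 D s (pl (S s)) in let ev s := e_v0 D s (pl (S s)) in
  exists D1 D2 : R,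
  [/\ is_derive t 1 (fun s => 2^-1 * dot (ev s) (ev s)
        + k_x0 K * (2^-1 * dot (ex s) (ex s))) D1,
      is_derive t 1 (fun s => dot (ex s) (ev s)) D2,
      D1 <= - k_v0 K * enorm (ev t) ^+ 2 + h * (enorm (ex t) + enorm (ev t)) &
      D2 <= - k_x0 K * enorm (ex t) ^+ 2 + k_v0 K * (enorm (ex t) * enorm (ev t))
            + enorm (ev t) ^+ 2 + h * (enorm (ex t) + enorm (ev t))].
Proof.
move=> hh ex ev.
pose u := (m0 P)^-1 *: (\sum_j gap j) + acc_err P K D S t.
have ule : enorm u <= h.
  have m0P : 0 < m0 P by case: hP.
  apply: le_trans hh; apply: le_trans (enormD _ _) _; rewrite lerD2r enormZ.
  by rewrite gtr0_norm ?invr_gt0 // ler_pM2l ?invr_gt0 // enorm_sum.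
have dex : is_derive t 1 ex (ev t).
  by apply: is_derive_sub; [case: hk|exact: is_derive_x0d].
have dev : is_derive t 1 ev (- (k_x0 K *: ex t) - k_v0 K *: ev t + u).
  have [dv _ _] := hv.
  have h1 := is_derive_sub (derivable_is_derive1 dv) (is_derive_v0d hD 0 t).
  apply: (is_derive_eq h1).
  have [sR _] := hM; have [sF _] := mu_d_force K D hP t sR.
  rewrite /u /acc_err /gap sumrB sF /Fd /acc_s -/p -/q -/(ex t) -/(ev t).
  have m0P : m0 P != 0 by case: hP => _ /lt0r_neq0 ? _ _ _.
  rewrite derive1n1.
  move: (derive1 _ _) (_ *: e3) (\sum_j _) (ex t) (ev t) (derive1 _ _) => x1 x2 x3 x4 x5 x6.
  rewrite scalerBr scalerA mulVf // scale1r.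
  by apply: col3P; rewrite !mxE; ring.
have [kx kv] : 0 < k_x0 K /\ 0 < k_v0 K by case: hK => -[].
exists (2^-1 * (dot (- (k_x0 K *: ex t) - k_v0 K *: ev t + u) (ev t)
                + dot (ev t) (- (k_x0 K *: ex t) - k_v0 K *: ev t + u))
        + k_x0 K * (2^-1 * (dot (ev t) (ex t) + dot (ex t) (ev t)))).
exists (dot (ev t) (ev t) + dot (ex t) (- (k_x0 K *: ex t) - k_v0 K *: ev t + u)).
have dee := is_derive_dot dev dev; have dxx := is_derive_dot dex dex.
have dxe := is_derive_dot dex dev.
split=> //.
- by apply: is_derive_add; do ?apply: is_derive_scale.
- clear dex dev dee dxx dxe; move: (ex t) (ev t) u ule => x v u ule.
  have := dot_le_norms v u; have := ler_wpM2l (enorm_ge0 v) ule.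
  have : 0 <= h * enorm x.
    by rewrite mulr_ge0 ?enorm_ge0 // (le_trans _ ule) // enorm_ge0.
  rewrite (dotC _ v) !(dotDr, dotBr, dotNr, dotZr) (dotC v x) enorm2; lra.
- clear dex dev dee dxx dxe; move: (ex t) (ev t) u ule => x v u ule.
  have := dot_le_norms x u; have := ler_wpM2l (enorm_ge0 x) ule.
  have : 0 <= h * enorm v.
    by rewrite mulr_ge0 ?enorm_ge0 // (le_trans _ ule) // enorm_ge0.
  have : k_v0 K * - dot x v <= k_v0 K * (enorm x * enorm v).
    by rewrite ler_pM2l // -dotNr; apply: le_trans (dot_le_norms _ _) _; rewrite enormN.
  rewrite !(dotDr, dotBr, dotNr, dotZr) !enorm2; lra.
Qed.

Lemma payload_attitude_estimate h c cr B E :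
  (forall x : 'cV[R]_3, enorm (J0 P *m x) <= c * enorm x) ->
  (forall j (x : 'cV[R]_3), enorm (hat (rho P j) *m x) <= cr * enorm x) ->
  cr * (\sum_j enorm (gap j)) + c * enorm (ang_err P K D S t) <= h ->
  enorm (W0d D t) <= B -> 0 <= B -> 0 <= c ->
  let eR s := e_R0 D s (pl (S s)) in let eW s := e_W0 D s (pl (S s)) in
  enorm (eW t) <= E ->
  exists D1 D2 : R,
  [/\ is_derive t 1 (fun s => 2^-1 * dot (eW s) (J0 P *m eW s)
        + k_R0 K * Psi ((R0d D s)^T *m pR (pl (S s)))) D1,
      is_derive t 1 (fun s => dot (eR s) (J0 P *m eW s)) D2,
      D1 <= - k_W0 K * enorm (eW t) ^+ 2 + h * (enorm (eR t) + enorm (eW t)) &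
      D2 <= - k_R0 K * enorm (eR t) ^+ 2
            + (c * (E + 3 * B) + k_W0 K) * (enorm (eR t) * enorm (eW t))
            + 2 * c * enorm (eW t) ^+ 2 + h * (enorm (eR t) + enorm (eW t))].
Proof.
move=> hc hcr hh WdB B0 c0 eR eW eW1.
(* [beta] is the desired angular velocity seen in the payload frame, so that the payload velocity is
   [eW + beta]. *)
pose J := J0 P; pose beta := (pR p)^T *m R0d D t *m W0d D t.
pose G := hat beta *m (J *m beta) - hat (pW p) *m (J *m pW p) + J *m (hat (pW p) *m beta).
pose u := \sum_j hat (rho P j) *m ((pR p)^T *m gap j) + J *m ang_err P K D S t.
have hcJ : forall x : 'cV[R]_3, enorm (J *m x) <= c * enorm x by [].
have sR : SO3 (pR p) by case: hM.
have sRd : SO3 (R0d D t) by case: hD => _ /(_ t)[].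
have hJ : inertia J by case: hP.
have Jsym x y : dot x (J *m y) = dot (J *m x) y by rewrite dot_mulmx; case: hJ => ->.
have eWE : eW t = pW p - beta by rewrite /eW /e_W0 /vel_err.
have bB : enorm beta <= B.
  rewrite /beta -mulmxA orthogonal_enorm ?orthogonal_enorm //; first by case: sRd.
  by rewrite trmxK; exact: SO3_tr.
(* The terms in [beta] alone cancel, so [G] vanishes with [eW]. It is quadratic in [eW], whence the
   a priori bound [E] in its linear estimate. *)
have GE : G = - cross (eW t) (J *m eW t) - cross (eW t) (J *m beta)
    - cross beta (J *m eW t) + J *m cross (eW t) beta.
  have -> : G = cross beta (J *m beta) - cross (eW t + beta) (J *m (eW t + beta))
      + J *m cross (eW t + beta) beta by rewrite eWE subrK.
  move: (eW t) => e; clearbody J beta.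
  have crossDl (x y z : 'cV[R]_3) : cross (x + y) z = cross x z + cross y z by vec3.
  rewrite mulmxDr !crossDl !crossDr mulmxDr [cross beta beta]cross_self mulmx0 addr0.
  move: (cross beta (J *m beta)) (cross e (J *m e)) (cross e (J *m beta))
    (cross beta (J *m e)) (J *m cross e beta) => x1 x2 x3 x4 x5.
  by apply: col3P; rewrite !mxE; ring.
(* Two terms are normal to [eW]; the other two cancel by symmetry of [J] and the cyclic invariance
   of the triple product. *)
have GW : dot (eW t) G = 0.
  rewrite GE; move: (eW t) => e; clearbody J beta.
  rewrite !(dotDr, dotNr) !dot_cross Jsym.
  by move: (J *m e) => y; dot3.
have Gle : enorm G <= c * (E + 3 * B) * enorm (eW t).
  rewrite GE; move: (eW t) eW1 (enorm_ge0 (eW t)) => e e1 e0; clearbody J beta.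
  have h1 : enorm (cross e (J *m e)) <= c * E * enorm e.
    apply: le_trans (enorm_cross _ _) _; rewrite mulrAC mulrC.
    by rewrite ler_pM ?enorm_ge0.
  have h2 : enorm (cross e (J *m beta)) <= c * B * enorm e.
    apply: le_trans (enorm_cross _ _) _; rewrite mulrC ler_wpM2r //.
    by apply: le_trans (hcJ _) _; rewrite ler_wpM2l.
  have h3 : enorm (cross beta (J *m e)) <= c * B * enorm e.
    apply: le_trans (enorm_cross _ _) _; rewrite (mulrC c) -mulrA.
    by rewrite ler_pM ?enorm_ge0.
  have h4 : enorm (J *m cross e beta) <= c * B * enorm e.
    apply: le_trans (hcJ _) _; rewrite -mulrA ler_wpM2l // mulrC.
    by apply: le_trans (enorm_cross _ _) _; rewrite ler_wpM2l.
  do ![apply: le_trans (enormD _ _) _; rewrite ?enormN].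
  have := enormB (- cross e (J *m e)) (cross e (J *m beta)).
  have := enormB (- cross e (J *m e) - cross e (J *m beta)) (cross beta (J *m e)).
  rewrite enormN; lra.
have ule : enorm u <= h.
  apply: le_trans hh; apply: le_trans (enormD _ _) _; apply: lerD; last exact: hc.
  apply: le_trans (enorm_sum _) _; rewrite mulr_sumr; apply: ler_sum => j _.
  apply: le_trans (hcr _ _) _.
  by rewrite (orthogonal_enorm (A := (pR p)^T)) // trmxK; exact: SO3_tr.
have [_ hR _] := hk.
have [_ dW _] := hv.
have [_ _ _ kW] : [/\ 0 < k_x0 K, 0 < k_v0 K, 0 < k_R0 K & 0 < k_W0 K] by case: hK.
have dWd := is_derive_W0d hD 0 t.
have := attitude_estimate (Rd := R0d D) (A := fun s => pR (pl (S s))) sRd sR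
  (is_derive_R0d hD t) hR hJ (k1 := k_R0 K)
  (k2 := k_W0 K) (h := h) (Bg := c * (E + 3 * B)) (c := c) (G := G) (u := u)
  (Wd := W0d D) (W := fun s => pW (pl (S s))) kW dWd (derivable_is_derive1 dW) _
  GW Gle ule hc.
apply.
have [_ sM] := mu_d_force K D hP t sR.
have dyn : J *m derive1 (fun s => pW (pl (S s))) t =
    Md P K D t p + u - hat (pW p) *m (J *m pW p).
  have uJ : J \in unitmx by exact: inertia_unit.
  have -> : derive1 (fun s => pW (pl (S s))) t = dW0_s P K D t p q + ang_err P K D S t.
    by rewrite /ang_err addrC subrK.
  rewrite mulmxDr /dW0_s mulKVmx // -sM /u -/p -/q.
  under [in RHS]eq_bigr do idtac.
  rewrite /gap; under [X in _ = _ + (X + _) - _]eq_bigr do rewrite !mulmxBr.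
  rewrite sumrB -!mulmxA.
  under [X in X - _ + _ = _]eq_bigr do rewrite -mulmxA.
  move: (\sum_j _) (\sum_j _) (J *m ang_err _ _ _ _ _) (hat _ *m _) => x1 x2 x3 x4.
  by apply: col3P; rewrite !mxE; ring.
rewrite mulmxDr dyn /Md -/p -/(eR t) -/(eW t).
have bE : (pR p)^T *m (R0d D t *m W0d D t) = beta by rewrite mulmxA.
rewrite derive1n1 -!mulmxA !bE -/J -/(att_err _ _) /G.
rewrite mulmxBr -/(e_R0 _ _ _) -/(e_W0 _ _ _) -/(eR t) -/(eW t).
clear ule; clearbody u; move: (eR t) (eW t) (J *m (_ *m (_ *m derive1 _ _))) => x1 x2 x4.
move: (hat beta *m _) (hat (pW p) *m (J *m _)) (J *m (hat _ *m _)) => x5 x6 x7.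
by apply: col3P; rewrite !mxE; ring.
Qed.

End PayloadErrors.

(** * Lyapunov arguments *)

Section Lyapunov.
Variable R : realType.

Lemma derivable_cvg (f : R -> R) x : derivable f x 1 -> {for x, continuous f}.
Proof. by move=> /derivable1_diffP/differentiable_continuous. Qed.

Lemma derive_le0_nonincreasing (f : R -> R) a b : a <= b ->
  (forall x, a <= x <= b -> derivable f x 1) ->
  (forall x, a < x < b -> derive1 f x <= 0) -> f b <= f a.
Proof.
rewrite le_eqVlt => /orP[/eqP -> //|ab] df f0.
have [x xab fx] : exists2 x, x \in `]a, b[ & f b - f a = derive1 f x * (b - a).
  apply: MVT => // [x|].
    rewrite in_itv /= => /andP[ax xb]; apply: derivable_is_derive1.
    by apply: df; rewrite !ltW.
  apply: continuous_in_subspaceT => x; rewrite inE /= in_itv /= => xab.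
  exact/derivable_cvg/df.
rewrite -subr_le0 fx; rewrite in_itv /= in xab.
by rewrite mulr_le0_ge0 ?f0 // subr_ge0 ltW.
Qed.

(** Up to the first time [x] at which [V] reaches [c], [V] does not increase, so [V x <= V t0 < c],
    a contradiction. *)
Lemma lyapunov_barrier (V : R -> R) t0 b l c :
  (forall t, t0 <= t < b -> derivable V t 1) ->
  (forall t, t0 <= t < b -> 0 <= V t) -> V t0 < c -> 0 <= l ->
  (forall t, t0 <= t < b -> V t < c -> derive1 V t <= - l * V t) ->
  forall t, t0 <= t < b -> V t < c.
Proof.
move=> dV V0 Vt0 l0 hV t1 /andP[t01 t1b].
rewrite ltNge; apply/negP => Vt1.
pose E := [set t | t0 <= t <= t1 /\ c <= V t]%classic.
have Et1 : E t1 by split=> //; rewrite t01 lexx.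
have lbE : has_lbound E by exists t0 => x [/andP[]].
have infE : has_inf E by split=> //; exists t1.
set x := inf E.
have t0x : t0 <= x by apply: lb_le_inf; [exists t1|move=> y [/andP[]]].
have xt1 : x <= t1 by exact: ge_inf.
have below s : t0 <= s < x -> V s < c.
  move=> /andP[t0s sx]; rewrite ltNge; apply/negP => Vs.
  have : E s by split=> //; rewrite t0s (le_trans (ltW sx)).
  by move=> /(ge_inf lbE); rewrite leNgt sx.
have Vx : c <= V x.
  rewrite leNgt; apply/negP => Vx.
  have dx : derivable V x 1 by apply: dV; rewrite t0x (le_lt_trans xt1).
  have /nbhs_ballP[e /= e0 he] : \forall s \near x, V s < c.
    exact: (@cvgr_lt _ _ _ _ _ _ (derivable_cvg dx) _ Vx).
  have [s Es sx] := inf_adherent e0 infE.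
  have xs : x <= s by exact: ge_inf.
  have : V s < c by apply: he; rewrite /ball /= distrC ger0_norm ?subr_ge0 // ltrBlDl.
  by case: Es => _; rewrite leNgt => /negP.
have : V x <= V t0.
  apply: (derive_le0_nonincreasing t0x) => y /andP[y0 yx].
    by apply: dV; rewrite y0 (le_lt_trans yx) // (le_lt_trans xt1).
  have yb : t0 <= y < b by rewrite (ltW y0) (lt_trans yx) // (le_lt_trans xt1).
  apply: le_trans (hV y yb _) _; first by rewrite below // (ltW y0).
  by rewrite mulNr oppr_le0 mulr_ge0 ?V0.
by move=> h; have := le_lt_trans (le_trans Vx h) Vt0; rewrite ltxx.
Qed.

(** The barrier makes the differential inequality available on the whole interval, where
    [exp (l (t - t0)) V] is then nonincreasing. *)
Lemma lyapunov_decay (V : R -> R) t0 b l c :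
  (forall t, t0 <= t < b -> derivable V t 1) ->
  (forall t, t0 <= t < b -> 0 <= V t) -> V t0 < c -> 0 <= l ->
  (forall t, t0 <= t < b -> V t < c -> derive1 V t <= - l * V t) ->
  forall t, t0 <= t < b -> V t <= expR (- (l * (t - t0))) * V t0.
Proof.
move=> dV V0 Vt0 l0 hV t tb.
have below := lyapunov_barrier dV V0 Vt0 l0 hV.
pose W s := expR (l * (s - t0)) * V s.
have dW s : t0 <= s < b ->
    is_derive s 1 W (expR (l * (s - t0)) * (l * V s + derive1 V s)).
  move=> sb.
  have h1 : is_derive s 1 (fun u => l * (u - t0)) l.
    have h := is_derive_scale l (is_derive_sub (is_derive_id s (1 : R)) (is_derive_cst t0 s 1)).
    by apply: (is_derive_eq h); rewrite subr0 /GRing.scale /= mulr1.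
  have h2 := @is_derive1_comp _ expR (fun u => l * (u - t0)) _ _ _
    (is_derive_expR (l * (s - t0))) h1.
  have h3 := is_derive_mul h2 (derivable_is_derive1 (dV s sb)).
  by apply: (is_derive_eq h3) => /=; ring.
have : W t <= W t0.
  have /andP[t0t ttb] := tb.
  apply: (derive_le0_nonincreasing t0t) => y /andP[y0 yx].
    by have [] := dW y; rewrite ?y0 ?(le_lt_trans yx).
  have yb : t0 <= y < b by rewrite (ltW y0) (lt_trans yx).
  rewrite (is_derive_derive1 (dW y yb)) mulr_ge0_le0 ?expR_ge0 //.
  by have := hV y yb (below y yb); rewrite mulNr; lra.
rewrite /W subrr mulr0 expR0 mul1r => h.
by rewrite expRN mulrC ler_pdivlMr ?expR_gt0 // mulrC.
Qed.

(** The common pattern of all stages: [a] and [b] are the norms of the configuration and velocity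
    errors, [U] and [T] the potential and kinetic energies, [X] the cross term and [h] the
    perturbation. The upper bound needs [U <= a ^+ 2], which holds only near the desired
    configuration, whereas the other two bounds do not ask for it. *)
Lemma lyapunov_weights (k kap lam Lam B : R) :
  0 < k -> 0 < kap -> 0 < lam -> 0 < Lam -> 0 < B ->
  exists c alpha b1 b2 M : R,
  [/\ 0 < c, 0 < alpha, 0 < b1, 0 < b2 & 0 < M] /\
  forall a b U T X : R, 0 <= a -> 0 <= b -> 0 <= U -> a ^+ 2 <= 2 * U ->
    lam * b ^+ 2 <= T -> T <= Lam * b ^+ 2 -> `|X| <= Lam * (a * b) ->
    [/\ b1 * (U + b ^+ 2) <= T + k * U + c * X,
        U <= a ^+ 2 -> T + k * U + c * X <= b2 * (a ^+ 2 + b ^+ 2) &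
        forall D1 D2 h : R, 0 <= h ->
          D1 <= - kap * b ^+ 2 + B * h * (a + b) ->
          D2 <= - k * a ^+ 2 + B * (a * b) + B * b ^+ 2 + B * h * (a + b) ->
          D1 + c * D2 <= - alpha * (a ^+ 2 + b ^+ 2) + M * h ^+ 2].
Proof.
move=> k0 kap0 lam0 Lam0 B0.
(* The weight [c] must be small for two reasons: [c x <= 1] keeps the quadratic form positive, and
   [c y <= 1] lets the damping [kap] absorb the velocity terms of [D2]. The choice below gives both,
   and [c <= 1]. *)
pose x := 2 * Lam ^+ 2 / (k * lam).
pose y := 4 * (B ^+ 2 / k + B) / kap.
have x0 : 0 < x by rewrite divr_gt0 ?mulr_gt0 ?exprn_gt0.
have y0 : 0 < y by rewrite divr_gt0 ?mulr_gt0 ?addr_gt0 ?divr_gt0 ?exprn_gt0.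
pose c := (1 + x + y)^-1.
have s0 : 0 < 1 + x + y by rewrite !addr_gt0.
have c0 : 0 < c by rewrite invr_gt0.
have cs : c * (1 + x + y) = 1 by rewrite mulVf ?gt_eqF.
have c1 : c <= 1 by nra.
have cx : c * x <= 1 by nra.
have cy : c * y <= 1 by nra.
have c2 : c * Lam ^+ 2 / lam <= k / 2.
  rewrite ler_pdivrMr // ; move: cx; rewrite /x mulrA ler_pdivrMr ?mulr_gt0 //; lra.
have c3 : c * (B ^+ 2 / k + B) <= kap / 4.
  by move: cy; rewrite /y mulrA ler_pdivrMr //; lra.
exists c, (Num.min (c * k / 2) (kap / 2)), (Num.min (k / 2) (lam / 2)).
(* The last constant comes from splitting [B h a] and [B h b] by completing squares, each at the
   cost of a quarter of the available decay. *)
exists (Lam + k + Lam), (4 * B ^+ 2 / (c * k) + 4 * B ^+ 2 / kap).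
split.
  split=> //; rewrite ?lt_min ?addr_gt0 ?divr_gt0 ?mulr_gt0 ?exprn_gt0 //.
move=> a b U T X a0 b0 U0 aU lT TL XL.
have [X1 X2] : - (Lam * (a * b)) <= X /\ X <= Lam * (a * b).
  by move: XL; rewrite ler_norml => /andP[].
split.
- have h1 : Num.min (k / 2) (lam / 2) <= k / 2 by rewrite ge_min lexx.
  have h2 : Num.min (k / 2) (lam / 2) <= lam / 2 by rewrite ge_min lexx orbT.
  have h3 : c * Lam * (a * b) <= lam / 2 * b ^+ 2 + c * Lam ^+ 2 / lam * U.
    have e1 : 0 <= lam / 2 * (b - c * Lam / lam * a) ^+ 2.
      by rewrite mulr_ge0 ?sqr_ge0 // divr_ge0 // ltW.
    have e2 : lam / 2 * (b - c * Lam / lam * a) ^+ 2 =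
        lam / 2 * b ^+ 2 - c * Lam * (a * b) + c * (c * Lam ^+ 2 / lam) * (a ^+ 2 / 2).
      by field; rewrite gt_eqF.
    have e3 : c * (c * Lam ^+ 2 / lam) * (a ^+ 2 / 2) <= 1 * (c * Lam ^+ 2 / lam) * U.
      have z0 : 0 <= c * Lam ^+ 2 / lam by rewrite divr_ge0 ?mulr_ge0 ?exprn_ge0 // ltW.
      apply: ler_pM.
      - by rewrite mulr_ge0 // ltW.
      - by rewrite divr_ge0 ?sqr_ge0.
      - by rewrite ler_wpM2r.
      - by rewrite ler_pdivrMr // mulrC.
    lra.
  have h4 : c * Lam ^+ 2 / lam * U <= k / 2 * U by rewrite ler_wpM2r.
  have h5 : c * - (Lam * (a * b)) <= c * X by rewrite ler_pM2l.
  have h6 := ler_wpM2r U0 h1; have h7 := ler_wpM2r (sqr_ge0 b) h2.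
  lra.
- move=> Ua.
  have h1 : c * X <= 1 * (Lam * (a * b)).
    apply: le_trans (_ : c * (Lam * (a * b)) <= _); first by rewrite ler_pM2l.
    by rewrite ler_wpM2r // !mulr_ge0 // ltW.
  have h2 : Lam * (a * b) <= Lam * ((a ^+ 2 + b ^+ 2) / 2).
    by rewrite ler_pM2l //; have := sqr_ge0 (a - b); lra.
  have h3 : k * U <= k * a ^+ 2 by rewrite ler_pM2l.
  have h4 : 0 <= Lam * a ^+ 2 by rewrite mulr_ge0 ?sqr_ge0 // ltW.
  have h5 : 0 <= Lam * b ^+ 2 by rewrite mulr_ge0 ?sqr_ge0 // ltW.
  have h6 : 0 <= k * b ^+ 2 by rewrite mulr_ge0 ?sqr_ge0 // ltW.
  lra.
- move=> D1 D2 h h0 hD1 hD2.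
  have g1 : Num.min (c * k / 2) (kap / 2) <= c * k / 2 by rewrite ge_min lexx.
  have g2 : Num.min (c * k / 2) (kap / 2) <= kap / 2 by rewrite ge_min lexx orbT.
  have g3 := ler_wpM2r (sqr_ge0 a) g1; have g4 := ler_wpM2r (sqr_ge0 b) g2.
  have ck0 : 0 < c * k by rewrite mulr_gt0.
  have e1 : c * B * (a * b) <= c * k / 4 * a ^+ 2 + c * (B ^+ 2 / k) * b ^+ 2.
    have : 0 <= c * k / 4 * (a - 2 * B / k * b) ^+ 2.
      by rewrite mulr_ge0 ?sqr_ge0 // divr_ge0 // ltW.
    have -> : c * k / 4 * (a - 2 * B / k * b) ^+ 2 =
        c * k / 4 * a ^+ 2 - c * B * (a * b) + c * (B ^+ 2 / k) * b ^+ 2.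
      by field; rewrite gt_eqF.
    lra.
  have e2 : 2 * B * h * a <= c * k / 4 * a ^+ 2 + 4 * B ^+ 2 / (c * k) * h ^+ 2.
    have : 0 <= c * k / 4 * (a - 4 * B / (c * k) * h) ^+ 2.
      by rewrite mulr_ge0 ?sqr_ge0 // divr_ge0 // ltW.
    have -> : c * k / 4 * (a - 4 * B / (c * k) * h) ^+ 2 =
        c * k / 4 * a ^+ 2 - 2 * B * h * a + 4 * B ^+ 2 / (c * k) * h ^+ 2.
      by field; rewrite !gt_eqF.
    lra.
  have e3 : 2 * B * h * b <= kap / 4 * b ^+ 2 + 4 * B ^+ 2 / kap * h ^+ 2.
    have : 0 <= kap / 4 * (b - 4 * B / kap * h) ^+ 2.
      by rewrite mulr_ge0 ?sqr_ge0 // divr_ge0 // ltW.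
    have -> : kap / 4 * (b - 4 * B / kap * h) ^+ 2 =
        kap / 4 * b ^+ 2 - 2 * B * h * b + 4 * B ^+ 2 / kap * h ^+ 2.
      by field; rewrite gt_eqF.
    lra.
  have e4 : c * D2 <= c * (- k * a ^+ 2 + B * (a * b) + B * b ^+ 2 + B * h * (a + b)).
    by rewrite ler_pM2l.
  have e5 : c * (B * h * (a + b)) <= B * h * (a + b).
    by rewrite ler_piMl // !mulr_ge0 ?addr_ge0 // ltW.
  have e6 : c * (B ^+ 2 / k + B) * b ^+ 2 <= kap / 4 * b ^+ 2 by rewrite ler_wpM2r ?sqr_ge0.
  lra.
Qed.

Lemma sqr_sum_le n (x : 'I_n -> R) : (\sum_i x i) ^+ 2 <= n%:R * \sum_i x i ^+ 2.
Proof.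
have e : (\sum_i x i) ^+ 2 = \sum_i \sum_j x i * x j.
  by rewrite expr2 mulr_suml; apply: eq_bigr => i _; rewrite mulr_sumr.
have : \sum_i \sum_j x i * x j <= \sum_i \sum_j (x i ^+ 2 + x j ^+ 2) / 2.
  apply: ler_sum => i _; apply: ler_sum => j _.
  by have := sqr_ge0 (x i - x j); lra.
rewrite -e => /le_trans; apply.
have -> : \sum_i \sum_j (x i ^+ 2 + x j ^+ 2) / 2 =
    \sum_i (n%:R * x i ^+ 2 + \sum_j x j ^+ 2) / 2.
  apply: eq_bigr => i _; rewrite -mulr_suml big_split /= sumr_const card_ord.
  by rewrite mulr_natl.
rewrite -mulr_suml big_split /= sumr_const card_ord -mulr_sumr mulr_natl.
lra.
Qed.

End Lyapunov.

(** * Uniform bounds near the desired motion *)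

Section Region.
Variables (R : realType) (n : nat) (P : plant R n) (K : gains R) (D : commands R n).
Hypotheses (hP : plant_ok P) (hK : gains_ok K) (hD : commands_smooth D).
Hypotheses (hB : commands_bounded D) (hT : desired_motion_regular P K D).
Notation config := (var n -> R).
Notation cfg := (cfg D).
Notation level := (@level n).
Implicit Types (t : R) (p : payload R) (q w : 'I_n -> 'cV[R]_3).

Lemma commands_bound : exists2 B : R, 0 <= B & forall t (l : nat), 0 <= t -> (l <= 3)%N ->
  enorm (derive1n l (v0d D) t) <= B /\ enorm (derive1n l (W0d D) t) <= B.
Proof.
have [B1 h1] := hB; have [_ [B2 h2]] := hT.
have [p1 p2] : B1 <= `|B1| /\ B2 <= `|B2| by split; exact: ler_norm.
have [n1 n2] := (normr_ge0 B1, normr_ge0 B2).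
exists (`|B1| + `|B2|) => [|t l t0 l3]; first exact: addr_ge0.
have w1 x : x <= B1 -> x <= `|B1| + `|B2| by lra.
have w2 x : x <= B2 -> x <= `|B1| + `|B2| by lra.
have [a1 a2 a3 a4] := h1 t t0.
case: l l3 => [|[|l]] l3.
- by split; [exact: w1 _ a1|exact: w1 _ a3].
- by split; [exact: w1 _ a2|exact: w1 _ a4].
- by have [b1 b2] := h2 l.+2 t l3 t0; split; [exact: w2 _ b1|exact: w2 _ b2].
Qed.

(** [Psi] is quadratic in the distance of the attitudes, whence [r ^+ 2]: every error is then of
    order [r]. *)
Definition near_desired r t p : Prop :=
  [/\ SO3 (pR p), enorm (e_x0 D t p) <= r, enorm (e_v0 D t p) <= r,
      enorm (e_W0 D t p) <= r & Psi ((R0d D t)^T *m pR p) <= r ^+ 2].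

(** The entries of [R0d - pR] are at most [2 r] by [Psi_entry]; three summands and the factor 3 of
    [enorm_le_entries] make 18. *)
Lemma rel_W0d r t p B : near_desired r t p -> 0 <= r -> enorm (W0d D t) <= B -> 0 <= B ->
  enorm ((pR p)^T *m R0d D t *m W0d D t - W0d D t) <= 18 * B * r.
Proof.
move=> [sR _ _ _ hpsi] r0 WB B0.
have sRd : SO3 (R0d D t) by case: hD => _ /(_ t)[].
have -> : (pR p)^T *m R0d D t *m W0d D t - W0d D t =
    (pR p)^T *m ((R0d D t - pR p) *m W0d D t).
  by rewrite mulmxBl mulmxBr !mulmxA; case: sR => -> _; rewrite mul1mx.
rewrite orthogonal_enorm; last by rewrite trmxK; exact: SO3_tr.
have e i j : `|(R0d D t - pR p) i j| <= 2 * r.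
  rewrite !mxE -(ler_pXn2r (n := 2)) ?nnegrE ?mulr_ge0 // real_normK ?num_real //.
  apply: le_trans (Psi_entry i j sRd sR) _; rewrite exprMn; lra.
apply: le_trans (@enorm_le_entries _ _ (6 * r * B) _) _; last lra.
move=> i; rewrite mul3E.
apply: le_trans (ler_normD _ _) _.
apply: le_trans (lerD (ler_normD _ _) (lexx _)) _.
have f j : `|(R0d D t - pR p) i j * W0d D t j 0| <= 2 * r * B.
  by rewrite normrM ler_pM // (le_trans (entry_le_enorm _ _)).
by have := f 0; have := f 1; have := f 2%:R; lra.
Qed.

Lemma cfg_bounded B r t p q w : (forall l, (l <= 3)%N ->
    enorm (derive1n l (v0d D) t) <= B /\ enorm (derive1n l (W0d D) t) <= B) ->
  0 <= B -> r <= 1 -> near_desired r t p -> (forall i, S2 (q i)) ->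
  bounded_on (level 1) (B + 1) (cfg t p q w).
Proof.
move=> hb B0 r1 [sR hx hv hW hpsi] hq.
have sRd : SO3 (R0d D t) by case: hD => _ /(_ t)[].
have W0B : enorm (W0d D t) <= B by have [_] := hb 0%N isT.
have le1 (x : 'cV[R]_3) i : enorm x <= r -> `|x i 0| <= B + 1.
  by move=> h; apply: le_trans (entry_le_enorm _ _) _; lra.
have leB (x : 'cV[R]_3) i : enorm x <= B -> `|x i 0| <= B + 1.
  by move=> h; apply: le_trans (entry_le_enorm _ _) _; lra.
case=> [k|k|l k|k l|k l|k|l k|j k|j k] //= hl.
- exact: le1.
- exact: le1.
- have l3 : (l.+1 <= 3)%N by rewrite ltnS (leq_trans hl).
  by have [h _] := hb l.+1 l3; exact: leB h.
- by apply: le_trans (SO3_entry k l sR) _; lra.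
- by apply: le_trans (SO3_entry k l sRd) _; lra.
- have -> : pW p = e_W0 D t p + (pR p)^T *m R0d D t *m W0d D t by rewrite subrK.
  apply: le_trans (entry_le_enorm _ _) _; apply: le_trans (enormD _ _) _.
  rewrite addrC lerD ?(le_trans hW) // -mulmxA.
  rewrite orthogonal_enorm ?orthogonal_enorm //; first by case: sRd.
  by rewrite trmxK; exact: SO3_tr.
- have l3 : (l <= 3)%N by rewrite (leq_trans hl).
  by have [_ h] := hb l l3; exact: leB h.
- by apply: le_trans (entry_le_enorm _ _) _; rewrite hq; lra.
Qed.

Lemma near_desired_payload_d t : near_desired 0 t (payload_d D t).
Proof.
have sRd : SO3 (R0d D t) by case: hD => _ /(_ t)[].
rewrite /near_desired /e_x0 /e_v0 /e_W0 /vel_err /=.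
case: (sRd) => -> _; rewrite mul1mx !subrr enorm0 expr0n lexx.
by split=> //; rewrite /Psi mxtrace1 subrr mulr0.
Qed.

(** [mu_d] is Lipschitz on bounded sets of level 0 coordinates, so the lower bound [c] on the
    desired motion loses at most half when [r] is small. *)
Lemma mu_d_lower : exists r k : R, [/\ 0 < r, r <= 1, 0 < k &
  forall t p q w i, 0 <= t -> near_desired r t p -> (forall i, S2 (q i)) ->
    dom P K k i (cfg t p q w)].
Proof.
have sq8 (x : R) : 0 < x -> x ^+ 2 / 8 < (x / 2) ^+ 2.
  by move=> /(exprn_gt0 2); rewrite expr_div_n; move: (x ^+ 2) => y; lra.
have [B B0 hb] := commands_bound.
have [[c c0 hc] _] := hT.
have [L L0 hL] : exists2 L : R, 0 <= L & forall i z z' h, setT z -> setT z' ->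
    bounded_on (level 0) (B + 1) z -> bounded_on (level 0) (B + 1) z' -> 0 <= h ->
    bounded_on (level 0) h (fun j => z j - z' j) ->
    enorm (mu_d_z P K i z - mu_d_z P K i z') <= L * h.
  apply: bound_uniform => [i M N MN h z z' a s s' b b' a0 hy|i].
    by apply: le_trans (h z z' a s s' b b' a0 hy) _; rewrite ler_wpM2r.
  by apply: regm_lipschitz; exact: regm_mu_d.
(* [g r] bounds the distance to the desired configuration in every level 0 coordinate: [2 r] for
   attitude entries, [r + 18 B r] for the angular velocity. *)
pose g := 2 + 18 * B; have g0 : 0 < g by rewrite /g; lra.
pose r := Num.min 1 (c / (2 * (L + 1) * g)).
have d0 : 0 < 2 * (L + 1) * g by rewrite !mulr_gt0 // ltr_wpDl.
have r0 : 0 < r by rewrite lt_min ltr01 divr_gt0.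
have r1 : r <= 1 by rewrite ge_min lexx.
have r2 : L * (g * r) <= c / 2.
  have : r <= c / (2 * (L + 1) * g) by rewrite ge_min lexx orbT.
  rewrite ler_pdivlMr // => h.
  have h' : 0 <= g * r by rewrite mulr_ge0 // ltW.
  lra.
(* Any value strictly below [(c / 2)^2] suits the strict inequality in [dom]. *)
exists r, (c ^+ 2 / 8); split=> //; first by rewrite divr_gt0 ?exprn_gt0.
move=> t p q w i t0 hn hq.
have hbt l : (l <= 3)%N -> enorm (derive1n l (v0d D) t) <= B /\ enorm (derive1n l (W0d D) t) <= B.
  exact: hb.
have b1 := cfg_bounded w hbt B0 r1 hn hq.
have hn0 := near_desired_payload_d t.
have b0 := cfg_bounded w hbt B0 ler01 hn0 hq.
have l01 j : level 0 j -> level 1 j by exact: level_mono.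
have [sR hx hv hW hpsi] := hn.
have sRd : SO3 (R0d D t) by case: hD => _ /(_ t)[].
have W0B : enorm (W0d D t) <= B by have [_] := hbt 0%N isT.
have rW := rel_W0d hn (ltW r0) W0B B0.
have Br : 0 <= B * r by rewrite mulr_ge0 // ltW.
have grE : g * r = 2 * r + 18 * (B * r) by rewrite /g; ring.
have diff : bounded_on (level 0) (g * r)
    (fun j => cfg t p q w j - cfg t (payload_d D t) q w j).
  have gr0 : 0 <= g * r by rewrite mulr_ge0 // ltW.
  have z0 (x : 'cV[R]_3) (y : 'cV[R]_3) k : y = 0 -> enorm x <= r -> `|x k 0 - y k 0| <= g * r.
    move=> -> h; rewrite mxE subr0; apply: le_trans (entry_le_enorm _ _) _.
    by rewrite grE; lra.
  case=> [k|k|l k|k l|k l|k|l k|j k|j k] //= hl; rewrite ?subrr ?normr0 //.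
  - by apply: z0 => //; rewrite /e_x0 subrr.
  - by apply: z0 => //; rewrite /e_v0 subrr.
  - rewrite distrC -(ler_pXn2r (n := 2)) ?nnegrE // real_normK ?num_real //.
    apply: le_trans (Psi_entry k l sRd sR) _.
    apply: (@le_trans _ _ ((2 * r) ^+ 2)); first by rewrite exprMn; lra.
    have r20 : 0 <= 2 * r by rewrite mulr_ge0 // ltW.
    by rewrite ler_pXn2r ?nnegrE // grE; lra.
  - have -> : pW p k 0 - W0d D t k 0 =
        (e_W0 D t p + ((pR p)^T *m R0d D t *m W0d D t - W0d D t)) k 0.
      by rewrite addrA subrK !mxE.
    apply: le_trans (entry_le_enorm _ _) _; apply: le_trans (enormD _ _) _.
    by rewrite grE; lra.
have gr0 : 0 <= g * r by rewrite mulr_ge0 // ltW.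
have := hL i (cfg t p q w) (cfg t (payload_d D t) q w) (g * r) I I
  (fun j hj => b1 j (l01 j hj)) (fun j hj => b0 j (l01 j hj)) gr0 diff.
rewrite -!mu_dE => near_mu.
have low := hc i t t0.
have : c / 2 <= enorm (mu_d P K D t p i).
  have -> : c / 2 = c - c / 2 by field.
  have := enormB (mu_d P K D t p i) (mu_d P K D t p i - mu_d P K D t (payload_d D t) i).
  rewrite subKr; move: (enorm _) (enorm _) (enorm _) near_mu low => x y z; lra.
move=> h; rewrite /dom -mu_dE -enorm2.
have : (c / 2) ^+ 2 <= enorm (mu_d P K D t p i) ^+ 2.
  by rewrite ler_pXn2r ?nnegrE ?enorm_ge0 // divr_ge0 // ltW.
exact: lt_le_trans (sq8 c c0).
Qed.

Lemma cfg_bounded2 B r C t p q w : (forall l, (l <= 3)%N ->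
    enorm (derive1n l (v0d D) t) <= B /\ enorm (derive1n l (W0d D) t) <= B) ->
  0 <= B -> 0 <= C -> r <= 1 -> near_desired r t p -> (forall i, S2 (q i)) ->
  (forall i, enorm (w i) <= C) ->
  bounded_on (level 2) (B + 1 + C) (cfg t p q w).
Proof.
move=> hb B0 C0 r1 hn hq hw v.
have h1 := cfg_bounded w hb B0 r1 hn hq.
have le1 x : x <= B + 1 -> x <= B + 1 + C by lra.
have leB (x : 'cV[R]_3) i : enorm x <= B -> `|x i 0| <= B + 1 + C.
  by move=> h; apply: le_trans (entry_le_enorm _ _) _; lra.
case: v => [k|k|l k|k l|k l|k|l k|j k|j k] hl; try exact: le1 _ (h1 _ _).
- by have [h _] := hb l.+1 hl; exact: leB h.
- by have [_ h] := hb l hl; exact: leB h.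
- by apply: le_trans (entry_le_enorm _ _) _; apply: le_trans (hw j) _; lra.
Qed.

Lemma enorm_hat_sqr (q x : 'cV[R]_3) : S2 q -> enorm (hat q ^+ 2 *m x) <= enorm x.
Proof.
move=> hq; rewrite expr2 -mulmxE -mulmxA -[hat q *m (_ *m _)]/(cross q (cross q x)).
apply: le_trans (enorm_cross _ _) _; rewrite hq mul1r.
by apply: le_trans (enorm_cross _ _) _; rewrite hq mul1r.
Qed.

(** All that the stability argument retains of the feedback, with one constant [M] uniform in time.
    The bound on [u_star] asks for bounded [e_w], because [near_desired] says nothing about the link
    velocities. *)
Definition region (r k M : R) : Prop :=
  forall i, exists DQ DW : config -> config -> 'cV[R]_3,
  (forall t T (p : R -> payload R) (q w : R -> 'I_n -> 'cV[R]_3) d1 d2,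
    moves P K D t T p q w d1 d2 -> dom P K k i (cfg (T t) (p t) (q t) (w t)) ->
    is_derive t 1 (fun s => q_d P K D (T s) (p s) i)
      (dq_d P K D (T t) (p t) (q t) i + DQ (cfg (T t) (p t) (q t) (w t)) (kick d1 d2)) /\
    is_derive t 1 (fun s => w_d P K D (T s) (p s) (q s) i)
      (dw_d P K D (T t) (p t) (q t) (w t) i + DW (cfg (T t) (p t) (q t) (w t)) (kick d1 d2))) /\
  forall t p q w, 0 <= t -> near_desired r t p -> (forall j, S2 (q j)) ->
    [/\ dom P K k i (cfg t p q w), enorm (mu_d P K D t p i) <= M,
        enorm (w_d P K D t p q i) <= M,
        (forall j, enorm (e_w P K D t p q w j) <= 1) -> enorm (u_star P K D t p q w i) <= M &
        forall d1 d2 h, 0 <= h -> enorm d1 <= h -> enorm d2 <= h ->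
          enorm (DQ (cfg t p q w) (kick d1 d2)) <= M * h /\
          enorm (DW (cfg t p q w) (kick d1 d2)) <= M * h].

Lemma region_bounds : exists r k M : R,
  [/\ 0 < r, r <= 1, 0 < k & 0 <= M] /\ region r k M.
Proof.
have [r [k [r0 r1 k0 hlow]]] := mu_d_lower.
have [B B0 hb] := commands_bound.
pose T : Type := ((config -> 'cV[R]_3) * (config -> 'cV[R]_3) *
  (config -> config -> 'cV[R]_3) * (config -> config -> 'cV[R]_3))%type.
have /choice[F hF] : forall i, exists F : T, let: (wd, us, DQ, DW) := F in
    [/\ forall a b, tanform (level 0) (dom P K k i) (fun z y => DQ z y a b),
        forall a b, tanform (level 1) (dom P K k i) (fun z y => DW z y a b),
        regm (level 1) (dom P K k i) wd & regm (level 2) (dom P K k i) us] /\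
    [/\ forall t p q w, dom P K k i (cfg t p q w) ->
          w_d P K D t p q i = wd (cfg t p q w),
        forall t p q w, dom P K k i (cfg t p q w) ->
          u_star P K D t p q w i = us (cfg t p q w) &
        forall t T (p : R -> payload R) (q w : R -> 'I_n -> 'cV[R]_3) d1 d2,
          moves P K D t T p q w d1 d2 ->
          dom P K k i (cfg (T t) (p t) (q t) (w t)) ->
          is_derive t 1 (fun s => q_d P K D (T s) (p s) i)
            (dq_d P K D (T t) (p t) (q t) i
             + DQ (cfg (T t) (p t) (q t) (w t)) (kick d1 d2)) /\
          is_derive t 1 (fun s => w_d P K D (T s) (p s) (q s) i)
            (dw_d P K D (T t) (p t) (q t) (w t) i
             + DW (cfg (T t) (p t) (q t) (w t)) (kick d1 d2))].
  move=> i; have [wd [us [DQ [DW h]]]] := feedback P K hD i k0.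
  by exists (wd, us, DQ, DW).
have [M1 M10 hM1] : exists2 M : R, 0 <= M & forall i z, setT z ->
    bounded_on (level 1) (B + 1) z -> enorm (mu_d_z P K i z) <= M.
  apply: bound_uniform => [i M N MN h z s b|i]; first exact: le_trans (h z s b) MN.
  by apply: regm_bounded; exact: regm_mu_d.
have [M2 M20 hM2] : exists2 M : R, 0 <= M & forall i z, dom P K k i z ->
    bounded_on (level 1) (B + 1) z -> enorm ((F i).1.1.1 z) <= M.
  apply: bound_uniform => [i M N MN h z s b|i]; first exact: le_trans (h z s b) MN.
  by have := hF i; case: (F i) => [[[wd us] DQ] DW] [[_ _ h _] _]; exact: regm_bounded h.
(* The radius accounts for [w = e_w - hat q ^+ 2 *m w_d], of norm at most [1 + M2]. *)
have [M3 M30 hM3] : exists2 M : R, 0 <= M & forall i z, dom P K k i z ->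
    bounded_on (level 2) (B + 1 + (1 + M2)) z -> enorm ((F i).1.1.2 z) <= M.
  apply: bound_uniform => [i M N MN h z s b|i]; first exact: le_trans (h z s b) MN.
  by have := hF i; case: (F i) => [[[wd us] DQ] DW] [[_ _ _ h] _]; exact: regm_bounded h.
have [M4 M40 hM4] : exists2 M : R, 0 <= M & forall i z y h, dom P K k i z ->
    bounded_on (level 0) (B + 1) z -> 0 <= h -> bounded_on (level 0) h y ->
    enorm ((F i).1.2 z y) <= M * h.
  apply: bound_uniform => [i M N MN h z y a s b a0 hy|i].
    by apply: le_trans (h z y a s b a0 hy) _; rewrite ler_wpM2r.
  by have := hF i; case: (F i) => [[[wd us] DQ] DW] [[h _ _ _] _]; exact: tanformm_bounded h.
have [M5 M50 hM5] : exists2 M : R, 0 <= M & forall i z y h, dom P K k i z ->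
    bounded_on (level 1) (B + 1) z -> 0 <= h -> bounded_on (level 1) h y ->
    enorm ((F i).2 z y) <= M * h.
  apply: bound_uniform => [i M N MN h z y a s b a0 hy|i].
    by apply: le_trans (h z y a s b a0 hy) _; rewrite ler_wpM2r.
  by have := hF i; case: (F i) => [[[wd us] DQ] DW] [[_ h _ _] _]; exact: tanformm_bounded h.
pose M := M1 + M2 + M3 + M4 + M5.
exists r, k, M; split; first by split=> //; rewrite !addr_ge0.
move=> i; have := hF i.
have := hM3 i; have := hM4 i; have := hM5 i.
case: (F i) (hM2 i) => [[[wd us] DQ] DW] /= kM2 kM5 kM4 kM3 [_ [wdE usE hder]].
exists DQ, DW; split=> // t p q w t0 hn hq.
have hbt l : (l <= 3)%N -> enorm (derive1n l (v0d D) t) <= B /\ enorm (derive1n l (W0d D) t) <= B.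
  exact: hb.
have hd j : dom P K k j (cfg t p q w) by exact: hlow.
have b1 := cfg_bounded w hbt B0 r1 hn hq.
have b0 : bounded_on (level 0) (B + 1) (cfg t p q w).
  by move=> j hj; apply: b1; exact: level_mono hj.
have wdle j : enorm (w_d P K D t p q j) <= M2.
  have := hM2 j _ (hd j) b1; have := hF j.
  by case: (F j) => [[[wd' us'] DQ'] DW'] [_ [h _ _]]; rewrite (h _ _ _ _ (hd j)).
split.
- exact: hd.
- rewrite (mu_dE _ _ _ _ _ q w); apply: le_trans (hM1 i _ I b1) _.
  by rewrite /M -!addrA lerDl !addr_ge0.
- by apply: le_trans (wdle i) _; rewrite /M; lra.
- move=> hew; rewrite (usE _ _ _ _ (hd i)); apply: le_trans (kM3 _ (hd i) _) _; last by rewrite /M; lra.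
  apply: (cfg_bounded2 hbt B0 _ r1 hn hq) => [|j]; first by rewrite addr_ge0.
  have -> : w j = e_w P K D t p q w j - hat (q j) ^+ 2 *m w_d P K D t p q j by rewrite addrK.
  apply: le_trans (enormB _ _) _; apply: lerD => //.
  exact: le_trans (enorm_hat_sqr _ (hq j)) (wdle j).
move=> d1 d2 h h0 hd1 hd2.
have kb m : bounded_on (level m) h (kick d1 d2).
  case=> [x|x|l x|x l|x l|x|l x|j x|j x] //= _; rewrite ?normr0 //.
  - exact: le_trans (entry_le_enorm _ _) _.
  - exact: le_trans (entry_le_enorm _ _) _.
have Mh N N' : N <= M -> N' <= N * h -> N' <= M * h.
  by move=> NM; move=> /le_trans; apply; rewrite ler_wpM2r.
split.
- by apply: Mh (kM4 _ _ _ (hd i) b0 h0 (kb 0%N)); rewrite /M; lra.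
- by apply: Mh (kM5 _ _ _ (hd i) b1 h0 (kb 1%N)); rewrite /M; lra.
Qed.

End Region.

Lemma mx_entry_le (R : realType) m n (A : 'M[R]_(m, n)) i j : `|A i j| <= `|A|.
Proof.
rewrite [leRHS]/Num.Def.normr/= mx_normrE.
by apply: le_trans; last exact: (le_bigmax _ _ (i, j)).
Qed.

Lemma col_third (R : realType) (x y z : 'cV[R]_3) :
  col 2%:R (\matrix_(k < 3, j < 3) (nth 0 [:: x; y; z] j) k 0) = z.
Proof. by apply/colP => i; rewrite !mxE. Qed.

(** * Facts on a single closed-loop trajectory *)

Section ClosedLoop.
Variables (R : realType) (n : nat) (P : plant R n) (K : gains R) (D : commands R n).
Hypotheses (hP : plant_ok P) (hK : gains_ok K) (hD : commands_smooth D).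
Notation config := (var n -> R).
Notation cfg := (cfg D).

Lemma unit_q_d t p i : mu_d P K D t p i != 0 -> dot (q_d P K D t p i) (q_d P K D t p i) = 1.
Proof.
move=> m0; rewrite /q_d dotNl dotNr opprK dotZl dotZr -enorm2.
by have /lt0r_neq0 := enorm_gt0 m0; move: (enorm _) => x x0; field.
Qed.

Lemma dom_neq0 k t p q w i : 0 < k -> dom P K k i (cfg t p q w) -> mu_d P K D t p i != 0.
Proof.
move=> k0; rewrite /dom -mu_dE => h; apply/eqP => m0.
by move: h; rewrite m0 dot0l ltNge (ltW k0).
Qed.

(** Along [pmove] the vector [q_d] stays unit and its derivative is [dq_d], the differential
    vanishing on the zero [kick]. *)
Lemma q_d_orth k i t p q w (DQ : config -> config -> 'cV[R]_3) : 0 < k ->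
  (forall t T (p : R -> payload R) (q w : R -> 'I_n -> 'cV[R]_3) d1 d2,
    moves P K D t T p q w d1 d2 -> dom P K k i (cfg (T t) (p t) (q t) (w t)) ->
    is_derive t 1 (fun s => q_d P K D (T s) (p s) i)
      (dq_d P K D (T t) (p t) (q t) i + DQ (cfg (T t) (p t) (q t) (w t)) (kick d1 d2))) ->
  DQ (cfg t p q w) (kick 0 0) = 0 -> dom P K k i (cfg t p q w) ->
  dot (q_d P K D t p i) (dq_d P K D t p q i) = 0.
Proof.
move=> k0 hDQ DQ0 hd.
have hm := moves_pmove P K D t p q w.
have c0 : cfg (t + 0) (pmove P K D t p q 0) (qmove q w 0) w = cfg t p q w.
  by rewrite addr0 pmove0 qmove0.
have hd0 : dom P K k i (cfg (t + 0) (pmove P K D t p q 0) (qmove q w 0) w) by rewrite c0.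
have := hDQ _ _ _ _ _ _ _ hm hd0; rewrite c0 DQ0 addr0 addr0 pmove0 qmove0 => h.
have hn := moves_dom hD hm hd0.
have := unit_derive_orth _ h; rewrite addr0 pmove0; apply.
near=> s; apply: unit_q_d.
have : dom P K k i (cfg (t + s) (pmove P K D t p q s) (qmove q w s) w) by near: s; exact: hn.
exact: dom_neq0.
Unshelve. all: by end_near. Qed.

Variables (S : R -> state R n) (eps a b : R).
Hypothesis e0 : 0 < eps.
Hypothesis hcl : closed_loop P K D S eps a b.

Section Instant.
Variable t : R.
Hypothesis tab : a < t < b.

Let hlaw : law_defined P K D S t. Proof. by have [] := hcl tab. Qed.
Let hM : on_manifold S t. Proof. by have [_ [[]]] := hcl tab. Qed.
Let hk : kinematics S t. Proof. by have [_ [[]]] := hcl tab. Qed.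
Let hv : velocities_derivable S t. Proof. by have [_ [[]]] := hcl tab. Qed.
Let hT : payload_translation P S (f_law P K D S) t.
Proof. by have [_ [_ []]] := hcl tab. Qed.
Let hR : payload_rotation P S (f_law P K D S) t.
Proof. by have [_ [_ []]] := hcl tab. Qed.
Let hl : link_dynamics P S (f_law P K D S) t.
Proof. by have [_ [_ []]] := hcl tab. Qed.

Lemma trajectory_moves : moves P K D t id (fun s => pl (S s)) (fun s => lq (S s))
  (fun s => lw (S s)) (acc_err P K D S t) (ang_err P K D S t).
Proof.
have [kx kR kq] := hk; have [dv dW _] := hv.
split; last by move=> j; have [] := kq j.
split; [exact: is_derive_id|exact: kx| |exact: kR| ].
- apply: (is_derive_eq (derivable_is_derive1 dv)).
  by rewrite /acc_err addrC subrK.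
- apply: (is_derive_eq (derivable_is_derive1 dW)).
  by rewrite /ang_err addrC subrK.
Qed.

Lemma mu_d_neq0 i : mu_d P K D t (pl (S t)) i != 0.
Proof. by case: (hlaw i). Qed.

Lemma q_d_near i : \forall s \near t,
  dot (q_d P K D s (pl (S s)) i) (q_d P K D s (pl (S s)) i) = 1.
Proof.
near=> s; apply: unit_q_d.
have sab : a < s < b by near: s; exact: near_itv.
by have [h _] := hcl sab; case: (h i).
Unshelve. all: by end_near. Qed.

(* With u* = -|u*| R_c e3, the force error is the component of u* normal to the
   thrust axis R e3. *)
Lemma force_err_le i :
  enorm (force_err P K D S t i) <=
  enorm (us P K D S i t) * (2 * Num.sqrt (Psi ((R_c P K D S i t)^T *m qR (S t) i))).
Proof.
have [_ sRc _ _] := hlaw i.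
have sR : SO3 (qR (S t) i) by case: hM => _ /(_ i)[].
set u := us P K D S i t; set y := qR (S t) i *m e3.
pose x := R_c P K D S i t *m e3.
have y1 : dot y y = 1.
  rewrite /y orthogonal_dot; last by case: sR.
  by rewrite dotE /e3 !mxE /=; ring.
have x1 : enorm x = 1.
  rewrite /x orthogonal_enorm; last by case: sRc.
  by rewrite /enorm dotE /e3 !mxE /= !mulr0 !add0r mulr1 sqrtr1.
have xE : x = - ((enorm u)^-1 *: u).
  by rewrite /x /R_c /R_cmd /e3 -colE col_third.
have ux : u = - (enorm u *: x).
  have u0 : enorm u != 0.
    apply/eqP => u0; move: x1; rewrite xE u0 invr0 scale0r oppr0 enorm0 => /eqP.
    by rewrite eq_sym oner_eq0.
  by rewrite xE scalerN opprK scalerA mulfV // scale1r.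
(* Replacing [x] by [x - y] is free inside a cross product with [y]; the difference is a column of
   [R_c - R], which [Psi_dist] controls. *)
have -> : force_err P K D S t i = enorm u *: cross y (cross (x - y) y).
  have uy : dot u y = - (enorm u * dot x y) by rewrite {1}ux dotNl dotZl.
  rewrite /force_err /thrust /f_law -/u -/y uy [X in _ - X]ux cross_cross y1 dotBr y1.
  rewrite (dotC y); move: (enorm u) (dot x y) => c d; clearbody x y.
  by apply: col3P; rewrite !mxE; ring.
rewrite enormZ ger0_norm ?enorm_ge0 // ler_wpM2l ?enorm_ge0 //.
have yn : enorm y = 1 by rewrite /enorm y1 sqrtr1.
apply: le_trans (enorm_cross _ _) _; rewrite yn mul1r.
apply: le_trans (enorm_cross _ _) _; rewrite yn mulr1.
apply: enorm_leP; first by rewrite mulr_ge0 ?sqrtr_ge0.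
rewrite exprMn sqr_sqrtr; last by apply: Psi_ge0; apply: SO3_mul => //; exact: SO3_trmx.
rewrite (_ : 2 ^+ 2 = 4); last by ring.
rewrite -Psi_dist // /y /x /e3 -!colE.
move: (R_c P K D S i t) (qR (S t) i) => A B; rewrite !sum3 dotE !mxE.
have s0 j l := sqr_ge0 (A j l - B j l).
have := s0 0 0; have := s0 0 1; have := s0 1 0; have := s0 1 1; have := s0 2%:R 0.
have := s0 2%:R 1.
lra.
Qed.

Lemma link_functions_derivable i :
  derivable (fun s =>
    2^-1 * dot (e_w P K D s (pl (S s)) (lq (S s)) (lw (S s)) i)
               (e_w P K D s (pl (S s)) (lq (S s)) (lw (S s)) i)
    + k_q K * (1 - dot (lq (S s) i) (q_d P K D s (pl (S s)) i))) t 1 /\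
  derivable (fun s => dot (e_q P K D s (pl (S s)) (lq (S s)) i)
               (e_w P K D s (pl (S s)) (lq (S s)) (lw (S s)) i)) t 1.
Proof.
(* Derivability is needed at every time of the trajectory, also outside the region with a uniform
   [k], so [k] is taken from the current value of [mu_d]. *)
pose k := dot (mu_d P K D t (pl (S t)) i) (mu_d P K D t (pl (S t)) i) / 2.
have mm : 0 < dot (mu_d P K D t (pl (S t)) i) (mu_d P K D t (pl (S t)) i).
  by rewrite -enorm2 exprn_gt0 // enorm_gt0 // mu_d_neq0.
have k0 : 0 < k by rewrite divr_gt0.
have hd : dom P K k i (cfg t (pl (S t)) (lq (S t)) (lw (S t))).
  by rewrite /dom -mu_dE /k; lra.
have [wd [us' [DQ [DW [_ [_ _ hder]]]]]] := feedback P K hD i k0.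
have [dq dw] := hder _ _ _ _ _ _ _ trajectory_moves hd.
have [_ _ kq] := hk; have [hq _] := kq i.
have [_ _ hvi] := hv; have [hw _] := hvi i.
have heq := is_derive_cross dq hq.
have [dew hew] : exists d, is_derive t 1
    (fun s => e_w P K D s (pl (S s)) (lq (S s)) (lw (S s)) i) d.
  have h := is_derive_add (derivable_is_derive1 hw)
    (is_derive_mulmx (is_derive_mulmx (is_derive_hat hq) (is_derive_hat hq)) dw).
  have -> : (fun s => e_w P K D s (pl (S s)) (lq (S s)) (lw (S s)) i) =
    fun s => lw (S s) i + hat (lq (S s) i) *m hat (lq (S s) i) *m w_d P K D s (pl (S s)) (lq (S s)) i.
    by apply/funext => s; rewrite /e_w expr2 -mulmxE.
  by eexists; exact: h.
split.
- have h1 := is_derive_scale (2^-1) (is_derive_dot hew hew).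
  have h2 := is_derive_scale (k_q K) (is_derive_sub (is_derive_cst (1 : R) t 1) (is_derive_dot hq dq)).
  by case: (is_derive_add h1 h2).
- by case: (is_derive_dot heq hew).
Qed.

End Instant.

End ClosedLoop.

(** * Exponential stability *)

Section LyapunovFunctions.
Variables (R : realType) (n : nat) (P : plant R n) (K : gains R) (D : commands R n).
Hypotheses (hP : plant_ok P) (hK : gains_ok K) (hD : commands_smooth D).
Variable eps : R.
Hypothesis e0 : 0 < eps.
Implicit Types (S : R -> state R n) (c t s : R) (i : 'I_n).

Notation ex S s := (e_x0 D s (pl (S s))).
Notation ev S s := (e_v0 D s (pl (S s))).
Notation eR0 S s := (e_R0 D s (pl (S s))).
Notation eW0 S s := (e_W0 D s (pl (S s))).
Notation eq S i s := (e_q P K D s (pl (S s)) (lq (S s)) i).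
Notation ew S i s := (e_w P K D s (pl (S s)) (lq (S s)) (lw (S s)) i).
Notation eR S i s := (e_R P K D S i s).
Notation eW S i s := (e_W P K D S i s).

Definition payload_Psi S s := Psi ((R0d D s)^T *m pR (pl (S s))).
Definition quad_Psi S i s := Psi ((R_c P K D S i s)^T *m qR (S s) i).
Definition link_psi S i s := 1 - dot (lq (S s) i) (q_d P K D s (pl (S s)) i).

Definition lyap_x c S s :=
  2^-1 * dot (ev S s) (ev S s) + k_x0 K * (2^-1 * dot (ex S s) (ex S s))
  + c * dot (ex S s) (ev S s).

Definition lyap_R c S s :=
  2^-1 * dot (eW0 S s) (J0 P *m eW0 S s) + k_R0 K * payload_Psi S s
  + c * dot (eR0 S s) (J0 P *m eW0 S s).

Definition lyap_q c S i s :=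
  2^-1 * dot (ew S i s) (ew S i s) + k_q K * link_psi S i s + c * dot (eq S i s) (ew S i s).

Definition lyap_f c S i s :=
  2^-1 * dot (eW S i s) (inert P i *m eW S i s) + k_R K / eps ^+ 2 * quad_Psi S i s
  + c * dot (eR S i s) (inert P i *m eW S i s).

Lemma is_derive_combination (f g : R -> R) c t D1 D2 :
  is_derive t 1 f D1 -> is_derive t 1 g D2 ->
  is_derive t 1 (fun s => f s + c * g s) (D1 + c * D2).
Proof. by move=> hf hg; apply: is_derive_add => //; exact: is_derive_scale. Qed.

Lemma lyap_f_spec : exists c al b1 b2 : R, [/\ 0 < al, 0 < b1 & 0 < b2] /\
  forall S a b t i, closed_loop P K D S eps a b -> a < t < b ->
  [/\ derivable (lyap_f c S i) t 1,
      b1 * (quad_Psi S i t + enorm (eW S i t) ^+ 2) <= lyap_f c S i t,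
      quad_Psi S i t <= 1 -> lyap_f c S i t <= b2 * (enorm (eR S i t) ^+ 2 + enorm (eW S i t) ^+ 2) &
      derive1 (lyap_f c S i) t <= - al * (enorm (eR S i t) ^+ 2 + enorm (eW S i t) ^+ 2)].
Proof.
have hJ i : inertia (inert P i) by case: hP => _ _ _ /(_ i)[].
have [cJ cJ0 hcJ] : exists2 c : R, 0 <= c & forall i x, enorm (inert P i *m x) <= c * enorm x.
  apply: bound_uniform => [i M N MN h x|i].
    by apply: le_trans (h x) _; rewrite ler_wpM2r ?enorm_ge0.
  by have [c c0 hc] := mulmx_bound (inert P i); exists c; rewrite // ltW.
(* The coercivity constant is handled through its inverse, which may be enlarged freely, as
   [bound_uniform] requires. *)
have [l0 l00 hl0] : exists2 l : R, 0 <= l & forall i, forall x : 'cV[R]_3,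
    enorm x ^+ 2 <= l * dot x (inert P i *m x).
  apply: bound_uniform => [i M N MN h x|i].
    apply: le_trans (h x) _; rewrite ler_wpM2r //.
    have [l l0 hl] := inertia_lower (hJ i).
    by apply: le_trans (hl x); rewrite mulr_ge0 ?sqr_ge0 // ltW.
  have [l l0 hl] := inertia_lower (hJ i).
  by exists l^-1 => [|x]; rewrite ?invr_ge0 ?(ltW l0) // ler_pdivlMl.
have [_ [_ _ kR kW]] := hK.
pose l := (2 * (l0 + 1))^-1.
have l0' : 0 < l by rewrite invr_gt0 mulr_gt0 // ltr_wpDl.
have k1 : 0 < k_R K / eps ^+ 2 by rewrite divr_gt0 ?exprn_gt0.
have k2 : 0 < k_W K / eps by rewrite divr_gt0.
have L0 : 0 < cJ + 1 by rewrite ltr_wpDl.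
have B0 : 0 < k_W K / eps + 2 * cJ by rewrite ltr_wpDr ?mulr_ge0.
have [c [al [b1 [b2 [M [[c0 al0 b10 b20 M0] hw]]]]]] := lyapunov_weights k1 k2 l0' L0 B0.
exists c, al, b1, b2; split=> // S a b t i hcl tab.
have [hlaw [[hM _ _] _]] := hcl t tab.
have sQ : SO3 ((R_c P K D S i t)^T *m qR (S t) i).
  apply: SO3_mul; first by apply: SO3_trmx; case: (hlaw i).
  by case: hM => _ /(_ i)[].
have [D1 [D2 [d1 d2 i1 i2]]] := fast_estimate hP hK e0 tab hcl (hcJ i).
have d := is_derive_combination c d1 d2.
set x := enorm (eR S i t) in i2 *; set y := enorm (eW S i t) in i1 i2 *.
have [x0 y0] : 0 <= x /\ 0 <= y by split; exact: enorm_ge0.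
have U0 : 0 <= quad_Psi S i t by exact: Psi_ge0.
have aU : x ^+ 2 <= 2 * quad_Psi S i t by rewrite /x /e_R att_errE; exact: rot_err_le.
have lT : l * y ^+ 2 <= 2^-1 * dot (eW S i t) (inert P i *m eW S i t).
  rewrite /l invfM -mulrA ler_pM2l ?invr_gt0 // mulrC ler_pdivrMr ?ltr_wpDl //.
  apply: le_trans (hl0 i _) _; rewrite mulrC ler_wpM2l ?lerDl //.
  have [-> |z0] := eqVneq (eW S i t) 0; first by rewrite dot0l.
  by case: (hJ i) => _ /(_ _ z0) /ltW.
have TL0 : dot (eW S i t) (inert P i *m eW S i t) <= y * (cJ * y).
  by apply: le_trans (dot_le_norms _ _) _; rewrite ler_wpM2l.
have TL : 2^-1 * dot (eW S i t) (inert P i *m eW S i t) <= (cJ + 1) * y ^+ 2.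
  have : 0 <= cJ * y ^+ 2 by rewrite mulr_ge0 ?sqr_ge0.
  have := sqr_ge0 y; rewrite !expr2; lra.
have XL : `|dot (eR S i t) (inert P i *m eW S i t)| <= (cJ + 1) * (x * y).
  apply: le_trans (dot_le _ _) _.
  apply: le_trans (_ : x * (cJ * y) <= _); first by rewrite ler_wpM2l.
  have : 0 <= x * y by rewrite mulr_ge0.
  lra.
have [w1 w2 w3] := hw _ _ _ _ _ x0 y0 U0 aU lT TL XL.
split; [by case: d|exact: w1| |].
- by move=> u1; apply: w2; rewrite /x /e_R att_errE; exact: Psi_le.
- rewrite (is_derive_derive1 d).
  have := w3 D1 D2 0 (lexx 0); rewrite !(mulr0, mul0r, addr0, expr0n) /=; apply.
  + by [].
  + have h1 : 0 <= cJ * (x * y) by rewrite !mulr_ge0.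
    have h2 : 0 <= k_W K / eps * y ^+ 2 by rewrite mulr_ge0 ?sqr_ge0 // ltW.
    apply: le_trans i2 _; rewrite mulrDl mulrDl; lra.
Qed.

Lemma lyap_x_spec : exists c al b1 b2 M : R, [/\ 0 < al, 0 < b1, 0 < b2 & 0 < M] /\
  forall S a b t, closed_loop P K D S eps a b -> a < t < b ->
  [/\ derivable (lyap_x c S) t 1,
      b1 * (2^-1 * enorm (ex S t) ^+ 2 + enorm (ev S t) ^+ 2) <= lyap_x c S t,
      lyap_x c S t <= b2 * (enorm (ex S t) ^+ 2 + enorm (ev S t) ^+ 2) &
      forall h, (m0 P)^-1 * \sum_j enorm (gap P K D S t j) + enorm (acc_err P K D S t) <= h ->
      derive1 (lyap_x c S) t <= - al * (enorm (ex S t) ^+ 2 + enorm (ev S t) ^+ 2) + M * h ^+ 2].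
Proof.
have [[kx kv _ _] _] := hK.
have B0 : 0 < 1 + k_v0 K by rewrite addr_gt0.
have h2 : (0 : R) < 2^-1 by rewrite invr_gt0.
have [c [al [b1 [b2 [M [[c0 al0 b10 b20 M0] hw]]]]]] := lyapunov_weights kx kv h2 ltr01 B0.
exists c, al, b1, b2, M; split=> // S a b t hcl tab.
have [_ [[hM hk hv] _]] := hcl t tab.
set x := enorm (ex S t); set y := enorm (ev S t).
have [x0 y0] : 0 <= x /\ 0 <= y by split; exact: enorm_ge0.
have U0 : 0 <= 2^-1 * dot (ex S t) (ex S t) by rewrite mulr_ge0 ?dot_ge0 ?ltW.
have aU : x ^+ 2 <= 2 * (2^-1 * dot (ex S t) (ex S t)).
  by rewrite /x enorm2 mulrA mulfV ?mul1r // pnatr_eq0.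
have lT : 2^-1 * y ^+ 2 <= 2^-1 * dot (ev S t) (ev S t) by rewrite /y enorm2.
have TL : 2^-1 * dot (ev S t) (ev S t) <= 1 * y ^+ 2.
  by rewrite /y enorm2; have := dot_ge0 (ev S t); lra.
have XL : `|dot (ex S t) (ev S t)| <= 1 * (x * y) by rewrite mul1r; exact: dot_le.
have [w1 w2 w3] := hw _ _ _ _ _ x0 y0 U0 aU lT TL XL.
have key h : (m0 P)^-1 * \sum_j enorm (gap P K D S t j) + enorm (acc_err P K D S t) <= h ->
    derivable (lyap_x c S) t 1 /\
    derive1 (lyap_x c S) t <= - al * (x ^+ 2 + y ^+ 2) + M * h ^+ 2.
  move=> hh; have [D1 [D2 [d1 d2 i1 i2]]] := translation_estimate hP hK hD hM hk hv hh.
  have d := is_derive_combination c d1 d2.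
  split; first by case: d.
  rewrite (is_derive_derive1 d).
  have h0 : 0 <= h.
    apply: le_trans hh; rewrite addr_ge0 ?enorm_ge0 // mulr_ge0 ?invr_ge0 //.
      by case: hP => _ /ltW.
    by apply: sumr_ge0 => j _; exact: enorm_ge0.
  have n1 : 0 <= h * (x + y) by rewrite mulr_ge0 ?addr_ge0.
  have n2 : 0 <= k_v0 K * (h * (x + y)) by rewrite mulr_ge0 // ltW.
  have n3 : 0 <= x * y by rewrite mulr_ge0.
  have n4 : 0 <= k_v0 K * y ^+ 2 by rewrite mulr_ge0 ?sqr_ge0 // ltW.
  apply: w3 => //.
  - by apply: le_trans i1 _; rewrite -/x -/y; lra.
  - by apply: le_trans i2 _; rewrite -/x -/y; lra.
split; [by have [] := key _ (lexx _)| | |by move=> h /key[]].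
  by rewrite [x ^+ 2]enorm2; exact: w1.
by apply: w2; rewrite /x enorm2; have := dot_ge0 (ex S t); lra.
Qed.

Lemma lyap_R_spec B : 0 <= B ->
  exists c al b1 b2 M cg : R, [/\ 0 < al, 0 < b1, 0 < b2, 0 < M & 0 <= cg] /\
  forall S a b t, closed_loop P K D S eps a b -> a < t < b ->
  [/\ derivable (lyap_R c S) t 1,
      b1 * (payload_Psi S t + enorm (eW0 S t) ^+ 2) <= lyap_R c S t,
      payload_Psi S t <= 1 -> lyap_R c S t <= b2 * (enorm (eR0 S t) ^+ 2 + enorm (eW0 S t) ^+ 2) &
      forall h, enorm (W0d D t) <= B -> enorm (eW0 S t) <= 1 ->
        cg * (\sum_j enorm (gap P K D S t j) + enorm (ang_err P K D S t)) <= h ->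
        derive1 (lyap_R c S) t <=
          - al * (enorm (eR0 S t) ^+ 2 + enorm (eW0 S t) ^+ 2) + M * h ^+ 2].
Proof.
move=> B0; have [[_ _ kR kW] _] := hK.
have hJ : inertia (J0 P) by case: hP.
have [cJ cJ0 hcJ] := mulmx_bound (J0 P).
have [l l0 hl] := inertia_lower hJ.
have [cr cr0 hcr] := hat_rho_bound P.
have L0 : 0 < l / 2 by rewrite divr_gt0.
have C0 : 0 < 1 + cJ * (1 + 3 * B) + k_W0 K + 2 * cJ.
  by rewrite !addr_gt0 ?mulr_gt0 // ltr_wpDr // mulr_ge0.
have [c [al [b1 [b2 [M [[c0 al0 b10 b20 M0] hw]]]]]] := lyapunov_weights kR kW L0 cJ0 C0.
exists c, al, b1, b2, M, (cr + cJ); split; first by split=> //; rewrite addr_ge0 // ltW.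
move=> S a b t hcl tab.
have [_ [[hM hk hv] _]] := hcl t tab.
have sR : SO3 (pR (pl (S t))) by case: hM.
have sRd : SO3 (R0d D t) by case: hD => _ /(_ t)[].
have sQ : SO3 ((R0d D t)^T *m pR (pl (S t))) by apply: SO3_mul => //; exact: SO3_trmx.
set x := enorm (eR0 S t); set y := enorm (eW0 S t).
have [x0 y0] : 0 <= x /\ 0 <= y by split; exact: enorm_ge0.
have U0 : 0 <= payload_Psi S t by exact: Psi_ge0.
have aU : x ^+ 2 <= 2 * payload_Psi S t by rewrite /x /e_R0 att_errE; exact: rot_err_le.
have lT : l / 2 * y ^+ 2 <= 2^-1 * dot (eW0 S t) (J0 P *m eW0 S t).
  by have := hl (eW0 S t); rewrite -/y; lra.
have TL0 : dot (eW0 S t) (J0 P *m eW0 S t) <= y * (cJ * y).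
  by apply: le_trans (dot_le_norms _ _) _; rewrite ler_wpM2l.
have TL : 2^-1 * dot (eW0 S t) (J0 P *m eW0 S t) <= cJ * y ^+ 2.
  have : 0 <= cJ * y ^+ 2 by rewrite mulr_ge0 ?sqr_ge0 // ltW.
  rewrite !expr2; lra.
have XL : `|dot (eR0 S t) (J0 P *m eW0 S t)| <= cJ * (x * y).
  apply: le_trans (dot_le _ _) _.
  by apply: le_trans (_ : x * (cJ * y) <= _); rewrite ?ler_wpM2l //; lra.
have [w1 w2 w3] := hw _ _ _ _ _ x0 y0 U0 aU lT TL XL.
have key h B' E : enorm (W0d D t) <= B' -> enorm (eW0 S t) <= E -> 0 <= B' ->
    cr * \sum_j enorm (gap P K D S t j) + cJ * enorm (ang_err P K D S t) <= h ->
    exists D1 D2 : R, [/\ is_derive t 1 (lyap_R c S) (D1 + c * D2),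
      D1 <= - k_W0 K * y ^+ 2 + h * (x + y) &
      D2 <= - k_R0 K * x ^+ 2 + (cJ * (E + 3 * B') + k_W0 K) * (x * y)
            + 2 * cJ * y ^+ 2 + h * (x + y)].
  move=> hW hE hB' hh.
  have [D1 [D2 [d1 d2 i1 i2]]] :=
    payload_attitude_estimate hP hK hD hM hk hv hcJ hcr hh hW hB' (ltW cJ0) hE.
  by exists D1, D2; split=> //; exact: is_derive_combination.
split.
(* Derivability is unconditional: every bound is instantiated with the quantity that it bounds. *)
- have [D1 [D2 [d _ _]]] := key _ _ _ (lexx _) (lexx _) (enorm_ge0 _) (lexx _).
  by case: d.
- exact: w1.
- by move=> u1; apply: w2; rewrite /x /e_R0 att_errE; exact: Psi_le.
move=> h hW hE hh.
have g0 : 0 <= \sum_j enorm (gap P K D S t j) by apply: sumr_ge0 => j _; exact: enorm_ge0.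
have a0 := enorm_ge0 (ang_err P K D S t).
have hh' : cr * \sum_j enorm (gap P K D S t j) + cJ * enorm (ang_err P K D S t) <= h.
  apply: le_trans hh; rewrite mulrDl !mulrDr.
  have : 0 <= cr * enorm (ang_err P K D S t) by rewrite mulr_ge0.
  have : 0 <= cJ * \sum_j enorm (gap P K D S t j) by rewrite mulr_ge0 // ltW.
  lra.
have h0 : 0 <= h by apply: le_trans hh'; rewrite addr_ge0 ?mulr_ge0 // ltW.
have [D1 [D2 [d i1 i2]]] := key h B 1 hW hE B0 hh'.
rewrite (is_derive_derive1 d).
have Cg : 1 <= 1 + cJ * (1 + 3 * B) + k_W0 K + 2 * cJ.
  by rewrite -!addrA lerDl !addr_ge0 ?mulr_ge0 ?addr_ge0 ?mulr_ge0 // ltW.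
have n1 : h * (x + y) <= (1 + cJ * (1 + 3 * B) + k_W0 K + 2 * cJ) * h * (x + y).
  by rewrite -mulrA ler_peMl ?mulr_ge0 ?addr_ge0.
have n2 : (cJ * (1 + 3 * B) + k_W0 K) * (x * y) <=
    (1 + cJ * (1 + 3 * B) + k_W0 K + 2 * cJ) * (x * y).
  by rewrite ler_wpM2r ?mulr_ge0 //; lra.
have n3 : 2 * cJ * y ^+ 2 <= (1 + cJ * (1 + 3 * B) + k_W0 K + 2 * cJ) * y ^+ 2.
  rewrite ler_wpM2r ?sqr_ge0 // lerDr !addr_ge0 ?mulr_ge0 ?addr_ge0 ?mulr_ge0 // ltW //.
apply: w3 => //.
- by apply: le_trans i1 _; rewrite lerD2l.
- by apply: le_trans i2 _; apply: lerD n1; apply: lerD n3; apply: lerD n2.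
Qed.

(** Lagrange's identity for two unit vectors; [link_psi] and [e_q] are related exactly as [Psi] and
    [rot_err]. *)
Lemma psi_facts S i t : S2 (lq (S t) i) -> mu_d P K D t (pl (S t)) i != 0 ->
  0 <= link_psi S i t /\ enorm (eq S i t) ^+ 2 = link_psi S i t * (2 - link_psi S i t).
Proof.
move=> /S2_dot q1 /unit_q_d d1; rewrite /link_psi; split.
  rewrite subr_ge0; apply: le_trans (dot_le_norms _ _) _.
  by rewrite /enorm q1 d1 sqrtr1 mulr1.
have h := cross_dot_sqr (q_d P K D t (pl (S t)) i) (lq (S t) i).
rewrite q1 d1 mulr1 in h; rewrite enorm2 /e_q (dotC (lq (S t) i)).
have -> : dot (cross (q_d P K D t (pl (S t)) i) (lq (S t) i))
   (cross (q_d P K D t (pl (S t)) i) (lq (S t) i)) =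
   1 - dot (q_d P K D t (pl (S t)) i) (lq (S t) i) ^+ 2 by rewrite -h addrK.
by ring.
Qed.

Lemma lyap_q_spec r k M C : 0 < k -> 0 <= M -> 0 <= C -> region P K D r k M ->
  exists c al b1 b2 N : R, [/\ 0 < al, 0 < b1, 0 < b2 & 0 < N] /\
  forall S a b t i, closed_loop P K D S eps a b -> a < t < b ->
  [/\ derivable (lyap_q c S i) t 1,
      b1 * (link_psi S i t + enorm (ew S i t) ^+ 2) <= lyap_q c S i t,
      link_psi S i t <= 1 -> lyap_q c S i t <= b2 * (enorm (eq S i t) ^+ 2 + enorm (ew S i t) ^+ 2) &
      forall h, 0 <= t -> near_desired D r t (pl (S t)) ->
        enorm (acc_err P K D S t) <= C * h -> enorm (ang_err P K D S t) <= C * h ->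
        enorm (pt_err P K D S t i) <= C * h -> enorm (force_err P K D S t i) <= h ->
        derive1 (lyap_q c S i) t <=
          - al * (enorm (eq S i t) ^+ 2 + enorm (ew S i t) ^+ 2) + N * h ^+ 2].
Proof.
move=> k0 M0 C0 hreg; have [_ [kq kw _ _]] := hK.
have hml i : 0 < mass P i /\ 0 < len P i by case: hP => _ _ _ /(_ i)[].
pose lb := \sum_i ((len P i)^-1 + (mass P i * len P i)^-1).
have lbi i : (len P i)^-1 <= lb /\ (mass P i * len P i)^-1 <= lb.
  have pos j : 0 <= (len P j)^-1 /\ 0 <= (mass P j * len P j)^-1.
    by have [m l] := hml j; rewrite !invr_ge0 mulr_ge0 ltW.
  have : (len P i)^-1 + (mass P i * len P i)^-1 <= lb.
    rewrite /lb (bigD1 i) //= lerDl sumr_ge0 // => j _.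
    by have [p1 p2] := pos j; exact: addr_ge0.
  by have [p1 p2] := pos i; move=> h; split; apply: le_trans h; rewrite ?lerDl ?lerDr.
have lb0 : 0 <= lb.
  apply: sumr_ge0 => i _; have [m l] := hml i.
  by rewrite addr_ge0 ?invr_ge0 ?mulr_ge0 ?ltW.
(* The summands bound, in units of [h], the three parts of [link_pert]: attachment acceleration,
   thrust and [zeta]. The last also covers [eta]. *)
pose G := lb * C + lb + M * C.
have MC0 : 0 <= M * C by exact: mulr_ge0.
have lC0 : 0 <= lb * C by exact: mulr_ge0.
have G0 : 0 <= G by rewrite !addr_ge0.
have h2 : (0 : R) < 2^-1 by rewrite invr_gt0.
pose B := 2 + k_q K + M + k_w K.
have B0 : 0 < B by rewrite /B; lra.
have [c [al [b1 [b2 [N [[c0 al0 b10 b20 N0] hw]]]]]] := lyapunov_weights kq kw h2 ltr01 B0.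
exists c, al, b1, b2, (N * (G + 1) ^+ 2); split.
  by split=> //; rewrite mulr_gt0 // exprn_gt0 // ltr_wpDl.
move=> S a b t i hcl tab.
have [hlaw [[hM hk hv] [_ _ hl _]]] := hcl t tab.
have m0 : mu_d P K D t (pl (S t)) i != 0 by case: (hlaw i).
have hq j : S2 (lq (S t) j) by case: hM => _ /(_ j)[].
have [U0 eqE] := psi_facts (hq i) m0.
set x := enorm (eq S i t) in eqE *; set y := enorm (ew S i t).
have [x0 y0] : 0 <= x /\ 0 <= y by split; exact: enorm_ge0.
have aU : x ^+ 2 <= 2 * link_psi S i t by rewrite eqE; have := sqr_ge0 (link_psi S i t); lra.
have lT : 2^-1 * y ^+ 2 <= 2^-1 * dot (ew S i t) (ew S i t) by rewrite /y enorm2.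
have TL : 2^-1 * dot (ew S i t) (ew S i t) <= 1 * y ^+ 2.
  by rewrite /y enorm2; have := dot_ge0 (ew S i t); lra.
have XL : `|dot (eq S i t) (ew S i t)| <= 1 * (x * y) by rewrite mul1r; exact: dot_le.
have [w1 w2 w3] := hw _ _ _ _ _ x0 y0 U0 aU lT TL XL.
split.
- have [d1 d2] := link_functions_derivable hD hcl tab i.
  have := is_derive_combination c (derivable_is_derive1 d1) (derivable_is_derive1 d2).
  by case.
- exact: w1.
- by move=> u1; apply: w2; rewrite eqE; nra.
move=> h t0 hn ha hW hpt hf.
have h0 : 0 <= h by apply: le_trans hf; exact: enorm_ge0.
have Ch0 : 0 <= C * h by exact: mulr_ge0.
have [DQ [DW [hder hbd]]] := hreg i.
have [hd _ wdM _ hdd] := hbd t (pl (S t)) (lq (S t)) (lw (S t)) t0 hn hq.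
have [dq dw] := hder _ _ _ _ _ _ _ (trajectory_moves hcl tab) hd.
have [eta_le zeta_le] := hdd _ _ _ Ch0 ha hW.
set eta := DQ _ _ in dq eta_le; set zeta := DW _ _ in dw zeta_le.
(* The linear bound on the differential, taken with [h = 0]. *)
have DQ0 : DQ (cfg D t (pl (S t)) (lq (S t)) (lw (S t))) (kick 0 0) = 0.
  have [q0 _] : enorm (0 : 'cV[R]_3) <= 0 /\ True by rewrite enorm0.
  have [z _] := hdd 0 0 0 (lexx 0) q0 q0.
  by apply: enorm_eq0; apply/eqP; rewrite eq_le enorm_ge0 andbT -(mulr0 M).
have hqd1 := unit_q_d m0.
have hdqd := q_d_orth hD k0 (fun t T p q w d1 d2 hm hd => (hder t T p q w d1 d2 hm hd).1) DQ0 hd.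
have heta : dot (q_d P K D t (pl (S t)) i) eta = 0.
  have := unit_derive_orth (q_d_near hcl tab i) dq.
  by rewrite dotDr hdqd add0r.
have hG : 0 <= G * h by exact: mulr_ge0.
have etaG : enorm eta <= G * h.
  apply: le_trans eta_le _; rewrite mulrA ler_wpM2r // /G; lra.
have pertG : enorm (link_pert P K D S t i zeta) <= G * h.
  have [li mi] := lbi i.
  have qn : enorm (lq (S t) i) = 1 := hq i.
  rewrite /link_pert; apply: le_trans (enormD _ _) _.
  apply: le_trans (lerD (enormB _ _) (lexx _)) _.
  rewrite !enormZ /G !mulrDl; apply: lerD; first apply: lerD.
  - rewrite -mulrA ler_pM ?normr_ge0 ?enorm_ge0 //.
      by rewrite ger0_norm // invr_ge0 ltW //; case: (hml i).
    by apply: le_trans (enorm_cross _ _) _; rewrite qn mul1r.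
  - rewrite ler_pM ?normr_ge0 ?enorm_ge0 //.
      by rewrite ger0_norm // invr_ge0 mulr_ge0 // ltW //; case: (hml i).
    by apply: le_trans (enorm_cross _ _) _; rewrite qn mul1r.
  - rewrite -mulrA; apply: le_trans zeta_le.
    have -> : dot (lq (S t) i) zeta *: lq (S t) i - zeta = hat (lq (S t) i) ^+ 2 *m zeta.
      by rewrite hat_sqrE (S2_dot (hq i)) scale1r.
    exact: enorm_hat_sqr.
have [D1 [D2 [d1 d2 i1 i2]]] :=
  link_estimate hP hK hM hk hv hl hqd1 hdqd dq dw heta etaG pertG wdM.
have d := is_derive_combination c d1 d2.
rewrite (is_derive_derive1 d).
have n1 : 0 <= G * h * (x + y) by rewrite mulr_ge0 ?addr_ge0.
have n2 : 0 <= x * y by rewrite mulr_ge0.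
have n3 := sqr_ge0 y.
have n4 : 0 <= k_q K * (G * h * (x + y)) by rewrite mulr_ge0 // ltW.
have n5 : 0 <= M * (G * h * (x + y)) by rewrite mulr_ge0.
have n6 : 0 <= k_w K * (G * h * (x + y)) by rewrite mulr_ge0 // ltW.
have n7 : 0 <= k_q K * (x * y) by rewrite mulr_ge0 // ltW.
have n8 : 0 <= k_q K * y ^+ 2 by rewrite mulr_ge0 // ltW.
have n9 : 0 <= M * y ^+ 2 by rewrite mulr_ge0.
have n10 : 0 <= k_w K * y ^+ 2 by rewrite mulr_ge0 // ltW.
have fin : D1 + c * D2 <= - al * (x ^+ 2 + y ^+ 2) + N * (G * h) ^+ 2.
  apply: w3 => //.
  - by apply: le_trans i1 _; rewrite -/x -/y /B; lra.
  - by apply: le_trans i2 _; rewrite -/x -/y /B; lra.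
apply: le_trans fin _; rewrite lerD2l -mulrA ler_pM2l // -exprMn.
by rewrite ler_pXn2r ?nnegrE ?mulr_ge0 ?addr_ge0 // ler_wpM2r // lerDl.
Qed.

End LyapunovFunctions.

(** * Scalar inequalities for the weighted sum *)

Section Cascade.
Variable R : realType.

Lemma cascade_gains (k1 k2 ax aR aq af : R) : 0 <= k1 -> 0 <= k2 ->
  0 < ax -> 0 < aR -> 0 < aq -> 0 < af ->
  exists A F al : R, [/\ 1 <= A, 1 <= F, 0 < al &
    forall sx sR sq sf Dx DR Dq Df : R, 0 <= sx -> 0 <= sR -> 0 <= sq -> 0 <= sf ->
      Dx + DR <= - ax * sx - aR * sR + k1 * (sq + sf) ->
      Dq <= - aq * sq + k2 * sf -> Df <= - af * sf ->
      Dx + DR + A * Dq + F * Df <= - al * (sx + sR + sq + sf)].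
Proof.
move=> k10 k20 ax0 aR0 aq0 af0.
(* [A aq] exceeds the coupling [k1] by [aq], and [F af] exceeds the total coupling [k1 + A k2] by
   [af]: each stage pays for those it perturbs and keeps its own rate. *)
pose A := 1 + k1 / aq; pose F := 1 + (k1 + A * k2) / af.
have A1 : 1 <= A by rewrite lerDl divr_ge0 // ltW.
have A0 : 0 <= A by apply: le_trans A1.
have F1 : 1 <= F by rewrite lerDl divr_ge0 ?addr_ge0 ?mulr_ge0 // ltW.
have F0 : 0 <= F by apply: le_trans F1.
have AE : A * aq = aq + k1 by rewrite mulrDl mul1r divfK // gt_eqF.
have FE : F * af = af + k1 + A * k2 by rewrite mulrDl mul1r divfK ?addrA // gt_eqF.
pose al := Num.min (Num.min ax aR) (Num.min aq af).
have [[m1 m2] [m3 m4]] : (al <= ax /\ al <= aR) /\ (al <= aq /\ al <= af).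
  by rewrite /al !ge_min !lexx ?orbT.
have al0 : 0 < al by rewrite /al !lt_min ax0 aR0 aq0 af0.
exists A, F, al; split=> // sx sR sq sf Dx DR Dq Df sx0 sR0 sq0 sf0 h1 h2 h3.
have h2' := ler_wpM2l A0 h2; have h3' := ler_wpM2l F0 h3.
have e2 : A * (- aq * sq + k2 * sf) = - (aq + k1) * sq + A * k2 * sf by rewrite -AE; ring.
have e3 : F * (- af * sf) = - (af + k1 + A * k2) * sf by rewrite -FE; ring.
rewrite e2 in h2'; rewrite e3 in h3'.
have g1 := ler_wpM2r sx0 m1; have g2 := ler_wpM2r sR0 m2.
have g3 := ler_wpM2r sq0 m3; have g4 := ler_wpM2r sf0 m4.
lra.
Qed.

Lemma half_lower (b x u y : R) : 0 < b -> 0 <= y -> x <= 2 * u ->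
  b / 2 * (x + y) <= b * (u + y).
Proof. by move=> b0 y0 xu; rewrite -mulrA ler_pM2l //; lra. Qed.

Lemma weighted_upper (a1 a2 a3 a4 A F z1 z2 z3 z4 v1 v2 v3 v4 : R) :
  0 < a1 -> 0 < a2 -> 0 < a3 -> 0 < a4 -> 0 < A -> 0 < F ->
  0 <= z1 -> 0 <= z2 -> 0 <= z3 -> 0 <= z4 ->
  v1 <= a1 * z1 -> v2 <= a2 * z2 -> v3 <= a3 * z3 -> v4 <= a4 * z4 ->
  v1 + v2 + A * v3 + F * v4 <=
    (a1 + a2 + A * a3 + F * a4) * (z1 + z2 + z3 + z4).
Proof.
move=> p1 p2 p3 p4 A0 F0 q1 q2 q3 q4 h1 h2 h3 h4.
have h3' : A * v3 <= A * (a3 * z3) by rewrite ler_pM2l.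
have h4' : F * v4 <= F * (a4 * z4) by rewrite ler_pM2l.
have nn (a z : R) : 0 < a -> 0 <= z -> 0 <= a * z by move=> a0 z0; rewrite mulr_ge0 // ltW.
have Aa := mulr_gt0 A0 p3; have Fa := mulr_gt0 F0 p4.
have := nn _ _ p1 q2; have := nn _ _ p1 q3; have := nn _ _ p1 q4.
have := nn _ _ p2 q1; have := nn _ _ p2 q3; have := nn _ _ p2 q4.
have := nn _ _ Aa q1; have := nn _ _ Aa q2; have := nn _ _ Aa q4.
have := nn _ _ Fa q1; have := nn _ _ Fa q2; have := nn _ _ Fa q3.
lra.
Qed.

Lemma weighted_lower (b z1 z2 z3 z4 v1 v2 v3 v4 u3 u4 : R) :
  b * z1 <= v1 -> b * z2 <= v2 -> b * z3 <= v3 -> b * z4 <= v4 ->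
  v3 <= u3 -> v4 <= u4 -> b * (z1 + z2 + z3 + z4) <= v1 + v2 + u3 + u4.
Proof. by move=> *; lra. Qed.

Lemma weighted_parts (c v1 v2 v3 v4 u3 u4 : R) :
  0 <= v1 -> 0 <= v2 -> 0 <= v3 -> 0 <= v4 -> v3 <= u3 -> v4 <= u4 ->
  v1 + v2 + u3 + u4 < c -> [/\ v1 <= c, v2 <= c, v3 <= c & v4 <= c].
Proof. by move=> *; split; lra. Qed.

Lemma small_parts (r u y : R) : 0 < r -> r <= 1 -> 0 <= u -> 0 <= y ->
  u + y ^+ 2 <= r ^+ 2 / 2 -> [/\ u <= r ^+ 2 / 2, u <= 1 & y <= r].
Proof.
move=> r0 r1 u0 y0 h; have y2 := sqr_ge0 y.
have r2 : r ^+ 2 <= 1 by rewrite expr_le1 // ltW.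
split; [lra|lra|]; rewrite -(ler_pXn2r (n := 2)) ?nnegrE //; [have := sqr_ge0 r; lra|exact: ltW].
Qed.

Lemma cross_terms (Mx MR G1 G2 N M2 q y sq sf : R) : 0 <= Mx -> 0 <= MR ->
  0 <= N -> 0 <= M2 -> 0 <= sq -> 0 <= sf -> q ^+ 2 <= N * sq -> y ^+ 2 <= M2 * sf ->
  Mx * (G1 * (q + y)) ^+ 2 + MR * (G2 * (q + y)) ^+ 2 <=
    2 * (Mx * G1 ^+ 2 + MR * G2 ^+ 2) * (N + M2) * (sq + sf).
Proof.
move=> Mx0 MR0 N0 M20 sq0 sf0 hq hy.
have -> : Mx * (G1 * (q + y)) ^+ 2 + MR * (G2 * (q + y)) ^+ 2 =
  (Mx * G1 ^+ 2 + MR * G2 ^+ 2) * (q + y) ^+ 2 by ring.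
have W0 : 0 <= Mx * G1 ^+ 2 + MR * G2 ^+ 2.
  by apply: addr_ge0; apply: mulr_ge0; rewrite ?sqr_ge0.
have h : (q + y) ^+ 2 <= 2 * ((N + M2) * (sq + sf)).
  have := sqr_ge0 (q - y); have : 0 <= N * sf by exact: mulr_ge0.
  by have : 0 <= M2 * sq by [exact: mulr_ge0]; lra.
move: (Mx * G1 ^+ 2 + MR * G2 ^+ 2) W0 => W W0.
by have := ler_wpM2l W0 h; lra.
Qed.

Lemma payload_input (m M C Q Y g a : R) : 0 < m -> 0 <= M -> 0 <= C -> 0 <= Q -> 0 <= Y ->
  g <= M * Q -> a <= C * Y -> m^-1 * g + a <= (M / m + C) * (Q + Y).
Proof.
move=> m0 M0 C0 Q0 Y0 hg ha.
have hg' : m^-1 * g <= m^-1 * (M * Q) by rewrite ler_pM2l ?invr_gt0.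
have n1 : 0 <= M / m * Y by rewrite mulr_ge0 // divr_ge0 // ltW.
have n2 : 0 <= C * Q by exact: mulr_ge0.
have -> : (M / m + C) * (Q + Y) = m^-1 * (M * Q) + M / m * Y + C * Q + C * Y by ring.
lra.
Qed.

Lemma payload_moment (c M C Q Y g a : R) : 0 <= c -> 0 <= M -> 0 <= C -> 0 <= Q -> 0 <= Y ->
  g <= M * Q -> a <= C * Y -> c * (g + a) <= c * (M + C) * (Q + Y).
Proof.
move=> c0 M0 C0 Q0 Y0 hg ha; rewrite -mulrA ler_wpM2l //.
have n1 : 0 <= M * Y by exact: mulr_ge0.
have n2 : 0 <= C * Q by exact: mulr_ge0.
lra.
Qed.

Lemma sum_estimates (ax aR sx sR Dx DR Mx MR h1 h2 k : R) :
  Dx <= - ax * sx + Mx * h1 ^+ 2 -> DR <= - aR * sR + MR * h2 ^+ 2 ->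
  Mx * h1 ^+ 2 + MR * h2 ^+ 2 <= k -> Dx + DR <= - ax * sx - aR * sR + k.
Proof. by move=> *; lra. Qed.

End Cascade.

Section Stability.
Variables (R : realType) (n : nat) (P : plant R n) (K : gains R) (D : commands R n).
Hypotheses (hP : plant_ok P) (hK : gains_ok K) (hD : commands_smooth D).
Hypotheses (hB : commands_bounded D) (hT : desired_motion_regular P K D).
Variable eps : R.
Hypothesis e0 : 0 < eps.

Notation ex S s := (e_x0 D s (pl (S s))).
Notation ev S s := (e_v0 D s (pl (S s))).
Notation eR0 S s := (e_R0 D s (pl (S s))).
Notation eW0 S s := (e_W0 D s (pl (S s))).
Notation eq S i s := (e_q P K D s (pl (S s)) (lq (S s)) i).
Notation ew S i s := (e_w P K D s (pl (S s)) (lq (S s)) (lw (S s)) i).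
Notation eR S i s := (e_R P K D S i s).
Notation eW S i s := (e_W P K D S i s).
Notation Psi0 S s := (payload_Psi D S s).
Notation Psiq S i s := (quad_Psi P K D S i s).
Notation psi S i s := (link_psi P K D S i s).

Implicit Types (S : R -> state R n) (t : R) (i : 'I_n).

Definition sqerr_x S t := enorm (ex S t) ^+ 2 + enorm (ev S t) ^+ 2.
Definition sqerr_R S t := enorm (eR0 S t) ^+ 2 + enorm (eW0 S t) ^+ 2.
Definition sqerr_q S t := \sum_i (enorm (eq S i t) ^+ 2 + enorm (ew S i t) ^+ 2).
Definition sqerr_f S t := \sum_i (enorm (eR S i t) ^+ 2 + enorm (eW S i t) ^+ 2).

Lemma err_norm_sqr S t : err_norm P K D S t ^+ 2 = sqerr_x S t + sqerr_R S t + sqerr_q S t + sqerr_f S t.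
Proof.
rewrite /err_norm sqr_sqrtr; last first.
  by rewrite !addr_ge0 ?sqr_ge0 ?sumr_ge0 // => i _; rewrite !addr_ge0 ?sqr_ge0.
rewrite /sqerr_x /sqerr_R /sqerr_q /sqerr_f -[RHS]addrA -big_split /= !addrA; congr (_ + _).
by apply: eq_bigr => i _; rewrite addrA.
Qed.

Lemma sqerr_ge0 S t : [/\ 0 <= sqerr_x S t, 0 <= sqerr_R S t, 0 <= sqerr_q S t & 0 <= sqerr_f S t].
Proof.
by split; rewrite ?addr_ge0 ?sqr_ge0 // sumr_ge0 // => i _; rewrite addr_ge0 ?sqr_ge0.
Qed.

Lemma err_norm_ge0 S t : 0 <= err_norm P K D S t. Proof. exact: sqrtr_ge0. Qed.

Lemma e_R0_le S t : SO3 ((R0d D t)^T *m pR (pl (S t))) -> enorm (eR0 S t) ^+ 2 <= 2 * Psi0 S t.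
Proof. by move=> h; rewrite /e_R0 att_errE; exact: rot_err_le. Qed.

Lemma e_R_le S i t : SO3 ((R_c P K D S i t)^T *m qR (S t) i) ->
  enorm (eR S i t) ^+ 2 <= 2 * Psiq S i t.
Proof. by move=> h; rewrite /e_R att_errE; exact: rot_err_le. Qed.

Lemma le_e_R S i t : SO3 ((R_c P K D S i t)^T *m qR (S t) i) -> Psiq S i t <= 1 ->
  Psiq S i t <= enorm (eR S i t) ^+ 2.
Proof. by move=> h; rewrite /e_R att_errE; exact: Psi_le. Qed.

Lemma Psi0_ge0 S t : SO3 ((R0d D t)^T *m pR (pl (S t))) -> 0 <= Psi0 S t.
Proof. exact: Psi_ge0. Qed.

Lemma Psiq_ge0 S i t : SO3 ((R_c P K D S i t)^T *m qR (S t) i) -> 0 <= Psiq S i t.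
Proof. exact: Psi_ge0. Qed.

(* Keeps [done] from normalizing the control law. *)
#[local] Opaque lyap_x lyap_R lyap_q lyap_f payload_Psi quad_Psi link_psi.
#[local] Opaque e_q e_w e_R e_W e_x0 e_v0 e_R0 e_W0.

(* The perturbations feed the cascade downwards only: the attitude errors of
   the quadrotors act on the links, and both act on the payload. *)
Lemma lyapunov_function : exists (V : (R -> state R n) -> R -> R) (c0 lam b1 b2 : R),
  [/\ 0 < c0, 0 < lam, 0 < b1 & 0 < b2] /\
  forall S a b, closed_loop P K D S eps a b -> forall t, a < t < b ->
  [/\ derivable (V S) t 1,
      b1 * err_norm P K D S t ^+ 2 <= V S t,
      [/\ Psi0 S t <= 1, forall i, psi S i t <= 1 & forall i, Psiq S i t <= 1] ->
        V S t <= b2 * err_norm P K D S t ^+ 2 &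
      0 <= t -> V S t < c0 -> derive1 (V S) t <= - lam * V S t].
Proof.
have [r [k [M [[r0 r1 k0 M0] hreg]]]] := region_bounds hD hB hT.
have [B B0 hb] := commands_bound hB hT.
have [C C0 hacc] := acc_err_bound K D hP.
have [cx [ax [bx [Bx [Mx [[ax0 bx0 Bx0 Mx0] hx]]]]]] := lyap_x_spec hP hK hD eps.
have [cR [aR [bR [BR [MR [cg [[aR0 bR0 BR0 MR0 cg0] hR]]]]]]] := lyap_R_spec hP hK hD eps B0.
have [cq [aq [bq [Bq [Mq [[aq0 bq0 Bq0 Mq0] hq]]]]]] := lyap_q_spec hP hK hD eps k0 M0 C0 hreg.
have [cf [af [bf [Bf [[af0 bf0 Bf0] hf]]]]] := lyap_f_spec D hP hK e0.
pose N : R := n%:R; have N0 : 0 <= N by exact: ler0n.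
have m0P : 0 < m0 P by case: hP.
pose G1 := M / m0 P + C; pose G2 := cg * (M + C).
have Mm0 : 0 <= M / m0 P by rewrite divr_ge0 // ltW.
have G10 : 0 <= G1 by exact: addr_ge0.
have G20 : 0 <= G2 by rewrite mulr_ge0 ?addr_ge0.
(* By Cauchy-Schwarz, [M2] times the squared quadrotor errors bounds the square of the total force
   bound [Y] introduced below. *)
pose M2 := (2 * M) ^+ 2 * N.
have M20 : 0 <= M2 by rewrite mulr_ge0 ?sqr_ge0.
pose k1 := 2 * (Mx * G1 ^+ 2 + MR * G2 ^+ 2) * (N + M2).
have W0 : 0 <= Mx * G1 ^+ 2 + MR * G2 ^+ 2 by apply: addr_ge0; apply: mulr_ge0; rewrite ?sqr_ge0 //; exact: ltW.
have k10 : 0 <= k1 by apply: mulr_ge0; [exact: mulr_ge0|exact: addr_ge0].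
pose k2 := N * (Mq * M2).
have k20 : 0 <= k2 by apply: mulr_ge0 => //; apply: mulr_ge0 => //; exact: ltW.
have [A [F [al [A1 F1 al0 hcas]]]] := cascade_gains k10 k20 ax0 aR0 aq0 af0.
have [A0 F0] : 0 < A /\ 0 < F by rewrite !(lt_le_trans ltr01).
pose b0 := Num.min (Num.min bx bR) (Num.min bq bf).
have [[m1 m2] [m3 m4]] : (b0 <= bx /\ b0 <= bR) /\ (b0 <= bq /\ b0 <= bf).
  by rewrite /b0 !ge_min !lexx ?orbT.
have b00 : 0 < b0 by rewrite /b0 !lt_min bx0 bR0 bq0 bf0.
pose Bt := Bx + BR + A * Bq + F * Bf.
have Bt0 : 0 < Bt by rewrite !addr_gt0 ?mulr_gt0.
(* Below this level each part satisfies [u + y^2 <= r^2 / 2], with [u] its potential and [y] its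
   velocity error. The half matches the potential [|ex|^2 / 2], so the payload is within
   [near_desired] of radius [r]. *)
pose c0 := b0 * (r ^+ 2 / 2).
have r20 : 0 < r ^+ 2 / 2 by rewrite divr_gt0 ?exprn_gt0.
exists (fun S s => lyap_x K D cx S s + lyap_R P K D cR S s
  + A * (\sum_i lyap_q P K D cq S i s) + F * (\sum_i lyap_f P K D eps cf S i s)).
exists c0, (al / Bt), (b0 / 2), Bt.
split; first by split; rewrite ?mulr_gt0 ?divr_gt0 ?invr_gt0.
move=> S a b hcl t tab; rewrite err_norm_sqr.
have [s1 s2 s3 s4] := sqerr_ge0 S t.
have [dx lx ux vx] := hx S a b t hcl tab.
have [dR lR uR vR] := hR S a b t hcl tab.
have hqi i := hq S a b t i hcl tab.
have hfi i := hf S a b t i hcl tab.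
have [hlaw [[hM hk hv] [hT1 hT2 hl _]]] := hcl t tab.
have mu0 i : mu_d P K D t (pl (S t)) i != 0 by case: (hlaw i).
have sR0 : SO3 (pR (pl (S t))) by case: hM.
have sRd : SO3 (R0d D t) by case: hD => _ /(_ t)[].
have hS2 j : S2 (lq (S t) j) by case: hM => _ /(_ j)[].
have sQ0 : SO3 ((R0d D t)^T *m pR (pl (S t))) by apply: SO3_mul => //; exact: SO3_trmx.
have sQi i : SO3 ((R_c P K D S i t)^T *m qR (S t) i).
  apply: SO3_mul; first by apply: SO3_trmx; case: (hlaw i).
  by case: hM => _ /(_ i)[].
have P0 : 0 <= Psi0 S t by exact: Psi0_ge0.
have Pi i : 0 <= Psiq S i t by exact: Psiq_ge0 (sQi i).
have pq i := psi_facts (hS2 i) (mu0 i).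
have low (c z V : R) : b0 <= c -> 0 <= z -> c * z <= V -> b0 * z <= V.
  by move=> bc z0; apply: le_trans; rewrite ler_wpM2r.
have nn (z V : R) : 0 <= z -> b0 * z <= V -> 0 <= V.
  by move=> z0; apply: le_trans; rewrite mulr_ge0 // ltW.
have sum0 (u v : R) : 0 <= u -> 0 <= u + v ^+ 2.
  by move=> u0; rewrite addr_ge0 ?sqr_ge0.
have x0 : 0 <= 2^-1 * enorm (ex S t) ^+ 2 by rewrite mulr_ge0 ?sqr_ge0 ?invr_ge0.
have p0 i : 0 <= psi S i t by case: (pq i).
have lower : b0 * (2^-1 * enorm (ex S t) ^+ 2 + enorm (ev S t) ^+ 2) <= lyap_x K D cx S t.
  exact: low _ _ _ m1 (sum0 _ _ x0) lx.
have lowerR : b0 * (Psi0 S t + enorm (eW0 S t) ^+ 2) <= lyap_R P K D cR S t.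
  exact: low _ _ _ m2 (sum0 _ _ P0) lR.
have lowerq i : b0 * (psi S i t + enorm (ew S i t) ^+ 2) <= lyap_q P K D cq S i t.
  by have [_ l _ _] := hqi i; exact: low _ _ _ m3 (sum0 _ _ (p0 i)) l.
have lowerf i : b0 * (Psiq S i t + enorm (eW S i t) ^+ 2) <= lyap_f P K D eps cf S i t.
  by have [_ l _ _] := hfi i; exact: low _ _ _ m4 (sum0 _ _ (Pi i)) l.
have Vx0 : 0 <= lyap_x K D cx S t := nn _ _ (sum0 _ _ x0) lower.
have VR0 : 0 <= lyap_R P K D cR S t := nn _ _ (sum0 _ _ P0) lowerR.
have Vq0 i : 0 <= lyap_q P K D cq S i t := nn _ _ (sum0 _ _ (p0 i)) (lowerq i).
have Vf0 i : 0 <= lyap_f P K D eps cf S i t := nn _ _ (sum0 _ _ (Pi i)) (lowerf i).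
have SVq0 : 0 <= \sum_i lyap_q P K D cq S i t by apply: sumr_ge0 => i _; exact: Vq0.
have SVf0 : 0 <= \sum_i lyap_f P K D eps cf S i t by apply: sumr_ge0 => i _; exact: Vf0.
have AV : \sum_i lyap_q P K D cq S i t <= A * (\sum_i lyap_q P K D cq S i t).
  by rewrite ler_peMl.
have FV : \sum_i lyap_f P K D eps cf S i t <= F * (\sum_i lyap_f P K D eps cf S i t).
  by rewrite ler_peMl.
have dq i : derivable (lyap_q P K D cq S i) t 1 by case: (hqi i).
have df i : derivable (lyap_f P K D eps cf S i) t 1 by case: (hfi i).
have dV := is_derive_combination F (is_derive_combination A
    (is_derive_add (derivable_is_derive1 dx) (derivable_is_derive1 dR))
    (is_derive_bigsum (fun i => derivable_is_derive1 (dq i))))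
  (is_derive_bigsum (fun i => derivable_is_derive1 (df i))).
have upper : [/\ Psi0 S t <= 1, forall i, psi S i t <= 1 & forall i, Psiq S i t <= 1] ->
    lyap_x K D cx S t + lyap_R P K D cR S t + A * (\sum_i lyap_q P K D cq S i t)
    + F * (\sum_i lyap_f P K D eps cf S i t) <= Bt * (sqerr_x S t + sqerr_R S t + sqerr_q S t + sqerr_f S t).
  move=> [p1 p2 p3].
  have u1 : lyap_x K D cx S t <= Bx * sqerr_x S t := ux.
  have u2 : lyap_R P K D cR S t <= BR * sqerr_R S t := uR p1.
  have u3 : \sum_i lyap_q P K D cq S i t <= Bq * sqerr_q S t.
    by rewrite mulr_sumr; apply: ler_sum => i _; have [_ _ u _] := hqi i; exact: u.
  have u4 : \sum_i lyap_f P K D eps cf S i t <= Bf * sqerr_f S t.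
    by rewrite mulr_sumr; apply: ler_sum => i _; have [_ _ u _] := hfi i; exact: u.
  exact: (weighted_upper Bx0 BR0 Bq0 Bf0 A0 F0 s1 s2 s3 s4 u1 u2 u3 u4).
split; [by case: dV| |exact: upper|].
  apply: weighted_lower AV FV.
  - apply: le_trans lower; apply: half_lower; rewrite ?sqr_ge0 //.
    by rewrite mulrA mulfV ?mul1r // pnatr_eq0.
  - apply: le_trans lowerR; apply: half_lower; rewrite ?sqr_ge0 //.
    exact: e_R0_le.
  - rewrite mulr_sumr; apply: ler_sum => i _.
    apply: le_trans (lowerq i); apply: half_lower; rewrite ?sqr_ge0 //.
    have [q0 ->] := pq i; rewrite mulrC ler_wpM2r // lerBlDr lerDl.
    exact: q0.
  - rewrite mulr_sumr; apply: ler_sum => i _.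
    apply: le_trans (lowerf i); apply: half_lower; rewrite ?sqr_ge0 //.
    exact: e_R_le (sQi i).
move=> t0 Vc.
have [Vxc VRc SVqc SVfc] := weighted_parts Vx0 VR0 SVq0 SVf0 AV FV Vc.
have Vqc i : lyap_q P K D cq S i t <= c0.
  apply: le_trans SVqc; rewrite (bigD1 i) //= lerDl; apply: sumr_ge0 => j _; exact: Vq0.
have Vfc i : lyap_f P K D eps cf S i t <= c0.
  apply: le_trans SVfc; rewrite (bigD1 i) //= lerDl; apply: sumr_ge0 => j _; exact: Vf0.
have small (u y : R) : 0 <= u -> 0 <= y -> b0 * (u + y ^+ 2) <= c0 ->
    [/\ u <= r ^+ 2 / 2, u <= 1 & y <= r].
  by move=> u0 y0; rewrite /c0 ler_pM2l //; exact: small_parts.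
have [gx1 _ gx2] := small _ _ x0 (enorm_ge0 _) (le_trans lower Vxc).
have [gR1 gR2 gR3] := small _ _ P0 (enorm_ge0 _) (le_trans lowerR VRc).
have gq i := small _ _ (p0 i) (enorm_ge0 _) (le_trans (lowerq i) (Vqc i)).
have gf i := small _ _ (Pi i) (enorm_ge0 _) (le_trans (lowerf i) (Vfc i)).
have exr : enorm (ex S t) <= r.
  rewrite -(ler_pXn2r (n := 2)) ?nnegrE ?enorm_ge0 //; last exact: ltW.
  by rewrite mulrC ler_pM2r ?invr_gt0 // in gx1.
have Psir : Psi0 S t <= r ^+ 2.
  by apply: le_trans gR1 _; rewrite ler_pdivrMr // ler_peMr ?sqr_ge0 // ler1n.
have near : near_desired D r t (pl (S t)) by split.
have psi1 i : psi S i t <= 1 by case: (gq i).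
have Psiq1 i : Psiq S i t <= 1 by case: (gf i).
have ew1 i : enorm (ew S i t) <= 1 by case: (gq i) => _ _ h; apply: le_trans h r1.
have usM i : enorm (us P K D S i t) <= M.
  have [DQ [DW [_ hbd]]] := hreg i.
  by have [_ _ _ h _] := hbd t (pl (S t)) (lq (S t)) (lw (S t)) t0 near hS2; exact: h.
have muM i : enorm (mu_d P K D t (pl (S t)) i) <= M.
  have [DQ [DW [_ hbd]]] := hreg i.
  by have [_ h _ _ _] := hbd t (pl (S t)) (lq (S t)) (lw (S t)) t0 near hS2.
pose X := \sum_i enorm (force_err P K D S t i).
pose Y := 2 * M * \sum_i enorm (eR S i t).
pose Q := \sum_i enorm (eq S i t).
(* [force_err_le] involves the square root of [Psi], which is at most [|e_R|] as long as
   [Psi <= 1]. *)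
have fe i : enorm (force_err P K D S t i) <= 2 * M * enorm (eR S i t).
  apply: le_trans (force_err_le hcl tab i) _; rewrite mulrCA -mulrA.
  apply: ler_wpM2l => //; apply: ler_pM; rewrite ?enorm_ge0 ?sqrtr_ge0 //.
  rewrite -[leRHS]ger0_norm ?enorm_ge0 // -sqrtr_sqr; apply: ler_wsqrtr.
  exact: le_e_R (sQi i) (Psiq1 i).
have XY : X <= Y by rewrite /Y mulr_sumr; apply: ler_sum => i _; exact: fe.
have X0 : 0 <= X by apply: sumr_ge0 => i _; exact: enorm_ge0.
have Y0 : 0 <= Y by exact: le_trans X0 XY.
have Q0 : 0 <= Q by apply: sumr_ge0 => i _; exact: enorm_ge0.
have feY i : enorm (force_err P K D S t i) <= Y.
  apply: le_trans XY; rewrite /X (bigD1 i) //= lerDl.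
  by apply: sumr_ge0 => j _; exact: enorm_ge0.
have CXY : C * X <= C * Y by rewrite ler_wpM2l.
have [a1 a2 a3] := hacc S t hM hT1 hT2.
have accY := le_trans a1 CXY; have angY := le_trans a2 CXY.
have ptY i := le_trans (a3 i) CXY.
have gapQ : \sum_j enorm (gap P K D S t j) <= M * Q.
  rewrite /Q mulr_sumr; apply: ler_sum => j _.
  apply: le_trans (gap_le hM (mu0 j)) _; rewrite ler_wpM2r ?enorm_ge0 //; exact: muM.
have QY0 : 0 <= Q + Y by exact: addr_ge0.
have h1 : (m0 P)^-1 * \sum_j enorm (gap P K D S t j) + enorm (acc_err P K D S t) <= G1 * (Q + Y).
  exact: payload_input.
have h2 : cg * (\sum_j enorm (gap P K D S t j) + enorm (ang_err P K D S t)) <= G2 * (Q + Y).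
  exact: payload_moment.
have W0B : enorm (W0d D t) <= B by have [_] := hb t 0%N t0 isT.
have Dx := vx _ h1; have DR := vR _ W0B (le_trans gR3 r1) h2.
have Q2 : Q ^+ 2 <= N * sqerr_q S t.
  apply: le_trans (sqr_sum_le _) _; rewrite ler_wpM2l //.
  by apply: ler_sum => i _; rewrite lerDl sqr_ge0.
have Y2 : Y ^+ 2 <= M2 * sqerr_f S t.
  rewrite /Y exprMn /M2 -mulrA ler_wpM2l ?sqr_ge0 //.
  apply: le_trans (sqr_sum_le _) _; rewrite ler_wpM2l //.
  by apply: ler_sum => i _; rewrite lerDl sqr_ge0.
have DxR : derive1 (lyap_x K D cx S) t + derive1 (lyap_R P K D cR S) t <=
    - ax * sqerr_x S t - aR * sqerr_R S t + k1 * (sqerr_q S t + sqerr_f S t).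
  have ct := cross_terms G1 G2 (ltW Mx0) (ltW MR0) N0 M20 s3 s4 Q2 Y2.
  exact: sum_estimates Dx DR ct.
have Dq : \sum_i derive1 (lyap_q P K D cq S i) t <= - aq * sqerr_q S t + k2 * sqerr_f S t.
  apply: (@le_trans _ _ (\sum_i (- aq * (enorm (eq S i t) ^+ 2 + enorm (ew S i t) ^+ 2)
      + Mq * Y ^+ 2))).
    apply: ler_sum => i _; have [_ _ _ h] := hqi i.
    exact: h t0 near accY angY (ptY i) (feY i).
  rewrite big_split /= -mulr_sumr lerD2l sumr_const card_ord -mulr_natl -/N.
  have h := ler_wpM2l N0 (ler_wpM2l (ltW Mq0) Y2).
  by apply: le_trans h _; rewrite /k2 !mulrA.
have Df : \sum_i derive1 (lyap_f P K D eps cf S i) t <= - af * sqerr_f S t.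
  by rewrite mulr_sumr; apply: ler_sum => i _; have [_ _ _ h] := hfi i.
have := hcas _ _ _ _ _ _ _ _ s1 s2 s3 s4 DxR Dq Df.
rewrite (is_derive_derive1 dV) => /le_trans; apply.
(* The decay obtained is in terms of the squared errors; the upper bound on the weighted sum, valid
   in this region, converts it into a rate [al / Bt]. *)
rewrite !mulNr lerN2 mulrAC ler_pdivrMr // -[leRHS]mulrA ler_pM2l // [leRHS]mulrC.
by apply: upper; split.
Qed.

End Stability.

Lemma Psi_near (R : realType) (A B : 'M[R]_3) : SO3 A -> SO3 B -> `|B - A| <= 2^-1 ->
  Psi (A^T *m B) <= 1.
Proof.
move=> hA hB h; apply: le_trans (Psi_small (e := 2^-1) hA hB _) _ => [i j|].
  by apply: le_trans h; rewrite distrC; have := mx_entry_le (B - A) i j; rewrite !mxE.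
by rewrite expr2; lra.
Qed.

Lemma psi_near (R : realType) (x y : 'cV[R]_3) : dot x x = 1 -> dot y y = 1 ->
  enorm (x - y) <= 2^-1 -> 1 - dot x y <= 1.
Proof.
move=> hx hy h.
have : enorm (x - y) ^+ 2 <= 2^-1 ^+ 2 by rewrite ler_pXn2r // ?nnegrE ?enorm_ge0 ?invr_ge0.
rewrite enorm2 dotBl !dotBr hx hy (dotC y) expr2; lra.
Qed.

(** Passing from the quadratic function to the norm takes a square root, which halves the rate. *)
Lemma norm_decay (R : realType) (b1 b2 lam s x y v w : R) : 0 < b1 -> 0 < b2 ->
  0 <= x -> 0 <= y -> b1 * x ^+ 2 <= v -> v <= expR (- (lam * s)) * w ->
  w <= b2 * y ^+ 2 -> x <= Num.sqrt (b2 / b1) * expR (- (lam / 2 * s)) * y.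
Proof.
move=> b10 b20 x0 y0 xv vw wy.
have C0 : 0 <= b2 / b1 by rewrite divr_ge0 // ltW.
rewrite -(ler_pXn2r (n := 2)) ?nnegrE ?mulr_ge0 ?sqrtr_ge0 ?expR_ge0 //.
rewrite !exprMn sqr_sqrtr // -expRM_natl.
have -> : 2%:R * (- (lam / 2 * s)) = - (lam * s) by field.
rewrite -(ler_pM2l b10); apply: le_trans xv _; apply: le_trans vw _.
have -> : b1 * (b2 / b1 * expR (- (lam * s)) * y ^+ 2) = expR (- (lam * s)) * (b2 * y ^+ 2).
  by field; rewrite gt_eqF.
by rewrite ler_wpM2l ?expR_ge0.
Qed.

Lemma closed_loop_stable (R : realType) n (P : plant R n) (K : gains R) (D : commands R n) eps :
  plant_ok P -> gains_ok K -> commands_smooth D -> commands_bounded D ->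
  desired_motion_regular P K D -> 0 < eps -> exponentially_stable P K D eps.
Proof.
move=> hP hK hD hB hT e0.
have [V [c0 [lam [b1 [b2 [[c00 lam0 b10 b20] hV]]]]]] := lyapunov_function hP hK hD hB hT e0.
(* The bound [1/2] puts the configurations where the upper bound on [V] holds. As the initial error
   is also below 1, its square is at most itself, so [c0 / b2] ensures that [V] starts below
   [c0]. *)
pose delta := Num.min 2^-1 (c0 / b2).
have d0 : 0 < delta by rewrite /delta lt_min invr_gt0 ltr0n divr_gt0.
have [d1 d2] : delta <= 2^-1 /\ delta <= c0 / b2 by rewrite /delta !ge_min !lexx orbT.
exists delta, (Num.sqrt (b2 / b1)), (lam / 2); split=> //.
- by rewrite sqrtr_gt0 divr_gt0.
- by rewrite divr_gt0.
move=> a b t0 S t00 /andP[at0 t0b] hcl [he hR hq] t tb.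
have [t0t ttb] := andP tb.
have ab s : t0 <= s < b -> a < s < b.
  by move=> /andP[t0s ->]; rewrite (lt_le_trans at0).
have t0ab : a < t0 < b by rewrite at0.
have [dV0 lV0 uV0 _] := hV S a b hcl t0 t0ab.
have [hlaw [[hM _ _] _]] := hcl t0 t0ab.
have small : [/\ payload_Psi D S t0 <= 1, forall i, link_psi P K D S i t0 <= 1 &
    forall i, quad_Psi P K D S i t0 <= 1].
  have [sR hi] := hM.
  have sRd : SO3 (R0d D t0) by case: hD => _ /(_ t0)[].
  split=> [|i|i].
  - by apply: Psi_near => //; apply: le_trans (ltW hR) d1.
  - have [hqi _] := hq i; have [s2 _ _] := hi i; have [m0 _ _ _] := hlaw i.
    apply: psi_near; [exact: S2_dot|exact: unit_q_d|exact: le_trans (ltW hqi) d1].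
  - have [_ hqi] := hq i; have [_ _ sq] := hi i; have [_ sRc _ _] := hlaw i.
    by apply: Psi_near => //; exact: le_trans (ltW hqi) d1.
have E0 := err_norm_ge0 P K D S t0.
have Vc : V S t0 < c0.
  apply: le_lt_trans (uV0 small) _.
  have h1 : err_norm P K D S t0 < c0 / b2 by exact: lt_le_trans he d2.
  rewrite ltr_pdivlMr // mulrC in h1; apply: le_lt_trans h1.
  rewrite ler_pM2l // expr2 ler_piMl //.
  by apply: le_trans (ltW he) _; apply: le_trans d1 _; rewrite invf_le1 // ler1n.
have dec : V S t <= expR (- (lam * (t - t0))) * V S t0.
  apply: (@lyapunov_decay _ (V S) t0 b lam c0 _ _ Vc (ltW lam0) _ t tb).
  - by move=> s /ab sab; have [] := hV S a b hcl s sab.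
  - move=> s /ab sab; have [_ l _ _] := hV S a b hcl s sab.
    by apply: le_trans l; rewrite mulr_ge0 ?sqr_ge0 // ltW.
  - move=> s stb Vs; have [_ _ _ h] := hV S a b hcl s (ab _ stb).
    by apply: h => //; case/andP: stb => h _; exact: le_trans t00 h.
have [_ lV _ _] := hV S a b hcl t (ab _ tb).
exact: norm_decay b10 b20 (err_norm_ge0 _ _ _ _ _) E0 lV dec (uV0 small).
Qed.

Theorem proposition2 (R : realType) (n : nat) (P : plant R n) (K : gains R)
    (D : commands R n) (hP : plant_ok P) (hK : gains_ok K)
    (hD : commands_smooth D) (hB : commands_bounded D)
    (hT : desired_motion_regular P K D) :
  exists2 eps_star : R, 0 < eps_star &
    forall eps : R, 0 < eps -> eps < eps_star ->
      exponentially_stable P K D eps.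

Proof.
by exists 1 => // eps eps0 _; exact: closed_loop_stable.
Qed.
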